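(* Fix $q\in(2,4]$ and let $\mathcal{K}$ be a tame knot class. Assume that $\mathscr{C}(\mathcal{K})$ contains at least one $D_2$-symmetric curve. Then for every $\vartheta>0$ there exists an arclength parametrized curve $\Gamma_\vartheta\in\mathscr{C}(\mathcal{K})$ which is $D_2$-symmetric and critical for the constrained problem of minimizing $E_\vartheta$ on $\mathscr{C}(\mathcal{K})$, in the sense that $$DE_\vartheta(\Gamma_\vartheta)h+\lambda\, D\mathscr{L}(\Gamma_\vartheta)h=0\quad\text{for all } h\in W^{2,2}(\mathbb{R}/\mathbb{Z},\mathbb{R}^3),$$ where $\lambda:=E_\vartheta(\Gamma_\vartheta)$.
   Context: $\mathbb{R}/\mathbb{Z}$ is the periodic interval of length one. $\mathscr{L}(\gamma)$ denotes the length of a curve. For a regular curve $\gamma$, the bending energy is $E(\gamma)=\int_\gamma \kappa^2\,ds$ (curvature squared integrated with respect to arclength). For $q\in(2,4]$, the tangent-point energy of an absolutely continuous regular closed curve $\gamma:\mathbb{R}/\mathbb{Z}\to\mathbb{R}^3$ is $\mathrm{TP}_q(\gamma)=\int_{\mathbb{R}/\mathbb{Z}}\int_{\mathbb{R}/\mathbb{Z}} r_{tp}(\gamma(s),\gamma(t))^{-q}|\gamma'(s)||\gamma'(t)|\,ds\,dt$, where $r_{tp}(\gamma(s),\gamma(t))$ is the radius of the unique circle through $\gamma(s)$ and $\gamma(t)$ tangent to $\gamma$ at $\gamma(s)$. The total energy is $E_\vartheta=E+\vartheta\,\mathrm{TP}_q^{1/(q-2)}$ for $\vartheta>0$; it is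 continuously differentiable on the open set of injective regular closed $W^{2,2}$-curves. For a knot class $\mathcal{K}$, $\mathscr{C}(\mathcal{K})=\{\gamma\in W^{2,2}(\mathbb{R}/\mathbb{Z},\mathbb{R}^3):\mathscr{L}(\gamma)=1,\ |\gamma'|>0,\ \gamma \text{ is an embedding of knot type }\mathcal{K}\}$. A knot class is tame if it contains a polygonal (equivalently a $C^1$) representative. $D_2$-symmetry: Let $R_1=\mathrm{diag}(1,-1,-1)$, $R_2=\mathrm{diag}(-1,1,-1)$, $R_3=\mathrm{diag}(-1,-1,1)$ (rotations by $\pi$ about the coordinate axes), $R_0=\mathrm{Id}$. For $\ell>0$ define on $\mathbb{R}/\ell\mathbb{Z}$: $\psi_0^\ell(t)=t$, $\psi_1^\ell(t)=-t+\ell/2$, $\psi_2^\ell(t)=t-\ell/2$, $\psi_3^\ell(t)=-t$ (mod $\ell$). For $\gamma\in C^0(\mathbb{R}/\ell\mathbb{Z},\mathbb{R}^3)$ set $\tau^\ell_{d_i}(\gamma)(t)=R_i\gamma(\psi_i^\ell(t))$, $i=0,1,2,3$. Let $\Sigma^\ell=\{\gamma\in C^0(\mathbb{R}/\ell\mathbb{Z},\mathbb{R}^3):0<\mathscr{L}(\gamma)<\infty,\ \tau^\ell_{d_i}(\gamma)=\gamma \text{ for } i=0,1,2,3\}$. A curve on $\mathbb{R}/\mathbb{Z}$ is called $D_2$-symmetric (dihedrally symmetric) if it belongs to $\Sigma^1$. *)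

(* Defs.v *)
From HB Require Import structures.
From mathcomp Require Import all_boot all_order all_algebra.
From mathcomp Require Import all_classical all_reals all_analysis.
Set Implicit Arguments.
Unset Strict Implicit.
Unset Printing Implicit Defensive.
Import Order.TTheory GRing.Theory Num.Theory numFieldNormedType.Exports.
Local Open Scope classical_set_scope.
Local Open Scope ring_scope.

(* Vectors of R^3 are row vectors 'rV[R]_3; Euclidean structure by hand
   (the library norm on matrices is the sup norm, which only matters for
   the topology/derivatives, where all norms agree). *)
Definition dot (R : realType) (u v : 'rV[R]_3) : R := \sum_(i < 3) u 0 i * v 0 i.
Definition enorm (R : realType) (u : 'rV[R]_3) : R := Num.sqrt (dot u u).
(* |u x v|^2 written via Lagrange's identity *)
Definition cross_norm2 (R : realType) (u v : 'rV[R]_3) : R :=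
  dot u u * dot v v - (dot u v) ^+ 2.

(* closed curves R/Z -> R^3 are 1-periodic maps R -> R^3 *)
Definition periodic1 (R : realType) (g : R -> 'rV[R]_3) : Prop :=
  forall t, g (t + 1) = g t.

Definition deriv1 (R : realType) (g : R -> 'rV[R]_3) : R -> 'rV[R]_3 :=
  fun t => 'D_1 g t.

(* W^{2,2}(R/Z, R^3): periodic, differentiable, with derivative absolutely
   continuous whose (weak) derivative g2 is square integrable over a period *)
Definition W22 (R : realType) (g : R -> 'rV[R]_3) : Prop :=
  periodic1 g /\ (forall t, derivable g t 1) /\
  exists g2 : R -> 'rV[R]_3,
    periodic1 g2 /\ (forall i : 'I_3, measurable_fun setT (fun x => g2 x 0 i)) /\
    (\int[lebesgue_measure]_(x in `[0%R, 1%R]) ((enorm (g2 x)) ^+ 2)%:E < +oo)%E /\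
    forall (s t : R) (i : 'I_3), s <= t ->
      deriv1 g t 0 i - deriv1 g s 0 i =
      Rintegral lebesgue_measure `[s, t] (fun x => g2 x 0 i).

Definition curve_length (R : realType) (g : R -> 'rV[R]_3) : R :=
  Rintegral lebesgue_measure `[0%R, 1%R] (fun t => enorm (deriv1 g t)).

(* bending energy  int kappa^2 ds, kappa^2 = |g' x g''|^2/|g'|^6, ds = |g'| dt *)
Definition bending (R : realType) (g : R -> 'rV[R]_3) : R :=
  Rintegral lebesgue_measure `[0%R, 1%R]
    (fun t => cross_norm2 (deriv1 g t) (deriv1 (deriv1 g) t)
              / (enorm (deriv1 g t)) ^+ 5).

(* 1 / r_tp(x, y) for the circle through x and y tangent to tau at x:
   r_tp = |y-x|^2 / (2 dist(y, x + R tau)) ; value 0 when x = y (null set) *)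
Definition inv_rtp (R : realType) (x y tau : 'rV[R]_3) : R :=
  if x == y then 0 else
  2 * Num.sqrt (cross_norm2 tau (y - x)) / (enorm tau * dot (y - x) (y - x)).

Definition TP (R : realType) (q : R) (g : R -> 'rV[R]_3) : R :=
  fine (\int[lebesgue_measure]_(s in `[0%R, 1%R])
          \int[lebesgue_measure]_(t in `[0%R, 1%R])
            (powR (inv_rtp (g s) (g t) (deriv1 g s)) q
              * enorm (deriv1 g s) * enorm (deriv1 g t))%:E)%E.

Definition Etheta (R : realType) (q theta : R) (g : R -> 'rV[R]_3) : R :=
  bending g + theta * powR (TP q g) (1 / (q - 2)).

Definition has_dir_deriv (R : realType) (F : (R -> 'rV[R]_3) -> R)
    (g h : R -> 'rV[R]_3) (l : R) : Prop :=
  (fun e : R => (F (fun t => g t + e *: h t) - F g) / e) @ 0^' --> l.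

Definition injective_period (R : realType) (g : R -> 'rV[R]_3) : Prop :=
  forall s t : R, 0 <= s < 1 -> 0 <= t < 1 -> g s = g t -> s = t.

Definition ambient_isotopic (R : realType) (A B : set 'rV[R]_3) : Prop :=
  exists H : R -> 'rV[R]_3 -> 'rV[R]_3,
    {within [set p : R * 'rV[R]_3 | 0 <= p.1 <= 1],
       continuous (fun p : R * 'rV[R]_3 => H p.1 p.2)} /\
    (forall t : R, 0 <= t <= 1 ->
       exists Hi : 'rV[R]_3 -> 'rV[R]_3,
         cancel (H t) Hi /\ cancel Hi (H t) /\ continuous Hi) /\
    (forall x, H 0 x = x) /\ H 1 @` A = B.

(* a C^1 regular embedded closed curve: representative of a tame knot class *)
Definition C1_knot (R : realType) (k : R -> 'rV[R]_3) : Prop :=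
  periodic1 k /\ (forall t, derivable k t 1) /\ continuous (deriv1 k) /\
  (forall t, deriv1 k t != 0) /\ injective_period k.

Definition knot_type_of (R : realType) (k g : R -> 'rV[R]_3) : Prop :=
  ambient_isotopic (range k) (range g).

Definition CK (R : realType) (k g : R -> 'rV[R]_3) : Prop :=
  W22 g /\ curve_length g = 1 /\ (forall t, enorm (deriv1 g t) > 0) /\
  injective_period g /\ knot_type_of k g.

Definition rotax (R : realType) (j : nat) (v : 'rV[R]_3) : 'rV[R]_3 :=
  \row_(i < 3) (if (i : nat) == j then v 0 i else - v 0 i).

(* D_2-symmetry (invariance under tau_{d_i}, i = 1,2,3; i = 0 trivial) *)
Definition D2sym (R : realType) (g : R -> 'rV[R]_3) : Prop :=
  forall t : R,
    g t = rotax 0 (g (- t + 1 / 2)) /\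
    g t = rotax 1 (g (t - 1 / 2)) /\
    g t = rotax 2 (g (- t)).

(* Main.v *)
(* Direct method and symmetric criticality. In arclength parametrisation a bound on the
   bending energy is a [W^{2,2}]-bound, and a bound on the tangent-point energy keeps strands
   apart: at a closest pair of points that are not neighbours the chord of length [d] is
   orthogonal to the curve, and a box of side comparable to [d] around the pair contributes a
   multiple of [d^(2-q)] to the energy. Hence a minimising sequence of symmetric arclength
   curves is uniformly bi-Lipschitz and subconverges in [C^1]; both energies are lower
   semicontinuous and the knot type is stable under [C^1]-small perturbations, so a minimiser
   [G] among the symmetric curves exists. As [q <= 4], the tangent-point kernel and its first
   variation are dominated by fourth powers of means of [|g''|], which are integrable, so the
   energy is differentiable at [G]. Since length times energy is scale invariant, the first
   variation of the product vanishes in symmetric directions; the sum of an arbitrary direction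
   over its [D_2]-orbit is symmetric and has four times the derivative. *)
Require Import Defs.
From HB Require Import structures.
From mathcomp Require Import all_boot all_order all_algebra.
From mathcomp Require Import all_classical all_reals all_analysis.
From mathcomp Require Import measurable_realfun ring lra.
Set Implicit Arguments.
Unset Strict Implicit.
Unset Printing Implicit Defensive.
Import Order.TTheory GRing.Theory Num.Theory numFieldNormedType.Exports.
Local Open Scope classical_set_scope.
Local Open Scope ring_scope.

(** * Measures with a density *)

Section density.
Context d (T : measurableType d) (R : realType) (mu : {measure set T -> \bar R}).
Local Open Scope ereal_scope.

(** Four obstacles shape the proof. [W22] asks for an explicit second derivative, which neither a
    limit nor a reparametrisation hands over; regularity is therefore carried by the increment
    inequality [H1ctrl], stable under both, and turned back into a square integrable derivative by
    Riesz's criterion. [TP] applies [fine], so that an infinite energy would read as 0; finiteness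
    on bi-Lipschitz [W22] curves has to be known before an energy bound says anything, and at
    [q = 4] it is the borderline case of a fractional integral estimate. The exponent [1 / (q - 2)]
    is below 1 for [q > 3], so the chain rule for the energy wants [0 < TP]; the symmetry supplies
    it, since it makes the chord from [g 0] to [g (1 / 2)] orthogonal to the tangent at 0. Finally
    many limits are taken at once, of curves, tangents and energy distributions; along one fixed
    ultrafilter all bounded sequences converge, which replaces repeated extraction of
    subsequences. *)

Definition density (w : T -> R) of measurable_fun setT w &
    (forall x, 0 <= w x)%R := fun A : set T => \int[mu]_(x in A) (w x)%:E.

Variable w : T -> R.
Hypotheses (mw : measurable_fun setT w) (w0 : (forall x, 0 <= w x)%R).

Local Notation nu := (density mw w0).

Let nu0 : nu set0 = 0. Proof. by rewrite /density integral_set0. Qed.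

Let nu_ge0 A : 0 <= nu A.
Proof. by apply: integral_ge0 => x _; rewrite lee_fin. Qed.

Let nu_sigma : semi_sigma_additive nu.
Proof.
apply: semi_sigma_additive_nng_induced => [|x]; last by rewrite lee_fin.
exact/measurable_EFinP.
Qed.

HB.instance Definition _ := isMeasure.Build _ _ _ nu nu0 nu_ge0 nu_sigma.

Import HBNNSimple.

(** Simple functions from below and monotone convergence on both sides reduce the claim to a level
    set of a simple function, where it is the definition of [density]. *)
Lemma ge0_integral_density (g : T -> \bar R) :
  measurable_fun setT g -> (forall x, 0 <= g x) ->
  \int[nu]_x g x = \int[mu]_x (g x * (w x)%:E).
Proof.
move=> mg g0.
pose g_ := nnsfun_approx measurableT mg.
have cg x : (g_ n x)%:E @[n --> \oo] --> g x.
  by apply: cvg_nnsfun_approx => // *; exact: g0.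
have ndg x : {homo (fun n => (g_ n x)%:E) : m n / (m <= n)%N >-> m <= n}.
  by move=> m n mn; rewrite lee_fin; exact/lefP/nd_nnsfun_approx.
have mgw n : measurable_fun setT (fun x => (g_ n x)%:E * (w x)%:E).
  under eq_fun do rewrite -EFinM.
  by apply/measurable_EFinP/measurable_funM => //; exact/measurable_funP.
transitivity (limn (fun n => \int[nu]_x (g_ n x)%:E)).
  rewrite -monotone_convergence//.
  - by apply: eq_integral => x _; apply/esym/cvg_lim.
  - by move=> n; exact/measurable_EFinP/measurable_funP.
  - by move=> n y _; rewrite lee_fin.
transitivity (limn (fun n => \int[mu]_x ((g_ n x)%:E * (w x)%:E))); last first.
  rewrite -monotone_convergence//.
  - apply: eq_integral => x _; apply/cvg_lim => //.
    by apply: cvgeZr => //; exact: cg.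
  - by move=> n y _; rewrite mule_ge0// lee_fin.
  - by move=> x _ m n mn; rewrite lee_wpmul2r ?lee_fin//; exact: ndg.
congr (limn _); apply/funext => n.
have -> : \int[nu]_x (g_ n x)%:E = sintegral nu (g_ n).
  exact: (@integralT_nnsfun _ _ _ nu (g_ n)).
rewrite sintegralE.
under [RHS]eq_integral => x _.
  rewrite fimfunE -fsumEFin// ge0_mule_fsuml; last first.
    by move=> r; rewrite nnfun_muleindic_ge0.
  over.
rewrite ge0_integral_fsum//; last 2 first.
  - move=> r; under eq_fun do rewrite -EFinM.
    by apply/measurable_EFinP/measurable_funM => //; exact: measurable_funM.
  - by move=> r x _; rewrite mule_ge0 ?nnfun_muleindic_ge0// lee_fin.
apply: eq_fsbigr => r; rewrite inE => -[x _ <-].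
have mA : measurable (g_ n @^-1` [set g_ n x]) by [].
transitivity ((g_ n x)%:E * \int[mu]_(y in g_ n @^-1` [set g_ n x]) (w y)%:E).
  by [].
rewrite integral_mkcond -ge0_integralZl_EFin//=.
- apply: eq_integral => y _; rewrite EFinM -muleA; congr (_ * _).
  by rewrite patchE indicE; case: ifPn => _; rewrite ?mul1e ?mul0e.
- by move=> y _; rewrite patchE; case: ifPn; rewrite ?lee_fin.
- apply/(measurable_restrictT _ _).1 => //.
  exact/measurable_EFinP/measurable_funTS.
Qed.

End density.

(** * Change of variables on the line *)

Section change_of_variables.
Context {R : realType}.
Local Notation mu := (@lebesgue_measure R).

Lemma is_derive_continuous (f df : R -> R) :
  (forall x : R, is_derive x 1 f (df x)) -> continuous f.
Proof.
move=> h x; apply: differentiable_continuous; apply/derivable1_diffP.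
by have [] := h x.
Qed.

Lemma continuous_FTC2_cc (F f : R -> R) (a b : R) : a <= b ->
  (forall x : R, is_derive x 1 F (f x)) -> continuous f ->
  (\int[mu]_(x in `[a, b]) (f x)%:E = (F b - F a)%:E)%E.
Proof.
move=> ab dF cf; have cF := is_derive_continuous dF.
move: ab; rewrite le_eqVlt => /predU1P[->|ab].
  by rewrite subrr set_itv1 integral_set1.
rewrite (@continuous_FTC2 _ f F a b)//.
- exact: continuous_subspaceT.
- split=> [x _||].
  + by have [] := dF x.
  + exact/cvg_at_right_filter/cF.
  + exact/cvg_at_left_filter/cF.
- by move=> x _; rewrite derive1E; have [_ ->] := dF x.
Qed.

Lemma gt0_derive_mono (tau dtau : R -> R) :
  (forall x : R, is_derive x 1 tau (dtau x)) -> (forall x, 0 < dtau x) ->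
  {mono tau : x y / x <= y}.
Proof.
move=> dt t0; apply: le_mono => a b ab.
apply: (@gtr0_derive1_lt_cc _ tau a b) => //.
- by move=> x _; rewrite derive1E; have [_ ->] := dt x.
- exact/continuous_subspaceT/is_derive_continuous.
- by rewrite in_itv/= lexx ltW.
- by rewrite in_itv/= lexx ltW.
Qed.

(** Lebesgue measure and the image under [tau] of the measure with density [dtau] give half-open
    intervals the same mass, by the fundamental theorem of calculus; uniqueness of Lebesgue measure
    identifies them. *)
Lemma cov_increasing (tau dtau : R -> R) (f : R -> \bar R) (D : set R) :
  (forall x : R, is_derive x 1 tau (dtau x)) -> continuous dtau ->
  (forall x, 0 < dtau x) -> (forall y, exists x, tau x = y) ->
  measurable D -> measurable_fun setT f -> (forall x, 0 <= f x)%E ->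
  (\int[mu]_(y in D) f y =
   \int[mu]_(x in tau @^-1` D) (f (tau x) * (dtau x)%:E))%E.
Proof.
move=> dt cdt dt0 st mD mf f0.
have ct := is_derive_continuous dt.
have mono := gt0_derive_mono dt dt0.
have mtau : measurable_fun [set: measurableTypeR R] (tau : _ -> measurableTypeR R).
  exact: continuous_measurable_fun.
have mdt : measurable_fun setT (dtau : measurableTypeR R -> R).
  exact: continuous_measurable_fun.
have dt0' : forall x, 0 <= dtau x by move=> x; exact: ltW.
pose nu := density mu mdt dt0'.
have eqm A : measurable A -> mu A = pushforward nu (tau : _ -> measurableTypeR R) A.
  move=> mA; apply/lebesgue_measure_unique => //= _ [[a b] _ <-] /=.
  have [x xa] := st a; have [y yb] := st b.
  rewrite /pushforward.
  have -> : tau @^-1` `]a, b] = `]x, y]%classic.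
    apply/seteqP; split => z /=; rewrite !in_itv/= -xa -yb.
      by rewrite (leW_mono mono) mono.
    by rewrite (leW_mono mono) mono.
  rewrite lebesgue_measure_itv/= lte_fin /nu /density.
  rewrite -xa -yb (leW_mono mono); case: ifPn => [xy|].
    rewrite integral_itv_obnd_cbnd; last first.
      exact/measurable_EFinP/measurable_funTS.
    by rewrite (@continuous_FTC2_cc tau)// ltW.
  by rewrite -leNgt => yx; rewrite set_itv_ge ?integral_set0//= bnd_simp -leNgt.
rewrite integral_mkcond.
pose g := f \_ D.
have mg : measurable_fun setT g.
  by apply/(measurable_restrictT _ _).1 => //; exact: measurable_funTS.
have g0 x : (0 <= g x)%E by rewrite /g patchE; case: ifPn.
transitivity (\int[pushforward nu (tau : _ -> measurableTypeR R)]_y g y)%E.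
  by apply: eq_measure_integral => A mA _; exact: eqm.
rewrite ge0_integral_pushforward// preimage_setT.
rewrite (@ge0_integral_density _ _ _ mu _ mdt dt0' (g \o tau)).
- rewrite [RHS]integral_mkcond; apply: eq_integral => x _ /=.
  rewrite /g !patchE; case: ifPn => Dx; case: ifPn => // Dx'; rewrite ?mul0e//.
  - by move: Dx'; rewrite notin_setE /=; move: Dx; rewrite inE.
  - by move: Dx; rewrite notin_setE /=; move: Dx'; rewrite inE.
- exact: measurableT_comp.
- by move=> x; exact: g0.
Qed.

Lemma cov_opp (f : R -> \bar R) (D : set R) :
  measurable D -> measurable_fun setT f -> (forall x, 0 <= f x)%E ->
  (\int[mu]_(y in D) f y = \int[mu]_(x in -%R @^-1` D) f (- x)%R)%E.
Proof.
move=> mD mf f0.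
transitivity (\int[pushforward mu (-%R : R -> measurableTypeR R)]_(y in D) f y)%E.
  by apply: eq_measure_integral => A mA _; exact/esym/lebesgue_measureN.
by rewrite ge0_integral_pushforward//; exact: measurable_funTS.
Qed.

(* [sg] is the orientation of the substitution. *)
Lemma cov (tau dtau : R -> R) (sg : bool) (f : R -> \bar R) (D : set R) :
  (forall x : R, is_derive x 1 tau (dtau x)) -> continuous dtau ->
  (forall x, 0 < (-1) ^+ sg * dtau x) -> (forall y, exists x, tau x = y) ->
  measurable D -> measurable_fun setT f -> (forall x, 0 <= f x)%E ->
  (\int[mu]_(y in D) f y =
   \int[mu]_(x in tau @^-1` D) (f (tau x) * `|dtau x|%:E))%E.
Proof.
case: sg => dt cdt dt0 st mD mf f0; last first.
  rewrite (cov_increasing dt cdt _ st mD mf f0); last first.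
    by move=> x; have := dt0 x; rewrite expr0 mul1r.
  apply: eq_integral => x _; rewrite gtr0_norm//.
  by have := dt0 x; rewrite expr0 mul1r.
have dt0' x : 0 < - dtau x by have := dt0 x; rewrite expr1 mulN1r.
rewrite cov_opp//.
rewrite (@cov_increasing (fun x => - tau x) (fun x => - dtau x)
  (fun y => f (- y)))//.
- have -> : (fun x => - tau x) @^-1` (-%R @^-1` D) = tau @^-1` D.
    by apply/seteqP; split => x /=; rewrite opprK.
  by apply: eq_integral => x _; rewrite opprK -[in RHS]normrN gtr0_norm.
- by move=> x; apply: continuousN; exact: cdt.
- by move=> y; have [x xy] := st (- y); exists x; rewrite xy opprK.
- by rewrite -[X in measurable X]setTI; exact: oppr_measurable.
- by apply: measurableT_comp => //; exact: oppr_measurable.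
Qed.

Lemma integral_shift (f : R -> \bar R) (D : set R) (c : R) :
  measurable D -> measurable_fun setT f -> (forall x, 0 <= f x)%E ->
  (\int[mu]_(y in D) f y = \int[mu]_(x in (+%R c) @^-1` D) f (c + x)%R)%E.
Proof.
move=> mD mf f0.
have dc (x : R) : is_derive x 1 (+%R c) (cst 1 x).
  have -> : (+%R c) = (cst c : R -> R) \+ id by [].
  by apply: is_derive_eq; rewrite add0r.
rewrite (cov_increasing dc)//.
- by apply: eq_integral => x _; rewrite mule1.
- exact: cst_continuous.
- by move=> y; exists (y - c); rewrite addrC subrK.
Qed.

Lemma shift_preimage_itvcc (a b c : R) :
  (+%R c) @^-1` `[a, b] = `[a - c, b - c]%classic.
Proof.
by apply/seteqP; split => x /=; rewrite !in_itv/= lerBlDl lerBrDl.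
Qed.

Lemma ge0_integral_itv_cat (f : R -> \bar R) (a b c : R) : a <= b -> b <= c ->
  measurable_fun setT f -> (forall x, 0 <= f x)%E ->
  (\int[mu]_(y in `[a, c]) f y =
   \int[mu]_(y in `[a, b]) f y + \int[mu]_(y in `[b, c]) f y)%E.
Proof.
move=> ab bc mf f0.
rewrite (@itv_bndbnd_setU _ _ (BLeft a) (BRight b) (BRight c))//.
rewrite ge0_integral_setU//=; last 2 first.
- exact: measurable_funTS.
- apply/disj_setPS => x [] /=; rewrite !in_itv/= => /andP[_ xb] /andP[bx _].
  by move: (lt_le_trans bx xb); rewrite ltxx.
congr (_ + _)%E; rewrite integral_itv_obnd_cbnd//.
exact: measurable_funTS.
Qed.

(** Integer shifts of [c] change nothing, so [c] may be taken in [[0, 1]]; there the window is cut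
    at 1 and its second piece moved back by a period. *)
Lemma ge0_integral_period (f : R -> \bar R) (c : R) :
  measurable_fun setT f -> (forall x, 0 <= f x)%E ->
  (forall x, f (x + 1)%R = f x) ->
  (\int[mu]_(y in `[c, (c + 1)%R]) f y = \int[mu]_(y in `[0%R, 1%R]) f y)%E.
Proof.
move=> mf f0 fp.
have shift a b : (\int[mu]_(y in `[(a + 1)%R, (b + 1)%R]) f y = \int[mu]_(y in `[a, b]) f y)%E.
  rewrite (@integral_shift _ _ 1)// shift_preimage_itvcc !addrK.
  by apply: eq_integral => x _; rewrite addrC fp.
have shiftn (n : nat) : (\int[mu]_(y in `[(c + n%:R)%R, (c + n%:R + 1)%R]) f y =
    \int[mu]_(y in `[c, (c + 1)%R]) f y)%E.
  elim: n => [|n <-]; first by rewrite addr0.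
  by rewrite -natr1 !addrA shift.
have small a : 0 <= a <= 1 ->
    (\int[mu]_(y in `[a, (a + 1)%R]) f y = \int[mu]_(y in `[0%R, 1%R]) f y)%E.
  move=> /andP[a0 a1].
  rewrite (@ge0_integral_itv_cat _ a 1 (a + 1))//; last by rewrite lerDr.
  rewrite (@ge0_integral_itv_cat _ 0 a 1)// addeC; congr (_ + _)%E.
  by rewrite -(shift 0) add0r.
have neg (n : nat) : (\int[mu]_(y in `[(c - n%:R)%R, (c - n%:R + 1)%R]) f y =
    \int[mu]_(y in `[c, (c + 1)%R]) f y)%E.
  elim: n => [|n <-]; first by rewrite subr0.
  by rewrite -shift -natr1 opprD !addrA subrK.
pose a := c - (Num.floor c)%:~R.
have a01 : 0 <= a <= 1.
  rewrite subr_ge0 floor_le /= lerBlDl; apply/ltW.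
  by have := floorD1_gt c; rewrite intrD1.
rewrite -(small _ a01) /a.
case: (Num.floor c) => n.
  by rewrite -(neg n).
by rewrite NegzE mulrNz opprK -(shiftn n.+1).
Qed.

End change_of_variables.

(** Banach's fixed point theorem asks for row vectors as a complete normed module. *)
HB.instance Definition _ (R : realType) := Complete.on 'rV[R]_3.

(** * Ambient isotopies from Lipschitz displacements *)

Section isotopy.
Context {R : realType}.
Implicit Types (g eta : R -> 'rV[R]_3) (A B : set 'rV[R]_3).

Lemma lipschitz_dist_continuous (V W : normedModType R) (f : V -> W) (k : R) :
  (forall x y, `|f x - f y| <= k * `|x - y|) -> continuous f.
Proof.
move=> lipf x; apply/cvgrPdist_lt => e e0; near=> y.
have kp : 0 < `|k| + 1 by rewrite ltr_wpDl.
rewrite (le_lt_trans (lipf _ _))//.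
apply: (@le_lt_trans _ _ ((`|k| + 1) * `|x - y|)).
  by rewrite ler_wpM2r// (le_trans (ler_norm _))// lerDl.
rewrite -ltr_pdivlMl//; near: y; apply: cvgr_dist_lt => //.
by rewrite mulr_gt0// invr_gt0.
Unshelve. all: by end_near. Qed.

Lemma row_norm_le (v : 'rV[R]_3) (c : R) : 0 <= c ->
  (forall i, `|v 0 i| <= c) -> `|v| <= c.
Proof.
move=> c0 vc; rewrite [leLHS]/Num.Def.normr/= mx_normrE.
by apply: bigmax_le => // -[i j] _ /=; rewrite (ord1 i).
Qed.

Lemma row_norm_coord (v : 'rV[R]_3) i : `|v 0 i| <= `|v|.
Proof.
rewrite [leRHS]/Num.Def.normr/= mx_normrE.
exact: (le_bigmax _ (fun ij : 'I_1 * 'I_3 => `|v ij.1 ij.2|) (0, i)).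
Qed.

(** The two isotopies run simultaneously, [G t] after [H t], which avoids gluing them in time. *)
Lemma ambient_isotopic_post A B (G : R -> 'rV[R]_3 -> 'rV[R]_3) :
  ambient_isotopic A B ->
  continuous (fun p : R * 'rV[R]_3 => G p.1 p.2) ->
  (forall t, 0 <= t <= 1 -> exists Gi, cancel (G t) Gi /\ cancel Gi (G t) /\
     continuous Gi) ->
  (forall x, G 0 x = x) ->
  ambient_isotopic A (G 1 @` B).
Proof.
move=> [H [cH [iH [H0 H1]]]] cG iG G0.
exists (fun t x => G t (H t x)); split; [|split; [|split]].
- set D := [set p : R * 'rV[R]_3 | 0 <= p.1 <= 1] in cH *.
  have cpair : {within D, continuous (fun p : R * 'rV[R]_3 => (p.1, H p.1 p.2))}.
    move=> p.
    have h1 : (fst : subspace D -> R) @ nbhs (p : subspace D) --> nbhs p.1.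
      by apply: (@continuous_subspaceT _ _ D fst) => x; exact: cvg_fst.
    have h2 := cH p.
    exact: (cvg_pair h1 h2).
  move=> p; apply: (@continuous_comp (subspace D) _ _
    (fun p : R * 'rV[R]_3 => (p.1, H p.1 p.2))
    (fun p : R * 'rV[R]_3 => G p.1 p.2)); first exact: cpair.
  exact: cG.
- move=> t t01.
  have [Hi [c1 [c2 cHi]]] := iH t t01; have [Gi [d1 [d2 cGi]]] := iG t t01.
  exists (Hi \o Gi); split; [|split].
  + exact: (can_comp d1 c1).
  + by move=> x /=; rewrite c2 d2.
  + by move=> x; apply: continuous_comp; [exact: cGi|exact: cHi].
- by move=> x; rewrite H0 G0.
- by rewrite -H1 -image_comp.
Qed.

Section mcshane.
Variables (g eta : R -> 'rV[R]_3) (k : R).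
Hypotheses (k0 : 0 <= k) (k1 : k < 1).
Hypothesis lip : forall s t, `|eta t - eta s| <= k * `|g t - g s|.

(** McShane's extension to all of space of the displacement sending [g s] to [eta s], one coordinate
    at a time; the constant [k] survives because the norm on row vectors is the sup norm. *)
Definition mcshane_set (x : 'rV[R]_3) (i : 'I_3) : set R :=
  [set eta s 0 i + k * `|x - g s| | s in setT].

Definition mcshane (x : 'rV[R]_3) : 'rV[R]_3 :=
  \row_i inf (mcshane_set x i).

Let lipi s t i : eta t 0 i - k * `|g t - g s| <= eta s 0 i.
Proof.
rewrite lerBlDr -lerBlDl (le_trans (ler_norm _))//.
apply: le_trans (lip s t); apply: le_trans (row_norm_coord _ i).
by rewrite !mxE.
Qed.

Let has_inf_mcshane x i : has_inf (mcshane_set x i).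
Proof.
split; first by exists (eta 0 0 i + k * `|x - g 0|), 0.
exists (eta 0 0 i - k * `|x - g 0|) => _ [s _ <-].
have := lipi s 0 i.
have : k * `|g 0 - g s| <= k * (`|x - g 0| + `|x - g s|).
  by apply: ler_wpM2l => //; rewrite (distrC x) ler_distD.
by rewrite mulrDr; lra.
Qed.

Let mcshane_ub x i s : mcshane x 0 i <= eta s 0 i + k * `|x - g s|.
Proof. by rewrite mxE; apply: ge_inf; [exact: (has_inf_mcshane x i).2|exists s]. Qed.

Let mcshane_lb x i m : (forall s, m <= eta s 0 i + k * `|x - g s|) ->
  m <= mcshane x 0 i.
Proof.
move=> h; rewrite mxE; apply: lb_le_inf; first exact: (has_inf_mcshane x i).1.
by move=> _ [s _ <-].
Qed.

Lemma mcshane_extends t : mcshane (g t) = eta t.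
Proof.
apply/rowP => i; apply/eqP; rewrite eq_le; apply/andP; split.
  by have := mcshane_ub (g t) i t; rewrite subrr normr0 mulr0 addr0.
by apply: mcshane_lb => s; rewrite -lerBlDr.
Qed.

Lemma mcshane_lip x y : `|mcshane x - mcshane y| <= k * `|x - y|.
Proof.
apply: row_norm_le => [|i]; first by rewrite mulr_ge0.
have le a b : mcshane a 0 i - k * `|a - b| <= mcshane b 0 i.
  apply: mcshane_lb => s; rewrite lerBlDr -addrA -mulrDr.
  apply: (le_trans (mcshane_ub a i s)); rewrite lerD2l ler_wpM2l// [leRHS]addrC.
  exact: ler_distD.
rewrite !mxE ler_norml; apply/andP; split.
  by have := le y x; rewrite (distrC y) !mxE; lra.
by have := le x y; rewrite !mxE; lra.
Qed.

Lemma mcshane_continuous : continuous mcshane.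
Proof.
exact/lipschitz_dist_continuous/mcshane_lip. Qed.

Definition push_isotopy (t : R) (x : 'rV[R]_3) := x + t *: mcshane x.

Lemma push_isotopy_continuous :
  continuous (fun p : R * 'rV[R]_3 => push_isotopy p.1 p.2).
Proof.
move=> p; apply: cvgD; first exact: cvg_snd.
apply: cvgZ; first exact: cvg_fst.
by apply: continuous_comp; [exact: cvg_snd|exact: mcshane_continuous].
Qed.

Let lower t x y : 0 <= t <= 1 ->
  (1 - k) * `|x - y| <= `|push_isotopy t x - push_isotopy t y|.
Proof.
move=> /andP[t0 t1]; rewrite /push_isotopy.
have -> : x + t *: mcshane x - (y + t *: mcshane y) =
   (x - y) - (- (t *: (mcshane x - mcshane y))).
  by rewrite opprK scalerBr opprD addrACA.
apply: le_trans (lerB_dist _ _); rewrite normrN mulrBl mul1r lerB//.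
rewrite normrZ (le_trans _ (mcshane_lip x y))// ger0_norm//.
by rewrite ler_piMl.
Qed.

(** [push_isotopy t] is the identity plus a [k]-contraction: Banach's theorem solves the equation,
    and the lower bound [1 - k] on the dilation makes the solution unique and Lipschitz in the
    target. *)
Lemma push_isotopy_inv t : 0 <= t <= 1 ->
  exists Gi, cancel (push_isotopy t) Gi /\ cancel Gi (push_isotopy t) /\
     continuous Gi.
Proof.
move=> t01.
have sol y : exists x, push_isotopy t x = y.
  pose f x := y - t *: mcshane x.
  have fS : set_fun [set: 'rV[R]_3] [set: 'rV[R]_3] f by [].
  pose F : {fun [set: 'rV[R]_3] >-> [set: 'rV[R]_3]} := HB.pack f (isFun.Build _ _ _ _ f fS).
  have [||x _ xE] := @banach_fixed_point R 'rV[R]_3 setT F _ closedT.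
  - exists (NngNum k0); split => //= -[a b] _ /=.
    rewrite /f opprD opprK addrACA subrr add0r addrC -scalerBr normrZ distrC.
    have /andP[t0 t1] := t01.
    rewrite (le_trans _ (mcshane_lip a b))// ger0_norm//.
    by rewrite ler_piMl.
  - by exists 0.
  - by exists x; rewrite /push_isotopy {1}xE /= /f subrK.
have [Gi GiP] := choice sol.
have GK : cancel (push_isotopy t) Gi.
  move=> x; apply/eqP; rewrite -subr_eq0 -normr_eq0 eq_le normr_ge0 andbT.
  have := lower (Gi (push_isotopy t x)) x t01.
  by rewrite GiP subrr normr0 pmulr_rle0// subr_gt0.
exists Gi; split => //; split => //.
apply: (@lipschitz_dist_continuous _ _ _ (1 - k)^-1) => y z.
have := lower (Gi y) (Gi z) t01; rewrite !GiP => h.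
by rewrite -ler_pdivrMl ?invr_gt0 ?subr_gt0// invrK.
Qed.

(** An isotopy without tubular neighbourhoods: [eta] is small relative to distances in space, not
    along the curve, and therefore extends to a contraction of the whole space. *)
Lemma ambient_isotopic_push A : ambient_isotopic A (range g) ->
  ambient_isotopic A (range (fun t => g t + eta t)).
Proof.
move=> iso.
have -> : range (fun t => g t + eta t) = push_isotopy 1 @` range g.
  rewrite image_comp; apply: eq_imagel => t _ /=.
  by rewrite /push_isotopy mcshane_extends scale1r.
apply: ambient_isotopic_post => //.
- exact: push_isotopy_continuous.
- exact: push_isotopy_inv.
- by move=> x; rewrite /push_isotopy scale0r addr0.
Qed.

End mcshane.

Lemma ambient_isotopic_scale A g (c : R) : 0 < c ->
  ambient_isotopic A (range g) ->
  ambient_isotopic A (range (fun t => c *: g t)).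
Proof.
move=> c0 iso; pose G (t : R) (x : 'rV[R]_3) := (1 + t * (c - 1)) *: x.
have -> : range (fun t => c *: g t) = G 1 @` range g.
  rewrite image_comp; apply: eq_imagel => t _ /=.
  by rewrite /G mul1r addrC subrK.
apply: ambient_isotopic_post => //.
- move=> p; apply: cvgZ; last exact: cvg_snd.
  apply: cvgD; first exact: cvg_cst.
  by apply: cvgM; [exact: cvg_fst|exact: cvg_cst].
- move=> t /andP[t0 t1].
  have p : 0 < 1 + t * (c - 1).
    have -> : 1 + t * (c - 1) = (1 - t) + t * c by ring.
    move: t0; rewrite le_eqVlt => /predU1P[<-|t0]; first by rewrite mul0r subr0 addr0.
    by rewrite ltr_wpDl ?subr_ge0 ?mulr_gt0.
  exists (fun x => (1 + t * (c - 1))^-1 *: x); split; [|split].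
  + by move=> x; rewrite /G scalerK// gt_eqF.
  + by move=> x; rewrite /G scalerKV// gt_eqF.
  + by move=> x; exact: scaler_continuous.
- by move=> x; rewrite /G mul0r addr0 scale1r.
Qed.

End isotopy.

(** * Integrability of real-valued functions *)

Section real_integrable.
Context d (T : measurableType d) {R : realType} (mu : {measure set T -> \bar R}).
Variables (D : set T) (mD : measurable D).
Implicit Types f g : T -> R.

Lemma integrable_rD f g : mu.-integrable D (EFin \o f) ->
  mu.-integrable D (EFin \o g) -> mu.-integrable D (EFin \o (fun x => f x + g x)).
Proof. by move=> fi gi; exact: (integrableD mD fi gi). Qed.

Lemma integrable_rB f g : mu.-integrable D (EFin \o f) ->
  mu.-integrable D (EFin \o g) -> mu.-integrable D (EFin \o (fun x => f x - g x)).
Proof. by move=> fi gi; exact: (integrableB mD fi gi). Qed.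

Lemma integrable_rZ f (k : R) : mu.-integrable D (EFin \o f) ->
  mu.-integrable D (EFin \o (fun x => k * f x)).
Proof. by move=> fi; exact: (integrableZl mD k fi). Qed.

Lemma measurable_fun_normr f : measurable_fun D f ->
  measurable_fun D (fun x => `|f x|).
Proof. by move=> mf; exact: (measurableT_comp (@normr_measurable R setT) mf). Qed.

Lemma le_integrable_r f g : measurable_fun D f ->
  (forall x, D x -> `|f x| <= g x) -> mu.-integrable D (EFin \o g) ->
  mu.-integrable D (EFin \o f).
Proof.
move=> mf fg; apply: le_integrable => //; first exact/measurable_EFinP.
by move=> x Dx /=; rewrite lee_fin (le_trans (fg _ Dx))// ler_norm.
Qed.

End real_integrable.

Lemma measurable_itvR (R : realType) (i : interval R) :
  measurable ([set` i] : set (measurableTypeR R)).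
Proof. exact: measurable_itv. Qed.

(** * Step functions on a uniform grid *)

Section step_functions.
Context {R : realType}.
Local Notation mu := (@lebesgue_measure R).
Variables (a dl : R).
Hypothesis dl0 : 0 < dl.

Definition node (j : nat) : R := a + dl * j%:R.
Definition cell (j : nat) : set R := `[node j, node j.+1[%classic.

Definition stepfun (N : nat) (c : nat -> R) (x : R) : R :=
  \sum_(j < N) c j * \1_(cell j) x.

Lemma node_mono : {mono node : i j / (i <= j)%N >-> i <= j}.
Proof. by move=> i j; rewrite /node lerD2l ler_pM2l// ler_nat. Qed.

Lemma node_lt i j : (node i < node j) = (i < j)%N.
Proof. by rewrite /node ltrD2l ltr_pM2l// ltr_nat. Qed.

Lemma cell_disjoint i j x : cell i x -> cell j x -> i = j.
Proof.
rewrite /cell /= !in_itv/= => /andP[ix xi] /andP[jx xj].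
have := le_lt_trans ix xj; have := le_lt_trans jx xi.
by rewrite !node_lt !ltnS => h1 h2; apply/eqP; rewrite eqn_leq h1 h2.
Qed.

Lemma stepfunE N c j x : (j < N)%N -> cell j x -> stepfun N c x = c j.
Proof.
move=> jN jx; rewrite /stepfun (bigD1 (Ordinal jN))//= indicE mem_set// mulr1.
rewrite big1 ?addr0// => i /eqP ij; rewrite indicE memNset ?mulr0//.
by move=> ix; apply: ij; apply: val_inj => /=; exact: (cell_disjoint ix jx).
Qed.

Lemma measurable_stepfun N c : measurable_fun setT (stepfun N c).
Proof.
rewrite /stepfun; elim: N => [|N ih].
  by under eq_fun do rewrite big_ord0; exact: measurable_cst.
under eq_fun do rewrite big_ord_recr /=.
apply: measurable_funD; first exact: ih.
by apply: measurable_funM => //; apply: measurable_indic; exact: measurable_itv.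
Qed.

Lemma stepfun_bounded N c x : `|stepfun N c x| <= \sum_(j < N) `|c j|.
Proof.
rewrite /stepfun (le_trans (ler_norm_sum _ _ _))// ler_sum// => j _.
by rewrite normrM ler_piMr// indicE; case: (_ \in _); rewrite ?normr0 ?normr1.
Qed.

Lemma bounded_itv_integrable (f : R -> R) (i j : bool) (x y M : R) :
  measurable_fun setT f -> (forall z, `|f z| <= M) ->
  mu.-integrable [set` Interval (BSide i x) (BSide j y)] (EFin \o f).
Proof.
move=> mf fM; apply: measurable_bounded_integrable => //.
- by rewrite /= lebesgue_measure_itv/=; case: ifP => // _; rewrite ltry.
- exact: measurable_funTS.
- exists M; split; first exact: num_real.
  by move=> x0 Mx0 z _ /=; rewrite (le_trans (fM z))// ltW.
Qed.

Lemma Rintegral_stepfunM K L c (phi : R -> R) M : (K <= L)%N ->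
  measurable_fun setT phi -> (forall x, `|phi x| <= M) ->
  Rintegral mu `[node 0, node K[ (fun x => stepfun L c x * phi x) =
  \sum_(j < K) c j * Rintegral mu (cell j) phi.
Proof.
move=> + mphi bphi; elim: K => [|K ih] KL.
  by rewrite big_ord0 set_itvco0 Rintegral_set0.
rewrite big_ord_recr/= -ih; last exact: ltnW.
rewrite (@itv_bndbnd_setU _ _ (BLeft (node 0)) (BLeft (node K)) (BLeft (node K.+1)))//;
  rewrite ?bnd_simp ?node_mono//.
rewrite Rintegral_setU//=.
- congr (_ + _); rewrite -RintegralZl//.
  + apply: eq_Rintegral => x; rewrite inE => xc; congr (_ * _).
    by apply: stepfunE => //; rewrite /cell.
  + exact: measurable_itv.
  + by rewrite /cell; apply: (@bounded_itv_integrable _ _ _ _ _ M).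
- rewrite -(@itv_bndbnd_setU _ _ (BLeft (node 0)) (BLeft (node K)) (BLeft (node K.+1)))//;
    rewrite ?bnd_simp ?node_mono//.
  apply: (@bounded_itv_integrable _ _ _ _ _ ((\sum_(j < L) `|c j|) * M)).
    apply: measurable_funM => //; exact: measurable_stepfun.
  move=> z; rewrite normrM; apply: ler_pM => //; exact: stepfun_bounded.
- apply/disj_setPS => x [] /=; rewrite !in_itv/= => /andP[_ xb] /andP[bx _].
  by move: (lt_le_trans xb bx); rewrite ltxx.
Qed.

Lemma Rintegral_stepfun K L c : (K <= L)%N ->
  Rintegral mu `[node 0, node K[ (stepfun L c) = \sum_(j < K) c j * dl.
Proof.
move=> KL; have := @Rintegral_stepfunM K L c (cst 1) 1 KL (measurable_cst _).
under eq_Rintegral do rewrite mulr1.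
move=> ->; last by move=> x /=; rewrite normr1.
apply: eq_bigr => j _; congr (_ * _); rewrite Rintegral_cst/=; last exact: measurable_itv.
rewrite mul1r /cell lebesgue_measure_itv/= lte_fin node_lt ltnSn -EFinD/=.
by rewrite /node -natr1; ring.
Qed.

End step_functions.

(** * Dyadic difference quotients as a martingale *)

Definition dyad {R : realType} (a b : R) (n : nat) : R := (b - a) / 2 ^+ n.

(** Squared [L^2] norm of the slope of the piecewise linear interpolant of [f] at dyadic level [n];
    its boundedness in [n] is F. Riesz's criterion for a square integrable derivative. *)
Definition qvar {R : realType} (f : R -> R) (a b : R) (n : nat) : R :=
  \sum_(j < 2 ^ n) (f (node a (dyad a b n) j.+1) - f (node a (dyad a b n) j)) ^+ 2
                   / dyad a b n.

Section riesz.
Context {R : realType}.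
Local Notation mu := (@lebesgue_measure R).
Variables (f : R -> R) (a b : R).
Hypotheses (ab : a < b).

Local Notation dl := (dyad a b).
Local Notation nd n := (node a (dl n)).
Local Notation V := (qvar f a b).

Let slope n j := (f (nd n j.+1) - f (nd n j)) / dl n.

Definition dyadic_slope n : R -> R := stepfun a (dl n) (2 ^ n) (slope n).
Local Notation g := dyadic_slope.

Lemma dyad_gt0 n : 0 < dl n.
Proof. by rewrite divr_gt0 ?subr_gt0 ?exprn_gt0. Qed.
Let dl0 := dyad_gt0.

Lemma node_refine n k j : nd (n + k) (j * 2 ^ k) = nd n j.
Proof.
rewrite /node /dyad exprD natrM natrX; congr (_ + _).
have h : (2 : R) ^+ k != 0 by rewrite expf_neq0.
have h' : (2 : R) ^+ n != 0 by rewrite expf_neq0.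
by field; rewrite h h'.
Qed.

Lemma node_first n : nd n 0 = a. Proof. by rewrite /node mulr0 addr0. Qed.

Let le_a_node n j : a <= nd n j.
Proof. by rewrite -[leLHS](node_first n) node_mono. Qed.

Lemma node_last n : nd n (2 ^ n) = b.
Proof.
rewrite /node /dyad natrX divfK ?expf_neq0//.
by rewrite addrC subrK.
Qed.

Let mg n : measurable_fun setT (g n). Proof. exact: measurable_stepfun. Qed.

Let M n := \sum_(j < 2 ^ n) `|slope n j|.
Let gM n x : `|g n x| <= M n. Proof. exact: stepfun_bounded. Qed.

Lemma dyadic_slope_integrable n i j x y :
  mu.-integrable [set` Interval (BSide i x) (BSide j y)] (EFin \o g n).
Proof. by apply: (@bounded_itv_integrable _ _ _ _ _ _ (M n)). Qed.

Lemma Rintegral_dyadic_slope n k j : (j <= 2 ^ n)%N ->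
  Rintegral mu `[a, nd n j[ (g (n + k)) = f (nd n j) - f a.
Proof.
move=> jn; have jk : (j * 2 ^ k <= 2 ^ (n + k))%N.
  by rewrite expnD leq_mul2r jn orbT.
have := Rintegral_stepfun a (dl0 (n + k)) (slope (n + k)) jk.
rewrite node_first node_refine => ->.
under eq_bigr do rewrite /slope divfK ?gt_eqF//.
rewrite -(big_mkord xpredT (fun i => f (nd (n + k) i.+1) - f (nd (n + k) i))).
by rewrite telescope_sumr// node_refine node_first.
Qed.

Lemma Rintegral_dyadic_slope_cell n k j : (j < 2 ^ n)%N ->
  Rintegral mu (cell a (dl n) j) (g (n + k)) = f (nd n j.+1) - f (nd n j).
Proof.
move=> jn; have := Rintegral_dyadic_slope k jn.
rewrite (@itv_bndbnd_setU _ _ (BLeft a) (BLeft (nd n j)) (BLeft (nd n j.+1)))//;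
  rewrite ?bnd_simp ?node_mono ?le_a_node//.
rewrite Rintegral_setU//=.
- rewrite Rintegral_dyadic_slope; last exact: ltnW.
  by rewrite -/(cell a (dl n) j); lra.
- rewrite -(@itv_bndbnd_setU _ _ (BLeft a) (BLeft (nd n j)) (BLeft (nd n j.+1)))//;
    rewrite ?bnd_simp ?node_mono ?le_a_node//.
  exact: dyadic_slope_integrable.
- apply/disj_setPS => x [] /=; rewrite !in_itv/= => /andP[_ xb] /andP[bx _].
  by move: (lt_le_trans xb bx); rewrite ltxx.
Qed.

(** On each cell of level [n] the finer slope averages to the coarse one: the slopes form a
    martingale. *)
Lemma Rintegral_dyadic_slopeM n k :
  Rintegral mu `[a, b[ (fun x => g n x * g (n + k) x) = V n.
Proof.
have := Rintegral_stepfunM a (dl0 n) (slope n) (leqnn (2 ^ n)) (mg (n + k)) (@gM (n + k)).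
rewrite node_first node_last => ->.
apply: eq_bigr => j _; rewrite Rintegral_dyadic_slope_cell// /slope.
by rewrite expr2 mulrAC.
Qed.

(** Pythagoras for martingale increments: the mixed integral equals the square integral of the
    coarser slope. *)
Lemma dyadic_slope_orthogonal n k :
  Rintegral mu `[a, b[ (fun x => (g (n + k) x - g n x) ^+ 2) = V (n + k) - V n.
Proof.
have i1 m l : mu.-integrable `[a, b[ (EFin \o (fun x => g m x * g l x)).
  apply: (@bounded_itv_integrable _ _ _ _ _ _ (M m * M l)).
    exact: measurable_funM.
  by move=> z; rewrite normrM ler_pM.
have -> : (fun x => (g (n + k) x - g n x) ^+ 2) =
  (fun x => g (n + k) x * g (n + k) x + (g n x * g n x - (g n x * g (n + k) x + g n x * g (n + k) x))).
  by apply/funext => x; ring.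
rewrite RintegralD//=; last first.
  by apply: integrable_rB => //; exact: integrable_rD.
rewrite RintegralB//=; last exact: integrable_rD.
rewrite RintegralD//=.
rewrite Rintegral_dyadic_slopeM.
have e m : Rintegral mu `[a, b[ (fun x => g m x * g m x) = V m.
  by have := Rintegral_dyadic_slopeM m 0; rewrite addn0.
by rewrite !e; ring.
Qed.

Lemma qvar_nd n m : (n <= m)%N -> V n <= V m.
Proof.
move=> nm; rewrite -(subnKC nm) -subr_ge0 -dyadic_slope_orthogonal.
by apply: Rintegral_ge0 => x _; exact: sqr_ge0.
Qed.

End riesz.

(** * Sequences converging fast in L^1 *)

Section L1_fast_cauchy.
Context d (T : measurableType d) {R : realType} (mu : {measure set T -> \bar R}).
Variables (D : set T) (h : nat -> T -> R) (c : R).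
Hypotheses (mD : measurable D) (mh : forall k, measurable_fun setT (h k)).
Hypothesis h0i : mu.-integrable D (EFin \o h 0%N).
Hypothesis fast : forall k,
  (\int[mu]_(x in D) `|h k.+1 x - h k x|%:E <= (c * 2^-1 ^+ k)%:E)%E.

Let dd k x := `|h k.+1 x - h k x|.
Let S x := (\sum_(k <oo) (dd k x)%:E)%E.

Let mdd k : measurable_fun setT (dd k).
Proof. by apply: measurableT_comp => //; apply: measurable_funB. Qed.

Let mS : measurable_fun setT S.
Proof.
apply: (@ge0_emeasurable_sum _ _ _ _ (fun k x => (dd k x)%:E) xpredT) => [k x _ _|k _].
  by rewrite lee_fin /dd normr_ge0.
exact/measurable_EFinP.
Qed.

Let S0 x : (0 <= S x)%E.
Proof. by apply: nneseries_ge0 => k _ _; rewrite lee_fin normr_ge0. Qed.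

Let c0 : 0 <= c.
Proof.
have := fast 0; rewrite expr0 mulr1 -lee_fin; apply: le_trans.
by apply: integral_ge0 => x _; rewrite lee_fin normr_ge0.
Qed.

Let Si : mu.-integrable D S.
Proof.
apply/integrableP; split; first exact: measurable_funTS.
under eq_integral do rewrite gee0_abs//.
rewrite integral_nneseries//; last first.
- move=> k x _; by rewrite lee_fin normr_ge0.
- by move=> k; apply: measurable_funTS; exact/measurable_EFinP.
apply: (@le_lt_trans _ _ (2 * c)%:E); last exact: ltry.
apply: lime_le; first by apply: is_cvg_nneseries => k _ _; apply: integral_ge0 => x _; rewrite lee_fin normr_ge0.
apply: nearW => n.
apply: (@le_trans _ _ (\sum_(0 <= k < n) (c * 2^-1 ^+ k)%:E)%E).
  by apply: lee_sum => k _; exact: fast.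
rewrite sumEFin lee_fin.
have -> : \sum_(0 <= k < n) c * 2^-1 ^+ k = 2 * c - 2 * c * 2^-1 ^+ n.
  elim: n => [|n ih]; first by rewrite big_geq// expr0 mulr1 subrr.
  by rewrite big_nat_recr//= ih exprS; lra.
by rewrite gerBl// !mulr_ge0.
Qed.

Let tele x n : h n x = h 0%N x + \sum_(0 <= k < n) (h k.+1 x - h k x).
Proof. by rewrite telescope_sumr// addrC subrK. Qed.

Let partial_le x n : S x \is a fin_num -> \sum_(0 <= k < n) dd k x <= fine (S x).
Proof.
move=> fS; rewrite -lee_fin fineK// -sumEFin.
by apply: nneseries_lim_ge => k _; rewrite lee_fin normr_ge0.
Qed.

Let h_cvg x : S x \is a fin_num -> cvgn (h ^~ x).
Proof.
move=> fS.
have cs : cvgn (series (fun k => h k.+1 x - h k x)).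
  apply: (@normed_cvg R R^o); apply: nondecreasing_is_cvgn.
    apply: nondecreasing_series => k _ _; exact: normr_ge0.
  exists (fine (S x)) => _ [n _ <-]; exact: partial_le.
have -> : h ^~ x = (fun n => h 0%N x + series (fun k => h k.+1 x - h k x) n).
  by apply/funext => n; rewrite tele.
by apply: is_cvgD => //; exact: is_cvg_cst.
Qed.

Let h_le x n : (`|h n x|%:E <= `|h 0%N x|%:E + S x)%E.
Proof.
have : (\sum_(0 <= k < n) (dd k x)%:E <= S x)%E.
  by apply: nneseries_lim_ge => k _; rewrite lee_fin normr_ge0.
have bnd : `|h n x| <= `|h 0%N x| + \sum_(0 <= k < n) dd k x.
  by rewrite tele (le_trans (ler_normD _ _))// lerD2l ler_norm_sum.
by rewrite sumEFin => hs; apply: le_trans (leeD2l _ hs); rewrite -EFinD lee_fin.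
Qed.

(** The sum [S] of the absolute increments is integrable, hence finite almost everywhere; there the
    sequence converges, and [|h 0| + S] dominates it. *)
Lemma L1_fast_cauchy : exists g : T -> R,
  [/\ measurable_fun setT g, mu.-integrable D (EFin \o g),
      {ae mu, forall x, D x -> h k x @[k --> \oo] --> g x} &
      forall A, measurable A -> A `<=` D ->
        Rintegral mu A (h k) @[k --> \oo] --> Rintegral mu A g].
Proof.
(* The upper limit exists everywhere, so [g] is measurable without discarding the null set of
   divergence. *)
pose g x := fine (limn_esup (fun k => (h k x)%:E)).
have mg : measurable_fun setT g.
  apply: (measurableT_comp (f := fine)) => //.
  apply: measurable_fun_limn_esup => k; exact/measurable_EFinP.
have aecvg : {ae mu, forall x, D x -> h k x @[k --> \oo] --> g x}.
  have := integrable_ae mD Si; apply: filterS => x + Dx => /(_ Dx) /h_cvg cx.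
  have ce : (h k x)%:E @[k --> \oo] --> (limn (h ^~ x))%:E.
    by apply: cvg_EFin; [exact: nearW|exact: cx].
  rewrite /g (is_cvg_limn_esupE (cvgP _ ce)) (cvg_lim _ ce)//=.
have iG : mu.-integrable D (fun x => `|h 0%N x|%:E + S x)%E.
  apply: integrableD => //.
  exact: (integrable_norm h0i).
have dom A : measurable A -> A `<=` D -> mu.-integrable A (EFin \o g) /\
    (\int[mu]_(x in A) (h k x)%:E)%E @[k --> \oo] --> (\int[mu]_(x in A) (g x)%:E)%E.
  move=> mA AD.
  have [] := @dominated_convergence _ _ _ mu A mA (fun k x => (h k x)%:E)
    (EFin \o g) (fun x => `|h 0%N x|%:E + S x)%E.
  - by move=> k; apply: measurable_funTS; exact/measurable_EFinP.
  - by apply: measurable_funTS; exact/measurable_EFinP.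
  - apply: filterS aecvg => x /[swap] Ax /(_ (AD _ Ax)) cx.
    by apply: cvg_EFin; [exact: nearW|exact: cx].
  - exact: (integrableS mD mA AD).
  - by apply: aeW => x k _; exact: h_le.
  - by move=> ? _ ?; split.
exists g; split => //; first by have [] := dom D mD (@subset_refl _ _).
move=> A mA AD; have [gi ci] := dom A mA AD.
apply: fine_cvg; rewrite fineK//.
exact: integrable_fin_num.
Qed.

End L1_fast_cauchy.

(** * Riesz's criterion for a square integrable derivative *)

Section riesz_H1.
Context {R : realType}.
Local Notation mu := (@lebesgue_measure R).

Lemma limn_einf_le_bound (u : nat -> \bar R) (K : \bar R) :
  (forall n, u n <= K)%E -> (limn_einf u <= K)%E.
Proof.
move=> uK; rewrite limn_einf_lim; apply: lime_le; first exact: is_cvg_einfs.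
by apply: nearW => n; apply: le_trans (uK n); apply: ereal_inf_lbound; exists n => /=.
Qed.

Lemma within_itv_seq_cvg (F : R -> R) (a b t : R) (x : nat -> R) :
  {within `[a, b], continuous F} -> t \in `[a, b] ->
  (forall n, x n \in `[a, b]) -> x n @[n --> \oo] --> t ->
  F (x n) @[n --> \oo] --> F t.
Proof.
move=> cF tab xab xt.
have /cvgrPdist_lt := cF t; rewrite /= => h; apply/cvgrPdist_lt => e e0.
have : within `[a, b] (nbhs t) [set x | `|F t - F x| < e].
  by rewrite (@nbhs_subspace_in _ `[a, b]%classic t tab); exact: (h e e0).
move=> /xt[m _ hm]; exists m => // n mn; exact: (hm n mn (xab n)).
Qed.

(** The dyadic slopes are a martingale bounded in [L^2]. Along a subsequence they converge fast in
    [L^1]; the limit has the right integral up to every dyadic node, hence up to every point by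
    continuity, and Fatou's lemma bounds its [L^2] norm. *)
Lemma riesz_H1 (f : R -> R) (a b K : R) : a < b -> continuous f ->
  (forall n, qvar f a b n <= K) ->
  exists g : R -> R, [/\ measurable_fun setT g,
    mu.-integrable `[a, b] (EFin \o g),
    forall t, a <= t <= b -> f t - f a = Rintegral mu `[a, t] g &
    (\int[mu]_(x in `[a, b]) (g x ^+ 2)%:E <= K%:E)%E].
Proof.
move=> ab cf VK; set V := qvar f a b in VK *.
have hsV : has_sup (range V).
  by split; [exists (V 0%N), 0%N|exists K => _ [n _ <-]].
pose Vs := sup (range V).
have ex k : exists n, Vs - V n <= 4^-1 ^+ k.
  have e0 : (0 : R) < 4^-1 ^+ k by rewrite exprn_gt0// invr_gt0.
  have [_ [n _ <-] h] := sup_adherent e0 hsV.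
  by exists n; rewrite /Vs lerBlDr -lerBlDl ltW.
(* The summand [k] sends [N k] to infinity, and minimality of [ex_minn] makes [N] monotone. *)
pose N k := (k + ex_minn (ex k))%N.
have NP k : Vs - V (N k) <= 4^-1 ^+ k.
  rewrite /N; case: ex_minnP => m hm _; apply: le_trans hm.
  by rewrite lerB// qvar_nd// leq_addl.
have Nnd k : (N k <= N k.+1)%N.
  rewrite /N; case: ex_minnP => m _ mmin; case: ex_minnP => l hl _.
  apply: leq_add => //; apply: mmin; apply: le_trans hl _.
  by rewrite exprS ler_piMl ?exprn_ge0 ?invr_ge0// invf_le1// ler1n.
have VVs n : V n <= Vs by apply: ub_le_sup; [exact: hsV.2|exists n].
pose h k := dyadic_slope f a b (N k).
have mh k : measurable_fun setT (h k) by exact: measurable_stepfun.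
have hb k : exists M, forall x, `|h k x| <= M.
  by eexists => x; exact: stepfun_bounded.
have bint (phi : R -> R) M : measurable_fun setT phi -> (forall x, `|phi x| <= M) ->
    Rintegral mu `[a, b[ phi = Rintegral mu `[a, b] phi.
  move=> mphi pM; rewrite Rintegral_itv_bndo_bndc//.
  exact: (@bounded_itv_integrable _ _ _ _ _ _ M).
have msq k : measurable_fun setT (fun x => (h k.+1 x - h k x) ^+ 2).
  by apply: measurable_funX; exact: measurable_funB.
have sqb k : exists M, forall x, `|(h k.+1 x - h k x) ^+ 2| <= M.
  have [M1 h1] := hb k.+1; have [M2 h2] := hb k.
  exists ((M1 + M2) ^+ 2) => x; rewrite normrX ler_sqr ?nnegrE//.
    by rewrite (le_trans (ler_normB _ _))// lerD.
  by rewrite addr_ge0// (le_trans _ (h1 0), le_trans _ (h2 0)).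
have sqi k : mu.-integrable `[a, b] (EFin \o (fun x => (h k.+1 x - h k x) ^+ 2)).
  by have [M hM] := sqb k; apply: (@bounded_itv_integrable _ _ _ _ _ _ M).
have orth k : Rintegral mu `[a, b] (fun x => (h k.+1 x - h k x) ^+ 2) <= 4^-1 ^+ k.
  have [M hM] := sqb k; rewrite -(bint _ M)//.
  rewrite /h -(subnKC (Nnd k)) dyadic_slope_orthogonal//.
  by apply: le_trans (NP k); rewrite lerB.
have mab : measurable (`[a, b]%classic : set (measurableTypeR R)).
  exact: measurable_itv.
have ci (c : R) : mu.-integrable `[a, b] (EFin \o (fun=> c)).
  exact: (@bounded_itv_integrable _ _ _ _ _ _ `|c|).
have fin : (mu `[a, b] < +oo)%E.
  by rewrite lebesgue_measure_itv/=; case: ifP => // _; rewrite ltry.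
(* Weighting the square bound [4^-1 ^+ k] by [2 ^+ k] leaves a multiple of [2^-1 ^+ k], the rate
   that [L1_fast_cauchy] asks for. *)
have fast k : (\int[mu]_(x in `[a, b]) `|h k.+1 x - h k x|%:E <=
    (((b - a + 1) / 2) * 2^-1 ^+ k)%:E)%E.
  apply: (@le_trans _ _ (\int[mu]_(x in `[a, b])
     (2^-1 * (2^-1 ^+ k) + (2 ^+ k / 2) * (h k.+1 x - h k x) ^+ 2)%:E)%E).
    apply: ge0_le_integral => //.
    - apply: measurable_funTS; apply/measurable_EFinP.
      by apply: measurable_fun_normr; apply: measurable_funB; exact: mh.
    - apply: measurable_funTS; apply/measurable_EFinP.
      by apply: measurable_funD => //; apply: measurable_funM => //; exact: msq.
    - move=> x _; rewrite lee_fin -(real_normK (num_real (_ - _))).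
      move: (`|_|) => z.
      (* AM-GM with weight [2 ^ k] *)
      have := sqr_ge0 (1 - 2 ^+ k * z); have e : (2 : R) ^+ k != 0 by rewrite expf_neq0.
      have p : (0 : R) < 2 ^+ k by rewrite exprn_gt0.
      rewrite exprVn => hz.
      rewrite -(@ler_pM2l _ (2 ^+ k))//.
      have -> : 2 ^+ k * (2^-1 * (2 ^+ k)^-1 + 2 ^+ k / 2 * z ^+ 2) =
        2^-1 + (2 ^+ k * z) ^+ 2 / 2 by field.
      by move: hz; rewrite expr2; lra.
  have ri : mu.-integrable `[a, b] (EFin \o
      (fun x => 2^-1 * (2^-1 ^+ k) + (2 ^+ k / 2) * (h k.+1 x - h k x) ^+ 2)).
    exact: (integrable_rD mab (ci _) (integrable_rZ mab _ (sqi k))).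
  rewrite -(fineK (integrable_fin_num _ ri))//= lee_fin.
  rewrite -/(Rintegral mu `[a, b] _) RintegralD//=; last first.
    exact: (integrable_rZ mab _ (sqi k)).
  have -> : Rintegral mu `[a, b] (fun=> 2^-1 * 2^-1 ^+ k) = 2^-1 * 2^-1 ^+ k * (b - a).
    rewrite (@Rintegral_cst _ _ _ mu _ mab); congr (_ * _).
    have muab : mu `[a, b] = (b - a)%:E by rewrite lebesgue_measure_itv/= lte_fin ab.
    by rewrite -[RHS]/(fine (b - a)%:E) -muab.
  rewrite RintegralZl//.
  have := orth k; set I := Rintegral _ _ _ => hI.
  have : 2 ^+ k / 2 * I <= 2 ^+ k / 2 * 4^-1 ^+ k.
    by rewrite ler_wpM2l// divr_ge0// exprn_ge0.
  have -> : 2 ^+ k / 2 * 4^-1 ^+ k = 2^-1 ^+ k / 2 :> R.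
    rewrite mulrAC -exprMn; congr (_ ^+ k / _); lra.
  lra.
have h0i : mu.-integrable `[a, b] (EFin \o h 0%N).
  by have [M hM] := hb 0%N; apply: (@bounded_itv_integrable _ _ _ _ _ _ M).
have [g [mg gi aeg cg]] := L1_fast_cauchy mab mh h0i fast.
have nodeab n j : (j <= 2 ^ n)%N -> a <= node a (dyad a b n) j <= b.
  move=> jn; have := node_mono a (dyad_gt0 ab n) 0 j.
  have := node_mono a (dyad_gt0 ab n) j (2 ^ n)%N.
  by rewrite node_first node_last jn => -> ->.
have Fnode n j : (j <= 2 ^ n)%N ->
    Rintegral mu `[a, node a (dyad a b n) j] g = f (node a (dyad a b n) j) - f a.
  move=> jn; set p := node _ _ _.
  have /andP[ap pb] : a <= p <= b := nodeab n j jn.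
  have sub : `[a, p]%classic `<=` `[a, b]%classic by apply: subset_itvl; rewrite bnd_simp.
  have c1 := cg _ (measurable_itv `[a, p]) sub.
  apply: (cvg_unique _ c1) => //.
  (* Once [N k >= n], the integral of the slope up to a node of level [n] no longer changes. *)
  apply: cvg_near_cst; exists n => // k /= nk.
  have [M hM] := hb k.
  rewrite -Rintegral_itv_bndo_bndc; last first.
    by apply: (@bounded_itv_integrable _ _ _ _ _ _ M); [exact: mh|exact: hM].
  have nN : (n <= N k)%N by rewrite (leq_trans nk)// leq_addr.
  by rewrite /h -(subnKC nN) Rintegral_dyadic_slope.
have cF := parameterized_integral_continuous (ltW ab) gi.
exists g; split => //.
- move=> t /andP[at_ tb].
  (* The last node of level [n] not beyond [t]; for [t = b] it is [b] itself. *)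
  pose x n := node a (dyad a b n) (Num.truncn ((t - a) / dyad a b n)).
  have dl0 n : 0 < dyad a b n by exact: dyad_gt0.
  have tr n : ((Num.truncn ((t - a) / dyad a b n))%:R <= (t - a) / dyad a b n) /\
      ((t - a) / dyad a b n < (Num.truncn ((t - a) / dyad a b n)).+1%:R).
    have p : 0 <= (t - a) / dyad a b n by rewrite divr_ge0 ?subr_ge0// ltW.
    by have /andP[] := truncn_itv p.
  have trl n : (Num.truncn ((t - a) / dyad a b n) <= 2 ^ n)%N.
    rewrite -(ler_nat R) natrX (le_trans (tr n).1)// ler_pdivrMr//.
    by rewrite /dyad mulrC divfK ?expf_neq0// lerB.
  have xt n : `|t - x n| <= (b - a) * 2^-1 ^+ n.
    have [l u] := tr n; rewrite -natr1 in u.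
    move: l u; rewrite ler_pdivlMr// ltr_pdivrMr// => l u.
    have -> : (b - a) * 2^-1 ^+ n = dyad a b n by rewrite exprVn.
    rewrite /x /node ger0_norm; first by lra.
    lra.
  have xct : x n @[n --> \oo] --> t.
    have geo : geometric (b - a) 2^-1 n @[n --> \oo] --> 0.
      by apply: cvg_geometric; rewrite gtr0_norm ?invr_gt0// invf_lt1// ltr1n.
    apply/cvgrPdist_lt => e e0; have [m _ hm] := cvgr0_norm_lt _ geo _ e0.
    exists m => // n /hm; apply: le_lt_trans; apply: (le_trans (xt n)).
    exact: (ler_norm ((b - a) * 2^-1 ^+ n)).
  have xab n : x n \in `[a, b] by rewrite in_itv/=; exact: nodeab.
  have tab : t \in `[a, b] by rewrite in_itv/= at_ tb.
  have c1 := within_itv_seq_cvg cF tab xab xct.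
  have c2 : f (x n) - f a @[n --> \oo] --> f t - f a.
    by apply: cvgB; [exact: (cvg_comp _ _ xct (cf t))|exact: cvg_cst].
  have E : (fun n => parameterized_integral mu a (x n) g) = (fun n => f (x n) - f a).
    by apply/funext => n; exact: Fnode.
  rewrite E in c1; exact: (cvg_unique _ c2 c1).
- pose u k x := ((h k x) ^+ 2)%:E.
  have mu_ k : measurable_fun setT (u k).
    by apply/measurable_EFinP; apply: measurable_funX; exact: mh.
  have Iu k : (\int[mu]_(x in `[a, b]) u k x)%E = (V (N k))%:E.
    have [M hM] := hb k.
    have i2 : mu.-integrable `[a, b] (EFin \o (fun x => h k x * h k x)).
      apply: (@bounded_itv_integrable _ _ _ _ _ _ (M * M)).
        by apply: measurable_funM; exact: mh.
      by move=> z; rewrite normrM ler_pM.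
    have -> : u k = EFin \o (fun x => h k x * h k x) by apply/funext => x; rewrite /u expr2.
    rewrite -(fineK (integrable_fin_num mab i2))//; congr EFin.
    rewrite /V; have := Rintegral_dyadic_slopeM f ab (N k) 0; rewrite addn0 => <-.
    symmetry; apply: (bint _ (M * M)); first by apply: measurable_funM; exact: mh.
    by move=> z; rewrite normrM; apply: ler_pM => //; exact: hM.
  have -> : (\int[mu]_(x in `[a, b]) (g x ^+ 2)%:E =
      \int[mu]_(x in `[a, b]) limn_einf (u^~ x))%E.
    apply: ae_eq_integral => //.
    + by apply: measurable_funTS; apply/measurable_EFinP; apply: measurable_funX; exact: mg.
    + rewrite (_ : (fun x => _) = (fun x => - limn_esup (fun k => - u k x)%E)%E); last first.
        by apply/funext => x; rewrite -limn_einfN; congr limn_einf; apply/funext => k /=; rewrite opprK.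
      apply: measurable_funTS; apply: measurableT_comp => //.
      apply: measurable_fun_limn_esup => k; exact: (measurableT_comp (@oppe_measurable R setT) (mu_ k)).
    + apply: filterS aeg => x /[swap] Dx /(_ Dx) cx.
      have cu : u k x @[k --> \oo] --> (g x ^+ 2)%:E.
        apply: cvg_EFin; first exact: nearW.
        rewrite expr2; under eq_fun do rewrite /u /= expr2.
        exact: (cvgM cx cx).
      by rewrite (is_cvg_limn_einfE (cvgP _ cu)) (cvg_lim _ cu).
  apply: (le_trans (fatou _ _ _ _)) => //.
  + by move=> k; apply: measurable_funTS; exact: mu_.
  + by move=> k x _; rewrite lee_fin sqr_ge0.
  + by apply: limn_einf_le_bound => k; rewrite Iu lee_fin.
Qed.

End riesz_H1.

(** * Almost everywhere equality with a non-measurable integrand *)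

Section ae_nonmeasurable.
Context d (T : measurableType d) {R : realType} (mu : {measure set T -> \bar R}).
Local Open Scope ereal_scope.
Import HBNNSimple.

(* Measurability of [f] is not assumed: the integral is a supremum over simple
   functions, which does not see a null set. *)
Lemma ge0_integral_ae_eq_nonmeas (D : set T) (f h : T -> \bar R) :
  measurable D -> (forall x, 0 <= f x) -> (forall x, 0 <= h x) ->
  measurable_fun D h -> {ae mu, forall x, D x -> f x = h x} ->
  \int[mu]_(x in D) f x = \int[mu]_(x in D) h x.
Proof.
move=> mD f0 h0 mh [N [mN N0 subN]].
have fh x : D x -> ~ N x -> f x = h x.
  move=> Dx Nx; apply: contrapT => fhx; apply: Nx; apply: subN => /=.
  by move=> /(_ Dx).
have hr0 x : 0 <= (h \_ D) x by rewrite patchE; case: ifPn.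
have mhr : measurable_fun setT (h \_ D) by apply/(measurable_restrictT _ _).1.
have mNC : measurable (~` N) by exact: measurableC.
apply/eqP; rewrite eq_le; apply/andP; split.
- rewrite ge0_integralE//; apply: ge_ereal_sup => /= _ [s /= sf <-].
  rewrite -integralT_nnsfun [leRHS]integral_mkcond.
  have ms : measurable_fun setT (fun x => (s x)%:E).
    exact/measurable_EFinP/measurable_funP.
  have s0 x : 0 <= (s x)%:E by rewrite lee_fin.
  rewrite (ge0_negligible_integral mN)//.
  rewrite [leRHS](ge0_negligible_integral mN)//.
  rewrite setTD; apply: ge0_le_integral => //; try exact: measurable_funTS.
  move=> x /= Nx; apply: le_trans (sf x) _; rewrite !patchE.
    by case: ifPn => // /set_mem Dx; rewrite fh.
- rewrite (ge0_negligible_integral mN)// [leRHS]ge0_integralE//.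
  rewrite ge0_integralE//; apply: ereal_sup_le => /= _ [s /= sf <-].
  exists s => //= x; apply: le_trans (sf x) _; rewrite !patchE.
  case: ifPn => [/set_mem[Dx Nx]|_]; first by rewrite mem_set// fh.
  by case: ifPn.
Qed.

End ae_nonmeasurable.

(** * Integrals over intervals and primitives *)

Section interval_integrals.
Context {R : realType}.
Local Notation mu := (@lebesgue_measure R).

Lemma ge0_integral_periodn (f : R -> \bar R) (c : R) (n : nat) :
  measurable_fun setT f -> (forall x, 0 <= f x)%E ->
  (forall x, f (x + 1)%R = f x) ->
  (\int[mu]_(y in `[c, (c + n%:R)%R]) f y =
   n%:R%:E * \int[mu]_(y in `[0%R, 1%R]) f y)%E.
Proof.
move=> mf f0 fp; elim: n => [|n ih].
  by rewrite addr0 mul0e set_itv1 integral_set1.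
rewrite (@ge0_integral_itv_cat _ _ c (c + n%:R)%R)//; last 2 first.
- by rewrite lerDl.
- by rewrite lerD2l ler_nat.
have -> : c + n.+1%:R = c + n%:R + 1 by rewrite -natr1 addrA.
rewrite ih ge0_integral_period// -natr1 EFinD ge0_muleDl ?lee_fin//.
by rewrite mul1e.
Qed.

Lemma itv_sub_nat_window (a b : R) : exists n : nat, (0 < n)%N /\
  - n%:R < a /\ b < n%:R.
Proof.
exists (Num.truncn (`|a| + `|b|)).+1; split => //.
have h := truncnS_gt (`|a| + `|b|); set n := (_.+1)%:R in h *.
have := ler_norm b; have := ler_norm (- a); rewrite normrN => ha hb.
have := normr_ge0 a; have := normr_ge0 b; split; lra.
Qed.

Lemma period_integral_lty (f : R -> \bar R) (a b : R) :
  measurable_fun setT f -> (forall x, 0 <= f x)%E ->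
  (forall x, f (x + 1)%R = f x) ->
  (\int[mu]_(y in `[0%R, 1%R]) f y < +oo ->
   \int[mu]_(y in `[a, b]) f y < +oo)%E.
Proof.
move=> mf f0 fp foo; have [n [_ [na bn]]] := itv_sub_nat_window a b.
apply: (@le_lt_trans _ _ (\int[mu]_(y in `[(- n%:R)%R, (- n%:R + (n + n)%:R)%R]) f y)%E).
  apply: ge0_subset_integral => //; first exact: measurable_funTS.
  move=> x /=; rewrite !in_itv/= => /andP[ax xb].
  by rewrite natrD addKr (ltW (lt_le_trans na ax)) (ltW (le_lt_trans xb bn)).
by rewrite ge0_integral_periodn// lte_mul_pinfty// lee_fin.
Qed.

Lemma Rintegral_itv_cat (f : R -> R) (a b c : R) : a <= b -> b <= c ->
  mu.-integrable `[a, c] (EFin \o f) ->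
  Rintegral mu `[a, c] f = Rintegral mu `[a, b] f + Rintegral mu `[b, c] f.
Proof.
move=> ab bc fi; rewrite addrC; apply/eqP; rewrite -subr_eq; apply/eqP.
rewrite Rintegral_itvB//; rewrite ?bnd_simp//.
apply: Rintegral_itv_obnd_cbnd; apply: integrableS fi => //.
by apply: subset_itv; rewrite bnd_simp.
Qed.

Lemma square_integrable_itv (f : R -> R) (a b : R) :
  measurable_fun setT f -> (\int[mu]_(x in `[a, b]) (f x ^+ 2)%:E < +oo)%E ->
  mu.-integrable `[a, b] (EFin \o f) /\
  mu.-integrable `[a, b] (EFin \o (fun x => f x ^+ 2)).
Proof.
move=> mf f2.
have i2 : mu.-integrable `[a, b] (EFin \o (fun x => f x ^+ 2)).
  apply/integrableP; split.
    by apply: measurable_funTS; apply/measurable_EFinP; exact: measurable_funX.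
  by under eq_integral do rewrite /= ger0_norm ?sqr_ge0//.
split=> //.
have mab : measurable (`[a, b]%classic : set (measurableTypeR R)).
  exact: measurable_itv.
apply: (@le_integrable_r _ _ _ mu _ mab f (fun x => 1 + f x ^+ 2)).
- exact: measurable_funTS.
- move=> x _; rewrite -(real_normK (num_real (f x))); move: (`|_|) => z.
  by have := sqr_ge0 (z - 1); rewrite sqrrB; nra.
- apply: (integrable_rD mab _ i2).
  exact: (@bounded_itv_integrable _ (fun=> 1) _ _ _ _ `|1|).
Qed.

Lemma Rintegral_itv_cst (a b c : R) : a <= b -> Rintegral mu `[a, b] (fun=> c) = c * (b - a).
Proof.
move=> ab; have mab : measurable (`[a, b]%classic : set (measurableTypeR R)).
  exact: measurable_itv.
rewrite (@Rintegral_cst _ _ _ mu _ mab); congr (_ * _).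
have -> : b - a = fine (b - a)%:E by [].
have <- // : mu `[a, b] = (b - a)%:E.
rewrite lebesgue_measure_itv/= lte_fin; case: ltP => // ba.
have -> : a = b by apply/eqP; rewrite eq_le ab ba.
by rewrite subrr.
Qed.

(** Expand the nonnegative integral of the squared deviation of [f] from its mean. *)
Lemma cauchy_schwarz_itv (f : R -> R) (s t : R) : s <= t ->
  mu.-integrable `[s, t] (EFin \o f) ->
  mu.-integrable `[s, t] (EFin \o (fun x => f x ^+ 2)) ->
  (Rintegral mu `[s, t] f) ^+ 2 <= (t - s) * Rintegral mu `[s, t] (fun x => f x ^+ 2).
Proof.
rewrite le_eqVlt => /predU1P[<- _ _|st fi f2i].
  by rewrite set_itv1 !Rintegral_set1 expr0n/= mulr0.
have mst : measurable (`[s, t]%classic : set (measurableTypeR R)).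
  exact: measurable_itv.
pose I := Rintegral mu `[s, t] f; pose J := Rintegral mu `[s, t] (fun x => f x ^+ 2).
rewrite -/I -/J.
pose m := I / (t - s).
have ts : 0 < t - s by rewrite subr_gt0.
have : 0 <= Rintegral mu `[s, t] (fun x => (f x - m) ^+ 2).
  by apply: Rintegral_ge0 => x _; exact: sqr_ge0.
have -> : (fun x => (f x - m) ^+ 2) = (fun x => f x ^+ 2 + (- (2 * m) * f x + m ^+ 2)).
  by apply/funext => x; ring.
have ci : mu.-integrable `[s, t] (EFin \o (fun=> m ^+ 2)).
  exact: (@bounded_itv_integrable _ _ _ _ _ _ `|m ^+ 2|).
have i1 := integrable_rZ mst (- (2 * m)) fi.
rewrite RintegralD//; last exact: (integrable_rD mst i1 ci).
rewrite RintegralD// RintegralZl// Rintegral_itv_cst; last exact: ltW.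
rewrite -/I -/J /m => h.
have : 0 <= (t - s) * (J + (- (2 * (I / (t - s))) * I + (I / (t - s)) ^+ 2 * (t - s))).
  by rewrite mulr_ge0// ltW.
have -> : (t - s) * (J + (- (2 * (I / (t - s))) * I + (I / (t - s)) ^+ 2 * (t - s))) =
   (t - s) * J - I ^+ 2 by field; rewrite gt_eqF.
by rewrite subr_ge0.
Qed.

Lemma signed_primitive (f : R -> R) :
  (forall a b, mu.-integrable `[a, b] (EFin \o f)) ->
  exists F : R -> R, forall s t, s <= t -> F t - F s = Rintegral mu `[s, t] f.
Proof.
move=> fi; exists (fun t => if 0 <= t then Rintegral mu `[0, t] f
                   else - Rintegral mu `[t, 0] f) => s t st.
case: (leP 0 t) => t0; case: (leP 0 s) => s0.
- by rewrite (Rintegral_itv_cat s0 st (fi _ _)) addrC addKr.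
- by rewrite opprK addrC -(Rintegral_itv_cat (ltW s0) t0 (fi _ _)).
- by have := le_lt_trans (le_trans s0 st) t0; rewrite ltxx.
- by rewrite opprK (Rintegral_itv_cat st (ltW t0) (fi _ _)) addrC addrK.
Qed.

(** Lebesgue's differentiation theorem for the extension of [g] by zero, whose primitive agrees with
    [f] up to a constant near every interior point. *)
Lemma ae_derive_primitive (f g : R -> R) (a b : R) : a < b ->
  mu.-integrable `[a, b] (EFin \o g) ->
  (forall t, a <= t <= b -> f t - f a = Rintegral mu `[a, t] g) ->
  {ae mu, forall x, a < x < b -> is_derive x 1 f (g x)}.
Proof.
move=> ab gi fg.
have mab : measurable (`[a, b]%classic : set (measurableTypeR R)).
  exact: measurable_itv.
pose h := g \_ `[a, b].
have hi : mu.-integrable setT (EFin \o h).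
  by move: gi; rewrite (@integrable_mkcond _ _ _ mu _ _ mab) restrict_EFin.
have li := integrable_locally mab gi.
have intf y : mu.-integrable [set` Interval (BLeft a) (BRight y)] (EFin \o h).
  exact: integrableS hi.
have := FTC1 intf li.
apply: filterS; first exact: (ae_filter_ringOfSetsType mu).
move=> x hx /andP[ax xb].
have [|dF eF] := hx; first by rewrite lte_fin.
set F := (fun y : R => Rintegral mu [set` Interval (BLeft a) (BRight y)] h) in dF eF.
have eqn : \forall y \near x, F y = f y - f a.
  have : x \in `]a, b[ by rewrite in_itv/= ax xb.
  move=> /near_in_itvoo; apply: filterS => y; rewrite in_itv/= => /andP[ay yb].
  rewrite fg ?(ltW ay) ?(ltW yb)// /F; apply: eq_Rintegral => z.
  move=> /set_mem/=; rewrite in_itv/= => /andP[az zy].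
  by rewrite /h ?patchE mem_set//= in_itv/= az (le_trans zy)// ltW.
have gx : g x = h x by rewrite /h patchE mem_set//= in_itv/= !ltW.
have dFx : is_derive x 1 F (g x).
  by apply: DeriveDef => //; rewrite -derive1E eF gx.
have dfa : is_derive x 1 (fun y => f y - f a) (g x).
  exact: near_eq_is_derive dFx.
have -> : f = (fun y => (f y - f a) + f a) by apply/funext => y; rewrite subrK.
by apply: is_derive_eq; rewrite addr0.
Qed.

End interval_integrals.

(** * W^{2,2} regularity through increments *)

Section curves.
Context {R : realType}.
Local Notation mu := (@lebesgue_measure R).
Implicit Types g h : R -> 'rV[R]_3.

Lemma sum3 (F : 'I_3 -> R) : \sum_i F i = F 0 + F 1 + F 2%:R.
Proof.
rewrite !big_ord_recl big_ord0 addr0 addrA.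
by congr (_ + F _ + F _); exact: val_inj.
Qed.

Lemma is_derive_coord g (t : R) i : derivable g t 1 ->
  is_derive t 1 (fun x => g x 0 i) (deriv1 g t 0 i).
Proof.
move=> dg; have /derivable_mxP/(_ 0 i) di := dg; apply: DeriveDef => //.
by rewrite /deriv1 derive_mx// mxE.
Qed.

Lemma derivable_coordP g (t : R) : (forall i, derivable (fun x => g x 0 i) t 1) ->
  derivable g t 1.
Proof. by move=> h; apply/derivable_mxP => j i; rewrite (ord1 j). Qed.

Lemma deriv1_coordP g (t : R) (v : 'rV[R]_3) :
  (forall i, is_derive t 1 (fun x => g x 0 i) (v 0 i)) ->
  derivable g t 1 /\ deriv1 g t = v.
Proof.
move=> h; have dg : derivable g t 1.
  by apply: derivable_coordP => i; have [] := h i.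
split=> //; apply/rowP => i.
by have [_ <-] := is_derive_coord i dg; have [_ <-] := h i.
Qed.

Lemma deriv1_periodic g : periodic1 g -> periodic1 (deriv1 g).
Proof.
move=> pg t; rewrite /deriv1 /derive.
set F := (f in lim (fmap f _)); set G := (f in _ = lim (fmap f _)).
have -> // : F = G.
by apply/funext => x; rewrite /F /G /= addrA !pg.
Qed.

(** A square integrable derivative expressed without integrals: [Psi] stands for a primitive of the
    squared derivative, and the inequality is Cauchy--Schwarz. This form survives sums, Lipschitz
    changes of variable and pointwise limits. *)
Definition H1ctrl (f : R -> R) := exists Psi : R -> R,
  {homo Psi : x y / x <= y} /\
  forall s t, s <= t -> (f t - f s) ^+ 2 <= (t - s) * (Psi t - Psi s).

(** One closure principle behind scaling, sums, shifts and the change to arclength: increments are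
    dominated by those of three controlled functions after a Lipschitz change of time. The factor 3
    comes from squaring a sum of three terms. *)
Lemma H1_lip (f : R -> R) (F : 'I_3 -> R -> R) (C L : R) (tau : R -> R) :
  0 <= C -> 0 <= L ->
  {homo tau : x y / x <= y} -> (forall s t, s <= t -> tau t - tau s <= L * (t - s)) ->
  (forall i, H1ctrl (F i)) ->
  (forall s t, s <= t -> `|f t - f s| <= C * \sum_i `|F i (tau t) - F i (tau s)|) ->
  H1ctrl f.
Proof.
move=> C0 L0 mt Lt /choice[Psi hPsi] lipf.
exists (fun t => 3 * C ^+ 2 * L * \sum_i Psi i (tau t)); split.
  move=> x y xy; rewrite ler_wpM2l ?mulr_ge0 ?sqr_ge0//.
  by apply: ler_sum => i _; apply: (hPsi i).1; exact: mt.
move=> s t st; have ts : tau s <= tau t by exact: mt.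
have step i : (F i (tau t) - F i (tau s)) ^+ 2 <=
    L * (t - s) * (Psi i (tau t) - Psi i (tau s)).
  apply: le_trans ((hPsi i).2 _ _ ts) _; apply: ler_wpM2r; last exact: Lt.
  by rewrite subr_ge0; apply: (hPsi i).1.
have := lipf s t st; rewrite !sum3 => hl.
have sqn (z : R) : z ^+ 2 = `|z| ^+ 2 by rewrite real_normK ?num_real.
have h1 := step 0; have h2 := step 1; have h3 := step 2%:R.
rewrite sqn in h1; rewrite sqn in h2; rewrite sqn in h3; rewrite sqn.
move: hl (normr_ge0 (f t - f s)) h1 h2 h3.
move: (`|f t - f s|) (`|F 0 (tau t) - F 0 (tau s)|) (`|F 1 (tau t) - F 1 (tau s)|)
  (`|F 2%:R (tau t) - F 2%:R (tau s)|) => x a b c hx x0 h1 h2 h3.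
have C2 : 0 <= C ^+ 2 by exact: sqr_ge0.
have sq : x ^+ 2 <= C ^+ 2 * (a + b + c) ^+ 2.
  by rewrite -exprMn ler_sqr ?nnegrE// (le_trans x0).
have abc : (a + b + c) ^+ 2 <= 3 * (a ^+ 2 + b ^+ 2 + c ^+ 2).
  have := sqr_ge0 (a - b); have := sqr_ge0 (a - c); have := sqr_ge0 (b - c).
  by rewrite !expr2; nra.
apply: (le_trans sq); apply: (@le_trans _ _ (C ^+ 2 * (3 * (a ^+ 2 + b ^+ 2 + c ^+ 2)))).
  by rewrite ler_wpM2l.
rewrite -subr_ge0.
have -> : (t - s) * (3 * C ^+ 2 * L * (Psi 0 (tau t) + Psi 1 (tau t) + Psi 2%:R (tau t)) -
   3 * C ^+ 2 * L * (Psi 0 (tau s) + Psi 1 (tau s) + Psi 2%:R (tau s))) -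
   C ^+ 2 * (3 * (a ^+ 2 + b ^+ 2 + c ^+ 2)) = 3 * C ^+ 2 * (
   (L * (t - s) * (Psi 0 (tau t) - Psi 0 (tau s)) +
    L * (t - s) * (Psi 1 (tau t) - Psi 1 (tau s)) +
    L * (t - s) * (Psi 2%:R (tau t) - Psi 2%:R (tau s))) - (a ^+ 2 + b ^+ 2 + c ^+ 2)).
  by ring.
rewrite mulr_ge0 ?mulr_ge0//; lra.
Qed.

Lemma H1_scale (f : R -> R) (c : R) : H1ctrl f -> H1ctrl (fun t => c * f t).
Proof.
move=> hf; apply: (@H1_lip _ (fun=> f) `|c| 1 id) => //.
- by move=> s t _; rewrite mul1r.
- move=> s t _; rewrite -mulrBr normrM ler_wpM2l// sum3 -[leLHS]addr0 -addrA lerD2l.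
  by rewrite addr_ge0.
Qed.

Lemma H1_add (f1 f2 : R -> R) : H1ctrl f1 -> H1ctrl f2 ->
  H1ctrl (fun t => f1 t + f2 t).
Proof.
move=> h1 h2; apply: (@H1_lip _ (fun i => if i == 0 then f1 else f2) 1 1 id) => //.
- by move=> s t _; rewrite mul1r.
- by move=> i; case: ifP.
- move=> s t _; rewrite mul1r sum3 /= opprD addrACA (le_trans (ler_normD _ _))//.
  by rewrite lerDl.
Qed.

Lemma H1_shift (f : R -> R) (c : R) : H1ctrl f -> H1ctrl (fun t => f (t + c)).
Proof.
move=> hf; apply: (@H1_lip _ (fun=> f) 1 1 (fun t => t + c)) => //.
- by move=> x y; rewrite lerD2r.
- by move=> s t _; rewrite mul1r opprD addrACA subrr addr0.
- by move=> s t _; rewrite mul1r sum3 -[leLHS]addr0 -addrA lerD2l addr_ge0.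
Qed.

Lemma H1_opp (f : R -> R) : H1ctrl f -> H1ctrl (fun t => f (- t)).
Proof.
move=> [P [ndP hP]]; exists (fun t => - P (- t)); split.
  by move=> x y xy; rewrite lerN2; apply: ndP; rewrite lerN2.
move=> s t st; have := hP (- t) (- s); rewrite lerN2 => /(_ st).
by rewrite -(sqrrN (_ - _)) opprB [- s - - t]addrC !opprK [P _ - _]addrC.
Qed.

Lemma H1_continuous (f : R -> R) : H1ctrl f -> continuous f.
Proof.
move=> [P [ndP hP]] t; apply/cvgrPdist_lt => e e0.
pose M := P (t + 1) - P (t - 1) + 1.
have M0 : 0 < M by rewrite ltr_wpDl// subr_ge0 ndP//; lra.
have nb y : `|t - y| < 1 -> (f t - f y) ^+ 2 <= `|t - y| * M.
  rewrite ltr_norml => /andP[h1 h2]; have [ty|yt] := leP t y.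
    rewrite -sqrrN opprB; apply: le_trans (hP _ _ ty) _.
    rewrite ler0_norm ?subr_le0// opprB ler_wpM2l ?subr_ge0//.
    have := ndP y (t + 1); have := ndP (t - 1) t; rewrite /M.
    by move=> a b; have := a ltac:(lra); have := b ltac:(lra); lra.
  apply: le_trans (hP _ _ (ltW yt)) _.
  rewrite ger0_norm ?subr_ge0 ?(ltW yt)// ler_wpM2l ?subr_ge0 ?(ltW yt)//.
  have := ndP t (t + 1); have := ndP (t - 1) y; rewrite /M.
  by move=> a b; have := a ltac:(lra); have := b ltac:(lra); lra.
near=> y.
rewrite -ltr_sqr ?nnegrE ?(ltW e0)//.
rewrite real_normK; last exact: num_real.
have y1 : `|t - y| < 1 by near: y; exact: cvgr_dist_lt.
apply: (le_lt_trans (nb y y1)); rewrite -ltr_pdivlMr//.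
by near: y; apply: cvgr_dist_lt => //; rewrite divr_gt0 ?exprn_gt0.
Unshelve. all: by end_near. Qed.

(** The increments of [P] telescope over the grid. *)
Lemma H1_qvar (f P : R -> R) (a b : R) (n : nat) : a < b ->
  (forall s t, s <= t -> (f t - f s) ^+ 2 <= (t - s) * (P t - P s)) ->
  qvar f a b n <= P b - P a.
Proof.
move=> ab hP; have d0 := dyad_gt0 ab n.
have <- : \sum_(0 <= j < 2 ^ n) (P (node a (dyad a b n) j.+1) -
    P (node a (dyad a b n) j)) = P b - P a.
  by rewrite (telescope_sumr (fun j => P (node a (dyad a b n) j)))// node_last node_first.
rewrite big_mkord.
apply: ler_sum => j _; rewrite ler_pdivrMr//.
have jj : node a (dyad a b n) j <= node a (dyad a b n) j.+1 by rewrite node_mono.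
apply: le_trans (hP _ _ jj) _; rewrite mulrC.
by have -> : node a (dyad a b n) j.+1 - node a (dyad a b n) j = dyad a b n
  by rewrite /node -natr1; ring.
Qed.

Lemma derivable_quotient_cvg (f : R -> R) (x l : R) : is_derive x 1 f l ->
  n.+1%:R * (f (x + n.+1%:R^-1) - f x) @[n --> \oo] --> l.
Proof.
move=> [df <-]; have := df; rewrite /derivable => /cvg_ex[/= L cL].
have E : 'D_1 f x = L by apply/cvg_lim => //; exact: cL.
have u0 : (forall n : nat, n.+1%:R^-1 != 0 :> R) /\
    (n.+1%:R^-1 : R) @[n --> \oo] --> 0.
  split; first by move=> n; rewrite invr_eq0 pnatr_eq0.
  exact: cvg_harmonic.
have := (cvgr_dnbhsP _ _ _).1 cL _ u0; rewrite E.
have -> // : (fun n : nat => (n.+1%:R^-1)^-1 *: (f (n.+1%:R^-1 *: 1 + x) - f x)) =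
  (fun n : nat => n.+1%:R * (f (x + n.+1%:R^-1) - f x)).
by apply/funext => n; rewrite invrK /GRing.scale/= mulr1 [_ + x]addrC.
Qed.

Lemma enorm_sqr (u : 'rV[R]_3) : enorm u ^+ 2 = \sum_i u 0 i ^+ 2.
Proof.
rewrite /enorm sqr_sqrtr; first by apply: eq_bigr => i _; rewrite expr2.
by apply: sumr_ge0 => i _; rewrite -expr2 sqr_ge0.
Qed.

(** Riesz's criterion yields a second derivative on each window [[-N, N]], determined only up to
    null sets; the windows are glued by using for all of them the upper limit of difference
    quotients of the tangent. *)
Lemma W22I g : periodic1 g -> (forall t, derivable g t 1) ->
  (forall i, H1ctrl (fun t => deriv1 g t 0 i)) -> W22 g.
Proof.
move=> pg dg hg; split => //; split => //.
pose f i t := deriv1 g t 0 i.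
have cf i : continuous (f i) by exact: H1_continuous (hg i).
(* This representative is measurable and inherits periodicity from [deriv1 g], whatever happens on
   the exceptional null set. *)
pose G (i : 'I_3) x := fine (limn_esup (fun n : nat => (n.+1%:R * (f i (x + n.+1%:R^-1) - f i x))%:E)).
have mG i : measurable_fun setT (G i).
  apply: (measurableT_comp (f := fine)) => //.
  apply: measurable_fun_limn_esup => n; apply/measurable_EFinP.
  have mf : measurable_fun setT (f i) by exact: continuous_measurable_fun.
  apply: measurable_funM; first exact: measurable_cst.
  apply: measurable_funB; last exact: mf.
  by apply: (measurableT_comp mf); exact: measurable_funD.
have key i (N : nat) : (0 < N)%N -> exists gN : R -> R,
   [/\ measurable_fun setT gN, mu.-integrable `[- N%:R, N%:R] (EFin \o gN),
    forall t, - N%:R <= t <= N%:R -> f i t - f i (- N%:R) = Rintegral mu `[- N%:R, t] gN,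
    (\int[mu]_(x in `[(- N%:R)%R, N%:R]) (gN x ^+ 2)%:E < +oo)%E &
    {ae mu, forall x, - N%:R < x < N%:R -> G i x = gN x}].
  move=> N0; have [P [ndP hP]] := hg i.
  have NN : - N%:R < N%:R :> R by move: N0; rewrite -(ltr0n R); lra.
  have [gN [mgN igN FgN qgN]] := riesz_H1 NN (cf i) (fun n => H1_qvar n NN hP).
  exists gN; split => //; first exact: le_lt_trans qgN (ltry _).
  have := ae_derive_primitive NN igN FgN.
  apply: filterS; first exact: (ae_filter_ringOfSetsType mu).
  move=> x hx /hx /derivable_quotient_cvg cx.
  have ce : (n.+1%:R * (f i (x + n.+1%:R^-1) - f i x))%:E @[n --> \oo] --> (gN x)%:E.
    by apply: cvg_EFin; [exact: nearW|exact: cx].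
  by rewrite /G (is_cvg_limn_esupE (cvgP _ ce)) (cvg_lim _ ce).
have aeI i N (gN : R -> R) (u v : R) (p : R -> R) : measurable_fun setT gN ->
    {ae mu, forall x, - N%:R < x < N%:R -> G i x = gN x} ->
    - N%:R < u -> v < N%:R -> measurable_fun setT p ->
    (\int[mu]_(x in `[u, v]) (p (G i x))%:E = \int[mu]_(x in `[u, v]) (p (gN x))%:E)%E.
  move=> mgN ae uN vN mp; apply: ae_eq_integral => //.
  - by apply: measurable_funTS; apply/measurable_EFinP; exact: (measurableT_comp mp (mG i)).
  - by apply: measurable_funTS; apply/measurable_EFinP; exact: (measurableT_comp mp mgN).
  - apply: filterS ae; first exact: (ae_filter_ringOfSetsType mu).
    move=> x hx /=; rewrite in_itv/= => /andP[ux xv]; rewrite hx//.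
    by rewrite (lt_le_trans uN ux) (le_lt_trans xv vN).
have pG i x : G i (x + 1) = G i x.
  have p y : f i (y + 1) = f i y by rewrite /f (deriv1_periodic pg).
  by rewrite /G; congr (fine (limn_esup _)); apply/funext => n; rewrite addrAC !p.
clearbody G.
exists (fun x => \row_i G i x); split; [|split; [|split]].
- by move=> x; apply/rowP => i; rewrite !mxE.
- by move=> i; under eq_fun do rewrite mxE; exact: mG.
- under eq_integral do rewrite enorm_sqr.
  under eq_integral => x _ do under eq_bigr do rewrite mxE.
  have [N [N0 [uN vN]]] := itv_sub_nat_window (0 : R) 1.
  have fin i : (\int[mu]_(x in `[0%R, 1%R]) (G i x ^+ 2)%:E < +oo)%E.
    have [gN [mgN igN FgN qgN ae]] := key i N N0.
    rewrite (@aeI i N gN 0 1 (fun z => z ^+ 2))//.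
    apply: le_lt_trans qgN; apply: ge0_subset_integral => //.
    - by apply: measurable_funTS; apply/measurable_EFinP; exact: measurable_funX.
    - by move=> x _; rewrite lee_fin sqr_ge0.
    - by apply: subset_itv; rewrite bnd_simp ltW.
  have ii i := (square_integrable_itv (mG i) (fin i)).2.
  under eq_integral do rewrite sum3.
  have mI := measurable_itvR `[(0 : R), 1].
  have := integrable_rD mI (integrable_rD mI (ii 0) (ii 1)) (ii 2%:R).
  move=> /integrableP[_]; under eq_integral do rewrite /= ger0_norm ?addr_ge0 ?sqr_ge0//.
  by [].
- move=> s t i st.
  have [N [N0 [uN vN]]] := itv_sub_nat_window s t.
  have [gN [mgN igN FgN qgN ae]] := key i N N0.
  under eq_Rintegral do rewrite mxE.
  rewrite /Rintegral (@aeI i N gN s t id)// -/(Rintegral mu `[s, t] gN).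
  have e1 := FgN s; have e2 := FgN t.
  have ints : mu.-integrable `[- N%:R, t] (EFin \o gN).
    by apply: integrableS igN => //; apply: subset_itvl; rewrite bnd_simp ltW.
  have := Rintegral_itv_cat (ltW uN) st ints.
  rewrite -e1 ?(ltW uN) ?(le_trans st (ltW vN))// -e2.
    move: (Rintegral _ _ _) => I; rewrite -/(f i t) -/(f i s).
    by move: (f i t) (f i s) (f i (- N%:R)) => x y z; clear; lra.
  by rewrite (ltW vN) (le_trans (ltW uN)).
Qed.

Lemma W22_second g : W22 g -> exists G : 'I_3 -> R -> R,
  [/\ forall i, measurable_fun setT (G i),
      forall i x, G i (x + 1) = G i x,
      forall i a b, (\int[mu]_(x in `[a, b]) (G i x ^+ 2)%:E < +oo)%E,
      forall i s t, s <= t ->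
        deriv1 g t 0 i - deriv1 g s 0 i = Rintegral mu `[s, t] (G i) &
      {ae mu, forall x : R, forall i,
        is_derive x 1 (fun t => deriv1 g t 0 i) (G i x)}].
Proof.
move=> [pg [dg [g2 [pg2 [mg2 [fin FTC]]]]]].
pose G i x := g2 x 0 i.
have per i x : G i (x + 1) = G i x by rewrite /G pg2.
have loc i a b : (\int[mu]_(x in `[a, b]) (G i x ^+ 2)%:E < +oo)%E.
  apply: period_integral_lty => [| | |].
  - by apply/measurable_EFinP; apply: measurable_funX; exact: mg2.
  - by move=> x; rewrite lee_fin sqr_ge0.
  - by move=> x; rewrite per.
  - apply: le_lt_trans fin; apply: ge0_le_integral => //.
    + by move=> x _; rewrite lee_fin sqr_ge0.
    + by apply: measurable_funTS; apply/measurable_EFinP; apply: measurable_funX; exact: mg2.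
    + apply: measurable_funTS; apply/measurable_EFinP.
      under eq_fun do rewrite enorm_sqr sum3.
      by apply: measurable_funD; [apply: measurable_funD|]; apply: measurable_funX; exact: mg2.
    + move=> x _; rewrite lee_fin enorm_sqr (bigD1 i)//= lerDl.
      by apply: sumr_ge0 => j _; exact: sqr_ge0.
exists G; split => //; first by move=> i s t; exact: FTC.
have ae i (n : nat) : {ae mu, forall x : R, - n.+1%:R < x < n.+1%:R ->
    is_derive x 1 (fun t => deriv1 g t 0 i) (G i x)}.
  apply: ae_derive_primitive.
  - by have := ltr0Sn R n; lra.
  - exact: (square_integrable_itv (mg2 i) (loc i _ _)).1.
  - by move=> t /andP[nt _]; exact: FTC.
have ae3 i : {ae mu, forall x : R, forall n : nat, - n.+1%:R < x < n.+1%:R ->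
    is_derive x 1 (fun t => deriv1 g t 0 i) (G i x)}.
  exact: ae_foralln (ae i).
(* Reading the coordinate as [inord k] turns the finite quantifier into a countable one, to which
   [ae_foralln] applies. *)
have ae4 : {ae mu, forall x : R, forall k n : nat, - n.+1%:R < x < n.+1%:R ->
    is_derive x 1 (fun t => deriv1 g t 0 (inord k)) (G (inord k) x)}.
  exact: ae_foralln (fun k => ae3 (inord k)).
apply: filterS ae4; first exact: (ae_filter_ringOfSetsType mu).
move=> x hx; have [n [n0 [nx xn]]] := itv_sub_nat_window x x.
case: n n0 nx xn => // n _ nx xn.
have xw : - n.+1%:R < x < n.+1%:R by rewrite nx xn.
by move=> i; have := hx i n xw; rewrite inord_val.
Qed.

(** Converse to [W22I]: [Psi] is a primitive of the squared second derivative. *)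
Lemma W22_H1 g i : W22 g -> H1ctrl (fun t => deriv1 g t 0 i).
Proof.
move=> /W22_second[G [mG pG lG FTC _]].
have li a b := (square_integrable_itv (mG i) (lG i a b)).
have [P hP] := signed_primitive (fun a b => (li a b).2).
exists P; split.
  by move=> x y xy; rewrite -subr_ge0 hP//; apply: Rintegral_ge0 => z _; exact: sqr_ge0.
move=> s t st; rewrite FTC// hP//.
exact: cauchy_schwarz_itv (li _ _).1 (li _ _).2.
Qed.

End curves.

(** * Euclidean geometry of R^3 *)

Section euclidean.
Context {R : realType}.
Implicit Types u v w : 'rV[R]_3.

Lemma dotE u v : dot u v = u 0 0 * v 0 0 + u 0 1 * v 0 1 + u 0 2%:R * v 0 2%:R.
Proof. exact: sum3. Qed.

Lemma dot_ge0 u : 0 <= dot u u.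
Proof. by apply: sumr_ge0 => i _; rewrite -expr2 sqr_ge0. Qed.

Lemma dotC u v : dot u v = dot v u.
Proof. by rewrite !dotE; ring. Qed.

Lemma dotDl u v w : dot (u + v) w = dot u w + dot v w.
Proof. by rewrite !dotE !mxE; ring. Qed.

Lemma dotZl (c : R) u v : dot (c *: u) v = c * dot u v.
Proof. by rewrite !dotE !mxE; ring. Qed.

Lemma dotDr u v w : dot w (u + v) = dot w u + dot w v.
Proof. by rewrite !dotE !mxE; ring. Qed.

Lemma dotZr (c : R) u v : dot v (c *: u) = c * dot v u.
Proof. by rewrite !dotE !mxE; ring. Qed.

Lemma dotNr u v : dot v (- u) = - dot v u.
Proof. by rewrite !dotE !mxE; ring. Qed.

Lemma dotNl u v : dot (- u) v = - dot u v.
Proof. by rewrite !dotE !mxE; ring. Qed.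

Definition dotLE := (dotDl, dotDr, dotZl, dotZr, dotNl, dotNr).

Lemma enorm_dot u : enorm u ^+ 2 = dot u u.
Proof. by rewrite /enorm sqr_sqrtr// dot_ge0. Qed.

Lemma enorm_ge0 u : 0 <= enorm u. Proof. exact: sqrtr_ge0. Qed.

Lemma cross_norm2_ge0 u v : 0 <= cross_norm2 u v.
Proof.
have -> : cross_norm2 u v = (u 0 0 * v 0 1 - u 0 1 * v 0 0) ^+ 2 +
    (u 0 0 * v 0 2%:R - u 0 2%:R * v 0 0) ^+ 2 +
    (u 0 1 * v 0 2%:R - u 0 2%:R * v 0 1) ^+ 2.
  by rewrite /cross_norm2 !dotE; ring.
by rewrite !addr_ge0 ?sqr_ge0.
Qed.

(** The area spanned with the tangent sees only the normal part of the chord, so the chord may be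
    replaced by its Taylor remainder. *)
Lemma cross_norm2_shear u v (c : R) : cross_norm2 u (v + c *: u) = cross_norm2 u v.
Proof. by rewrite /cross_norm2 !dotE !mxE; ring. Qed.

Lemma cross_norm2_le u v : cross_norm2 u v <= dot u u * dot v v.
Proof. by rewrite /cross_norm2 lerBlDr lerDl sqr_ge0. Qed.

Lemma cauchy_dot u v : `|dot u v| <= enorm u * enorm v.
Proof.
rewrite -ler_sqr ?nnegrE ?mulr_ge0 ?enorm_ge0// exprMn !enorm_dot.
rewrite real_normK ?num_real//.
by have := cross_norm2_ge0 u v; rewrite /cross_norm2 subr_ge0.
Qed.

Lemma enormD u v : enorm (u + v) <= enorm u + enorm v.
Proof.
rewrite -ler_sqr ?nnegrE ?addr_ge0 ?enorm_ge0// enorm_dot sqrrD !enorm_dot !dotLE.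
have := cauchy_dot u v; rewrite ler_norml => /andP[_ h].
by rewrite (dotC v u); lra.
Qed.

Lemma enormZ (c : R) u : enorm (c *: u) = `|c| * enorm u.
Proof. by rewrite /enorm !dotLE mulrA -expr2 sqrtrM ?sqr_ge0// sqrtr_sqr. Qed.

Lemma enormN u : enorm (- u) = enorm u.
Proof. by rewrite /enorm !dotLE opprK. Qed.

Lemma enorm_distC u v : enorm (u - v) = enorm (v - u).
Proof. by rewrite -enormN opprB. Qed.

Lemma enorm0 : enorm (0 : 'rV[R]_3) = 0.
Proof. by rewrite /enorm dotE !mxE !mulr0 !addr0 sqrtr0. Qed.

Lemma enorm_eq0 u : (enorm u == 0) = (u == 0).
Proof.
apply/eqP/eqP => [|->]; last exact: enorm0.
move=> h; apply/rowP => i; rewrite mxE; apply/eqP; rewrite -sqrf_eq0.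
have := enorm_sqr u; rewrite h expr0n/= => /esym/eqP.
by rewrite psumr_eq0 => [/allP/(_ i)|j _]; rewrite ?sqr_ge0// mem_index_enum; apply.
Qed.

Lemma enorm_gt0 u : (0 < enorm u) = (u != 0).
Proof. by rewrite lt_def enorm_ge0 andbT enorm_eq0. Qed.

Lemma enorm_coord u i : `|u 0 i| <= enorm u.
Proof.
rewrite -ler_sqr ?nnegrE ?enorm_ge0// real_normK ?num_real// enorm_sqr (bigD1 i)//= lerDl.
by apply: sumr_ge0 => j _; exact: sqr_ge0.
Qed.

Lemma enorm_le_sum u : enorm u <= \sum_i `|u 0 i|.
Proof.
rewrite -ler_sqr ?nnegrE ?enorm_ge0 ?sumr_ge0// enorm_sqr !sum3.
rewrite -!(real_normK (num_real (u 0 _))).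
have := normr_ge0 (u 0 0); have := normr_ge0 (u 0 1); have := normr_ge0 (u 0 2%:R).
move: (`|u 0 0|) (`|u 0 1|) (`|u 0 2%:R|) => x y z hz hy hx.
by have := mulr_ge0 hx hy; have := mulr_ge0 hx hz; have := mulr_ge0 hy hz; rewrite !expr2; nra.
Qed.

Lemma enorm_le_norm u : enorm u <= 3 * `|u|.
Proof.
apply: (le_trans (enorm_le_sum u)); rewrite sum3.
have := row_norm_coord u 0; have := row_norm_coord u 1; have := row_norm_coord u 2%:R; lra.
Qed.

End euclidean.

(** * Real powers and differentiation under the integral *)

Section powR_derivatives.
Context {R : realType}.

Lemma is_derive_powR_pos (f : R -> R) (x df al : R) : 0 < f x ->
  is_derive x 1 f df ->
  is_derive x 1 (fun y => powR (f y) al) (al * powR (f x) (al - 1) * df).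
Proof.
move=> fx hf; have h := is_derive1_powR al fx.
by have := is_derive1_comp h hf.
Qed.

(** Where [f] vanishes, the quotient of its power [p] is the power [p - 1] of [f] times the quotient
    of [f], and tends to 0. The tangent-point kernel meets this case wherever the chord is tangent
    to the curve. *)
Lemma is_derive_powR_ge0 (f : R -> R) (x df p : R) : 1 < p ->
  (forall y, 0 <= f y) -> is_derive x 1 f df ->
  is_derive x 1 (fun y => powR (f y) p) (p * powR (f x) (p - 1) * df).
Proof.
move=> p1 f0 hf; have p0 : 0 < p - 1 by rewrite subr_gt0.
have := f0 x; rewrite le_eqVlt => /predU1P[fx|fx]; last exact: is_derive_powR_pos.
have cf : {for x, continuous f}.
  by apply: differentiable_continuous; apply/derivable1_diffP; case: hf.
rewrite -fx powR0 ?gt_eqF// mulr0 mul0r.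
have c1 : powR (f (h *: 1 + x)) (p - 1) @[h --> 0^'] --> (0 : R).
  apply/cvgrPdist_lt => e e0.
  have e0' : 0 < powR e (p - 1)^-1 by exact: powR_gt0.
  have : \forall y \near x, `|f x - f y| < powR e (p - 1)^-1.
    by have /cvgrPdist_lt := cf; apply.
  move=> /nbhs_ballP[d /= d0 hd].
  exists d => //= h /= hh _; rewrite sub0r normrN ger0_norm ?powR_ge0//.
  have : ball x d (h *: 1 + x).
    rewrite /ball/= opprD addrCA subrr addr0 normrN /GRing.scale/= mulr1.
    by move: hh; rewrite sub0r normrN.
  move=> /hd; rewrite -fx sub0r normrN ger0_norm// => hf'.
  have -> : e = powR (powR e (p - 1)^-1) (p - 1).
    by rewrite -powRrM mulVf ?gt_eqF// powRr1// ltW.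
  by apply: gt0_ltr_powR; rewrite ?nnegrE ?powR_ge0.
have c2 : h^-1 *: (f (h *: 1 + x) - f x) @[h --> 0^'] --> df.
  by case: hf => /cvg_ex[/= l cl] <-; rewrite /derive; have -> := cvg_lim _ cl.
have c3 : h^-1 *: (powR (f (h *: 1 + x)) p - powR (f x) p) @[h --> 0^'] --> (0 : R).
  have -> : (fun h => h^-1 *: (powR (f (h *: 1 + x)) p - powR (f x) p)) =
      (fun h => powR (f (h *: 1 + x)) (p - 1) * (h^-1 *: (f (h *: 1 + x) - f x))).
    apply/funext => h.
    rewrite -fx powR0 ?gt_eqF ?(lt_trans _ p1)// !subr0 /GRing.scale/=.
    rewrite [RHS]mulrCA; congr (_ * _).
    rewrite -[X in _ = _ * X]powRr1// -powRD; last by rewrite subrK (gt_eqF (lt_trans _ p1)).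
    by rewrite subrK.
  have := cvgM c1 c2; rewrite mul0r. exact.
apply: DeriveDef; first by apply/cvg_ex; exists 0.
exact/cvg_lim.
Qed.

(** Common shape of the three integrands: the squared lengths [a], [b], [c], bounded away from 0,
    carry real exponents, while the factor [n], which may vanish, stays linear. *)
Definition prodpow (al be ga n a b c : R) : R :=
  n * powR a al * powR b be * powR c ga.

Definition dprodpow (al be ga n a b c dn da db dc : R) : R :=
  dn * (powR a al * powR b be * powR c ga) +
  da * (n * al * powR a (al - 1) * powR b be * powR c ga) +
  db * (n * be * powR b (be - 1) * powR a al * powR c ga) +
  dc * (n * ga * powR c (ga - 1) * powR a al * powR b be).

Lemma is_derive_prodpow (al be ga e : R) (n a b c : R -> R) (dn da db dc : R) :
  0 < a e -> 0 < b e -> 0 < c e ->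
  is_derive e 1 n dn -> is_derive e 1 a da -> is_derive e 1 b db ->
  is_derive e 1 c dc ->
  is_derive e 1 (fun x => prodpow al be ga (n x) (a x) (b x) (c x))
    (dprodpow al be ga (n e) (a e) (b e) (c e) dn da db dc).
Proof.
move=> a0 b0 c0 hn ha hb hc.
have pa := is_derive_powR_pos al a0 ha.
have pb := is_derive_powR_pos be b0 hb.
have pc := is_derive_powR_pos ga c0 hc.
have := is_deriveM (is_deriveM (is_deriveM hn pa) pb) pc.
have -> : (((n * (fun y => powR (a y) al)) * (fun y => powR (b y) be)) *
  (fun y => powR (c y) ga)) = (fun x => prodpow al be ga (n x) (a x) (b x) (c x)) by [].
move=> h; apply: is_derive_eq; rewrite ?fctE /GRing.scale/= /dprodpow.
by ring.
Qed.

Lemma powR_bounded (al m M : R) : 0 < m -> exists2 C, 0 <= C &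
  forall a, m <= a <= M -> `|powR a al| <= C.
Proof.
move=> m0; exists (powR m al + powR M al); first by rewrite addr_ge0 ?powR_ge0.
move=> a /andP[ma aM]; rewrite ger0_norm ?powR_ge0//.
have a0 : 0 < a by exact: lt_le_trans ma.
have M0 : 0 < M by exact: lt_le_trans aM.
have [al0|al0] := leP 0 al.
  by rewrite ler_wpDl ?powR_ge0// ge0_ler_powR ?nnegrE// ltW.
have e x : powR x al = (powR x (- al))^-1 by rewrite powRN invrK.
rewrite ler_wpDr ?powR_ge0// (e a) (e m) lef_pV2 ?posrE ?powR_gt0//.
have al1 : 0 <= - al by rewrite oppr_ge0 ltW.
by apply: (ge0_ler_powR al1) => //; rewrite nnegrE; exact: ltW.
Qed.

(** On a compact range away from 0 all powers are bounded, so the numerator alone controls value and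
    derivative; [w] stays outside [C] because it will depend on the point of integration. *)
Lemma prodpow_bound (al be ga m M : R) : 0 < m -> exists2 C, 0 <= C &
  forall n a b c dn da db dc w, `|n| <= w -> `|dn| <= w ->
    m <= a <= M -> m <= b <= M -> m <= c <= M ->
    `|da| <= M -> `|db| <= M -> `|dc| <= M ->
    `|prodpow al be ga n a b c| <= C * w /\
    `|dprodpow al be ga n a b c dn da db dc| <= C * w.
Proof.
move=> m0.
have [A A0 hA] := powR_bounded al M m0; have [A' A'0 hA'] := powR_bounded (al - 1) M m0.
have [B B0 hB] := powR_bounded be M m0; have [B' B'0 hB'] := powR_bounded (be - 1) M m0.
have [C C0 hC] := powR_bounded ga M m0; have [C' C'0 hC'] := powR_bounded (ga - 1) M m0.
exists (A * B * C + `|M| * `|al| * A' * B * C + `|M| * `|be| * B' * A * C +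
  `|M| * `|ga| * C' * A * B); first by rewrite !addr_ge0 ?mulr_ge0.
move=> n a b c dn da db dc w hn hdn ha hb hc hda hdb hdc.
have w0 : 0 <= w by exact: le_trans hn.
have t1 x : `|x| <= w -> `|x * (powR a al * powR b be * powR c ga)| <= A * B * C * w.
  move=> hx; rewrite !normrM mulrC; apply: ler_pM; rewrite ?mulr_ge0//.
  by apply: ler_pM; rewrite ?mulr_ge0//; [apply: ler_pM => //; [exact: hA|exact: hB]|exact: hC].
have MM x : `|x| <= M -> `|x| <= `|M| by move=> h; rewrite (le_trans h)// ler_norm.
have t2 x k p q r P Q S : `|x| <= M -> `|p| <= P -> `|q| <= Q -> `|r| <= S ->
    `|x * (n * k * p * q * r)| <= `|M| * `|k| * P * Q * S * w.
  move=> /MM hx hp hq hr; rewrite !normrM.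
  have -> : `|M| * `|k| * P * Q * S * w = `|M| * (w * `|k| * P * Q * S) by ring.
  by do 5 (apply: ler_pM => //; rewrite ?mulr_ge0//).
split.
  have -> : prodpow al be ga n a b c = n * (powR a al * powR b be * powR c ga).
    by rewrite /prodpow; ring.
  apply: (le_trans (t1 _ hn)); rewrite -!addrA ler_wpM2r// lerDl.
  by rewrite !addr_ge0 ?mulr_ge0.
rewrite /dprodpow !mulrDl.
apply: le_trans (ler_normD _ _) _; apply: lerD; last by apply: t2 => //; [exact: hC'|exact: hA|exact: hB].
apply: le_trans (ler_normD _ _) _; apply: lerD; last by apply: t2 => //; [exact: hB'|exact: hA|exact: hC].
apply: le_trans (ler_normD _ _) _; apply: lerD; last by apply: t2 => //; [exact: hA'|exact: hB|exact: hC].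
exact: t1.
Qed.

Lemma has_dir_derivP (F : (R -> 'rV[R]_3) -> R) g h l :
  is_derive (0 : R) 1 (fun e : R => F (fun t => g t + e *: h t)) l ->
  has_dir_deriv F g h l.
Proof.
move=> [/cvg_ex[/= L cL] E]; have EL : L = l.
  by rewrite -E /derive; apply/esym/cvg_lim.
rewrite EL in cL; rewrite /has_dir_deriv.
have e0 : (fun t => g t + 0 *: h t) = g.
  by apply/funext => t; rewrite scale0r addr0.
move: cL; rewrite e0.
have -> // : (fun h0 : R => h0^-1 *: (F (fun t => g t + (h0 *: 1 + 0) *: h t) - F g)) =
  (fun e : R => (F (fun t => g t + e *: h t) - F g) / e).
by apply/funext => e; rewrite /GRing.scale/= mulr1 addr0 mulrC.
Qed.

Lemma is_derive_Rintegral d (Y : measurableType d)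
    (mu : {measure set Y -> \bar R}) (B : set Y) (F dF : R -> Y -> R)
    (G : Y -> R) (dl : R) : 0 < dl -> measurable B ->
  (forall e, `|e| < dl -> measurable_fun B (F e)) ->
  (forall (e : R) y, `|e| < dl -> B y -> is_derive e 1 (F ^~ y) (dF e y)) ->
  (forall e y, `|e| < dl -> B y -> `|F e y| <= G y /\ `|dF e y| <= G y) ->
  (forall y, 0 <= G y) -> mu.-integrable B (EFin \o G) ->
  mu.-integrable B (EFin \o dF 0) /\
  is_derive (0 : R) 1 (fun e => Rintegral mu B (F e)) (Rintegral mu B (dF 0)).
Proof.
move=> dl0 mB mF dFP bd G0 iG.
have z0 : `|0 : R| < dl by rewrite normr0.
have Fi e : `|e| < dl -> mu.-integrable B (EFin \o F e).
  move=> he; apply: (@le_integrable_r _ _ _ mu _ mB _ G) => //; first exact: mF.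
  by move=> y By; have [] := bd _ _ he By.
(* Steps tending to 0 inside the admissible range; the difference quotients along them make [dF 0]
   measurable. *)
pose u (n : nat) := dl / 2 * n.+1%:R^-1.
have small n : `|u n| < dl.
  rewrite ger0_norm; last by rewrite mulr_ge0 ?divr_ge0// ltW.
  apply: (@le_lt_trans _ _ (dl / 2)); last by rewrite ltr_pdivrMr// ltr_pMr// ltr1n.
  by rewrite ler_piMr ?divr_ge0 ?(ltW dl0)// invf_le1// ler1n.
have mdF : measurable_fun B (dF 0).
  apply: (@measurable_fun_cvg _ _ _ _ (fun (n : nat) y => (u n)^-1 * (F (u n) y - F 0 y))).
    move=> n; apply: measurable_funM => //; apply: measurable_funB; exact: mF.
  move=> y By; have [/cvg_ex[/= L cL] <-] := dFP 0 y z0 By.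
  have -> : 'D_1 (F ^~ y) 0 = L by exact/cvg_lim.
  have u0 : (forall n : nat, u n != 0) /\ u n @[n --> \oo] --> 0.
    split; first by move=> n; rewrite !mulf_neq0 ?invr_eq0 ?pnatr_eq0// gt_eqF.
    rewrite -[X in _ --> X](mulr0 (dl / 2)); apply: cvgM; first exact: cvg_cst.
    exact: cvg_harmonic.
  have := (cvgr_dnbhsP _ _ _).1 cL _ u0.
  have -> // : (fun n : nat => (u n)^-1 *: (F (u n *: 1 + 0) y - F 0 y)) =
     (fun n : nat => (u n)^-1 * (F (u n) y - F 0 y)).
  by apply/funext => n; rewrite /GRing.scale/= mulr1 addr0.
split.
  apply: (@le_integrable_r _ _ _ mu _ mB _ G) => // y By.
  by have [] := bd _ _ z0 By.
have I0 : `]- dl, dl[%classic 0 by rewrite /= in_itv/= oppr_lt0 dl0.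
have toI e : `]- dl, dl[%classic e -> `|e| < dl.
  by rewrite /= in_itv/= ltr_norml.
have d1E e y : `]- dl, dl[%classic e -> B y -> partial1of2 F e y = dF e y.
  by move=> /toI he By; rewrite partial1of2E; have [_ ->] := dFP _ _ he By.
have cdi := @cvg_differentiation_under_integral R d Y mu F B mB 0 (- dl) dl I0
  (fun x Ix => Fi x (toI x Ix)) (fun x y Ix By => @ex_derive _ _ _ _ _ _ _ (dFP x y (toI x Ix) By)) G G0 iG.
have {}cdi := cdi (fun x y Ix By => eq_ind_r (fun z => `|z| <= G y) (bd x y (toI x Ix) By).2 (d1E x y Ix By)).
have E : Rintegral mu B (partial1of2 F 0) = Rintegral mu B (dF 0).
  by apply: eq_Rintegral => y /set_mem By; exact: d1E.
rewrite E in cdi.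
have c : h^-1 *: (Rintegral mu B (F (h *: 1 + 0)) - Rintegral mu B (F 0)) @[h --> 0^']
    --> Rintegral mu B (dF 0).
  by under eq_fun do rewrite [_ *: 1]mulr1.
apply: DeriveDef; first by apply/cvg_ex; eexists; exact: c.
exact/cvg_lim.
Qed.

End powR_derivatives.

(** * Measurability of roots, powers and inverses *)

Section measurable_tools.
Context d (T : measurableType d) {R : realType}.
Implicit Types (D : set T) (g : T -> R).

Lemma measurable_fun_sqrt D g : measurable_fun D g ->
  measurable_fun D (fun x => Num.sqrt (g x)).
Proof.
move=> mg; have ms : measurable_fun setT (@Num.sqrt R).
  by apply: continuous_measurable_fun; exact: sqrt_continuous.
exact: (measurableT_comp ms mg).
Qed.

Lemma measurable_fun_powR D g p : measurable_fun D g ->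
  measurable_fun D (fun x => powR (g x) p).
Proof. by move=> mg; exact: (measurableT_comp (measurable_powR p) mg). Qed.

(** Writing the inverse of [x] as [x] times the inverse of [x ^+ 2] puts a nonnegative number under
    the real power; at 0 both sides are 0 by convention. *)
Lemma measurable_fun_invr D g : measurable_fun D g ->
  measurable_fun D (fun x => (g x)^-1).
Proof.
move=> mg; have -> : (fun x => (g x)^-1) = (fun x => g x * powR (g x ^+ 2) (- 1)).
  apply/funext => x; rewrite powR_inv1 ?sqr_ge0//.
  have [->|gx] := eqVneq (g x) 0; first by rewrite invr0 mul0r.
  by rewrite expr2 invfM mulrA mulfV// mul1r.
apply: measurable_funM => //.
by apply: measurable_fun_powR; exact: measurable_funX.
Qed.

End measurable_tools.

(** * Tonelli's theorem on product sets *)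

Section tonelli_on_sets.
Context {R : realType}.
Local Notation mu := (@lebesgue_measure R).
Variables (k : R -> R -> R) (A B : set R).
Hypothesis mk : measurable_fun [set: measurableTypeR R * measurableTypeR R]
  (fun z => k z.1 z.2).
Hypothesis k0 : forall x y, 0 <= k x y.
Hypotheses (mA : measurable (A : set (measurableTypeR R)))
           (mB : measurable (B : set (measurableTypeR R))).

Let K (z : measurableTypeR R * measurableTypeR R) : \bar R :=
  (\1_A z.1 * \1_B z.2 * k z.1 z.2)%:E.

Let mK : measurable_fun setT K.
Proof.
apply/measurable_EFinP; apply: measurable_funM => //; apply: measurable_funM.
- have mA' : measurable_fun setT (\1_A : measurableTypeR R -> R) by exact: measurable_indic.
  exact: (measurableT_comp mA' measurable_fst).
- have mB' : measurable_fun setT (\1_B : measurableTypeR R -> R) by exact: measurable_indic.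
  exact: (measurableT_comp mB' measurable_snd).
Qed.

Let K0 z : (0 <= K z)%E. Proof. by rewrite lee_fin !mulr_ge0. Qed.

Let patchB x : (\int[mu]_(y in B) (k x y)%:E = \int[mu]_y (\1_B y * k x y)%:E)%E.
Proof.
rewrite integral_mkcond; apply: eq_integral => y _; rewrite patchE indicE.
by case: ifPn => _; rewrite ?mul1r ?mul0r.
Qed.

Let patchA y : (\int[mu]_(x in A) (k x y)%:E = \int[mu]_x (\1_A x * k x y)%:E)%E.
Proof.
rewrite integral_mkcond; apply: eq_integral => x _; rewrite patchE indicE.
by case: ifPn => _; rewrite ?mul1r ?mul0r.
Qed.

Let innerB x : (((fun x => \int[mu]_(y in B) (k x y)%:E) \_ A) x = \int[mu]_y K (x, y))%E.
Proof.
rewrite patchE; case: ifPn => xA.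
  by rewrite patchB; apply: eq_integral => y _; rewrite /K/= [X in (X * _ * _)%R]indicE xA mul1r.
rewrite integral0_eq// => y _.
by rewrite /K/= [X in (X * _ * _)%R]indicE (negbTE xA) !mul0r.
Qed.

Let innerA y : (((fun y => \int[mu]_(x in A) (k x y)%:E) \_ B) y = \int[mu]_x K (x, y))%E.
Proof.
rewrite patchE; case: ifPn => yB.
  rewrite patchA; apply: eq_integral => x _.
  by rewrite /K/= [X in (_ * X * _)%R]indicE yB mulr1.
rewrite integral0_eq// => x _.
by rewrite /K/= [X in (_ * X * _)%R]indicE (negbTE yB) mulr0 mul0r.
Qed.

Lemma tonelli_sets :
  (\int[mu]_(x in A) \int[mu]_(y in B) (k x y)%:E =
   \int[mu]_(y in B) \int[mu]_(x in A) (k x y)%:E)%E.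
Proof.
rewrite integral_mkcond [RHS]integral_mkcond.
under eq_integral do rewrite innerB.
under [RHS]eq_integral do rewrite innerA.
exact: fubini_tonelli.
Qed.

Lemma tonelli_sets_prod :
  (\int[mu]_(x in A) \int[mu]_(y in B) (k x y)%:E =
   \int[mu \x mu]_(z in A `*` B) (k z.1 z.2)%:E)%E.
Proof.
rewrite integral_mkcond; under eq_integral do rewrite innerB.
transitivity (\int[mu \x mu]_z K z)%E; first by rewrite fubini_tonelli1.
rewrite [RHS]integral_mkcond; apply: eq_integral => -[x y] _; rewrite patchE /K /= !indicE.
case: ifPn => [/set_mem[/= xA yB]|]; first by rewrite !mem_set// !mul1r.
rewrite notin_setE /setX /= => /not_andP[xA|yB]; first by rewrite memNset// !mul0r.
by rewrite (memNset yB) mulr0 mul0r.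
Qed.

Lemma measurable_inner : measurable_fun setT (fun x : measurableTypeR R =>
  \int[mu]_(y in B) (k x y)%:E)%E.
Proof.
under eq_fun do rewrite patchB.
have mk' : measurable_fun [set: measurableTypeR R * measurableTypeR R]
    (fun z => (\1_B z.2 * k z.1 z.2)%:E).
  apply/measurable_EFinP; apply: measurable_funM => //.
  have mB' : measurable_fun setT (\1_B : measurableTypeR R -> R) by exact: measurable_indic.
  exact: (measurableT_comp mB' measurable_snd).
have p z : (0 <= (\1_B z.2 * k z.1 z.2)%:E)%E by rewrite lee_fin mulr_ge0.
by have := measurable_fun_fubini_tonelli_F (m2 := mu) _ mk' p; exact.
Qed.

End tonelli_on_sets.

(** * Integrability of fourth powers of difference quotients *)

Section difference_quotients.
Context {R : realType}.
Local Notation mu := (@lebesgue_measure R).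

(* The kernel [z^4 (1 + z^2 h)^(-3/2)] makes the Hardy--Littlewood--Sobolev type
   estimate at the critical exponent elementary: its integral in [h] is at most
   [2 z^2], and Young's inequality bounds the fourth power of a mean by it. *)
Definition crit_ker (h z : R) : R := z ^+ 4 / Num.sqrt (1 + z ^+ 2 * h) ^+ 3.

Let wgt (h z : R) := Num.sqrt (1 + z ^+ 2 * h).

Let wgt_gt0 h z : 0 <= h -> 0 < wgt h z.
Proof. by move=> h0; rewrite sqrtr_gt0 ltr_wpDr// mulr_ge0 ?sqr_ge0. Qed.

Lemma crit_ker_ge0 h z : 0 <= crit_ker h z.
Proof.
by apply: divr_ge0; [exact: exprn_even_ge0|rewrite exprn_ge0// sqrtr_ge0].
Qed.

(** Let [w = wgt h z]. If [z <= B * w], the second term suffices because [w >= 1]; otherwise the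
    cube of [B * w] is at most that of [z], and the first term does. *)
Lemma young_crit (h z B : R) : 0 <= h -> 0 <= z -> 0 < B ->
  z <= crit_ker h z / B ^+ 3 + B * (1 + z ^+ 2 * h).
Proof.
move=> h0 z0 B0; have w0 := wgt_gt0 z h0.
have w1 : 1 <= wgt h z.
  rewrite -[leLHS]sqrtr1 ler_sqrt ?lerDl ?mulr_ge0 ?sqr_ge0//.
  by rewrite ltW// ltr_wpDr// mulr_ge0 ?sqr_ge0.
have ww : wgt h z ^+ 2 = 1 + z ^+ 2 * h.
  by rewrite sqr_sqrtr// addr_ge0 ?mulr_ge0 ?sqr_ge0.
rewrite -ww /crit_ker -/(wgt h z).
have wle : B * wgt h z <= B * wgt h z ^+ 2.
  by rewrite ler_wpM2l ?(ltW B0)// expr2 ler_peMr// ltW.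
have [zw|wz] := leP z (B * wgt h z).
  by rewrite (le_trans zw)// (le_trans wle)// lerDr divr_ge0 ?exprn_ge0 ?(ltW B0)// crit_ker_ge0.
rewrite -[leLHS]addr0 lerD ?mulr_ge0 ?exprn_ge0 ?(ltW B0) ?(ltW w0)//.
rewrite -mulrA -invfM -exprMn ler_pdivlMr ?exprn_gt0 ?mulr_gt0//.
rewrite [z ^+ 4]exprS ler_wpM2l// ler_pXn2r ?nnegrE ?mulr_ge0 ?(ltW B0) ?(ltW w0)//.
by rewrite mulrC ltW.
Qed.

Lemma crit_ker_integral (z H : R) : 0 < H ->
  (\int[mu]_(h in `[0%R, H]) (crit_ker h z)%:E <= (2 * z ^+ 2)%:E)%E.
Proof.
move=> H0.
(* An explicit primitive, with values between [- 2 z^2] and 0. *)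
pose P (h : R) := - (2 * z ^+ 2) * powR (1 + z ^+ 2 * h) (- 2^-1).
have pos (h : R) : 0 <= h -> 0 < 1 + z ^+ 2 * h by move=> h0; rewrite ltr_wpDr// mulr_ge0 ?sqr_ge0.
have kE (h : R) : 0 <= h -> crit_ker h z = - (2 * z ^+ 2) * (- 2^-1 * powR (1 + z ^+ 2 * h) (- 2^-1 - 1) * z ^+ 2).
  move=> h0; have p := pos h h0.
  have -> : - 2^-1 - 1 = - (2^-1 * 3) :> R by lra.
  rewrite powRN powRrM powR12_sqrt ?(ltW p)// (powR_mulrn 3) ?sqrtr_ge0//.
  rewrite /crit_ker; set w := _ ^- 3.
  have -> : z ^+ 4 = z ^+ 2 * z ^+ 2 by ring.
  by field.
have dP (h : R) : 0 <= h -> is_derive h 1 P (crit_ker h z).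
  move=> h0; rewrite (kE h h0).
  have d1 : is_derive h 1 (fun h : R => 1 + z ^+ 2 * h) (z ^+ 2).
    by apply: is_derive_eq; rewrite /GRing.scale/=; ring.
  have d2 := @is_derive_powR_pos _ (fun h : R => 1 + z ^+ 2 * h) h _ (- 2^-1) (pos h h0) d1.
  by apply: is_derive_eq; rewrite /GRing.scale/=; ring.
have cP (h : R) : 0 <= h -> {for h, continuous P}.
  by move=> h0; apply: differentiable_continuous; apply/derivable1_diffP; case: (dP h h0).
have ck (h : R) : 0 <= h -> {for h, continuous (crit_ker ^~ z)}.
  move=> h0; apply: cvgM; first exact: cvg_cst.
  apply: cvgV; first by rewrite expf_neq0// gt_eqF// wgt_gt0.
  apply: (@continuous_comp _ _ _ (fun h => Num.sqrt (1 + z ^+ 2 * h)) (fun x => x ^+ 3)); last exact: exprn_continuous.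
  apply: (@continuous_comp _ _ _ (fun h => 1 + z ^+ 2 * h) Num.sqrt); last exact: sqrt_continuous.
  apply: cvgD; first exact: cvg_cst.
  by apply: cvgM; [exact: cvg_cst|exact: cvg_id].
rewrite (@continuous_FTC2 _ _ P 0 H H0).
- rewrite -EFinB lee_fin /P mulr0 addr0.
  have -> : powR 1 (- 2^-1) = 1 :> R by rewrite powR1.
  have := mulr_ge0 (sqr_ge0 z) (powR_ge0 (1 + z ^+ 2 * H) (- 2^-1)); lra.
- by apply: continuous_in_subspaceT => h /set_mem/=; rewrite in_itv/= => /andP[h0 _]; exact: ck.
- split.
  + by move=> h; rewrite in_itv/= => /andP[/ltW h0 _]; case: (dP h h0).
  + exact/cvg_at_right_filter/cP.
  + exact/cvg_at_left_filter/cP/ltW.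
- by move=> h; rewrite in_itv/= => /andP[/ltW h0 _]; rewrite derive1E; case: (dP h h0).
Qed.

Variables (f F : R -> R).
Hypotheses (mf : measurable_fun setT f) (f0 : forall x, 0 <= f x).
Hypothesis f2 : forall a b, (\int[mu]_(x in `[a, b]) (f x ^+ 2)%:E < +oo)%E.
Hypothesis FE : forall s t, s <= t -> F t - F s = Rintegral mu `[s, t] f.

(** Fourth power of the mean of [f] between [s] and [t], the majorant of the tangent-point kernel at
    [q = 4] when [f] dominates the second derivatives. *)
Definition quot4 (s t : R) : R := ((F t - F s) / (t - s)) ^+ 4.

Lemma quot4_ge0 s t : 0 <= quot4 s t.
Proof. by rewrite /quot4 exprn_even_ge0. Qed.

Lemma quot4C s t : quot4 s t = quot4 t s.
Proof. by rewrite /quot4 -(opprB t s) -(opprB (F t)) invrN mulrNN. Qed.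

Let fi a b := (square_integrable_itv mf (f2 a b)).1.
Let f2i a b := (square_integrable_itv mf (f2 a b)).2.

Lemma primitive_nd : {homo F : x y / x <= y}.
Proof. by move=> x y xy; rewrite -subr_ge0 FE// Rintegral_ge0. Qed.

Lemma measurable_primitive : measurable_fun setT F.
Proof. by apply: nondecreasing_measurable => // x y; exact: primitive_nd. Qed.

Lemma measurable_crit_ker d (T : measurableType d) (h z : T -> R) :
  measurable_fun setT h -> measurable_fun setT z ->
  measurable_fun setT (fun x => crit_ker (h x) (z x)).
Proof.
move=> mh mz; apply: measurable_funM; first exact: measurable_funX.
apply: measurable_fun_invr; apply: measurable_funX; apply: measurable_fun_sqrt.
by apply: measurable_funD => //; apply: measurable_funM => //; exact: measurable_funX.
Qed.

(** Integrating [young_crit] between [s] and [t] bounds the mean [M] by an integral of [crit_ker]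
    plus a multiple of [M] that can be absorbed; [N] bounds the square integral of [f] around
    [s]. *)
Lemma quot4_le (s t k N : R) : 0 < k -> t = s + k \/ t = s - k ->
  0 <= N -> (\int[mu]_(x in `[(s - k)%R, (s + k)%R]) (f x ^+ 2)%:E <= N%:E)%E ->
  ((quot4 s t)%:E <= (16 * (1 + N) ^+ 3 / k)%:E *
    \int[mu]_(u in `[(s - k)%R, (s + k)%R]) (crit_ker k (f u))%:E)%E.
Proof.
move=> k0 st N0 hN.
set U := `[(s - k)%R, (s + k)%R]%classic in hN *.
have mU : measurable (U : set (measurableTypeR R)) by exact: measurable_itvR.
have mk : measurable_fun setT (fun u => crit_ker k (f u)).
  by apply: measurable_crit_ker => //; exact: mf.
pose a := Order.min s t; pose b := Order.max s t.
have [ab bak aU] : [/\ a <= b, b - a = k & `[a, b] `<=` U].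
  rewrite /a /b /U; case: st => ->.
    rewrite min_l ?max_r ?lerDl ?(ltW k0)//; split; rewrite ?lerDl ?(ltW k0)//; first by ring.
    by apply: subset_itvr; rewrite bnd_simp gerBl ltW.
  rewrite min_r ?max_l ?gerBl ?(ltW k0)//; split; rewrite ?gerBl ?(ltW k0)//; first by ring.
  by apply: subset_itvl; rewrite bnd_simp lerDl ltW.
have -> : quot4 s t = ((F b - F a) / k) ^+ 4.
  rewrite -bak /a /b; case: st => tE.
    by rewrite min_l ?max_r ?tE ?lerDl ?(ltW k0).
  by rewrite min_r ?max_l ?tE ?gerBl ?(ltW k0)// quot4C.
have mab : measurable (`[a, b]%classic : set (measurableTypeR R)) by exact: measurable_itvR.
set M := (F b - F a) / k.
have M0 : 0 <= M by rewrite divr_ge0 ?(ltW k0)// subr_ge0; exact: primitive_nd.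
set I := (\int[mu]_(u in U) _)%E.
have I0 : (0 <= I)%E by apply: integral_ge0 => x _; rewrite lee_fin crit_ker_ge0.
have N1 : 0 < 1 + N by rewrite ltr_wpDr.
have C0 : 0 < 16 * (1 + N) ^+ 3 / k by rewrite divr_gt0// mulr_gt0// exprn_gt0.
move: M0; rewrite le_eqVlt => /predU1P[<-|M0].
  by rewrite expr0n/= mule_ge0// lee_fin ltW.
have [->|Ifin] := eqVneq I +oo%E.
  by rewrite gt0_muley ?lte_fin// leey.
have ki : mu.-integrable U (EFin \o (fun u => crit_ker k (f u))).
  apply/integrableP; split; first by apply: measurable_funTS; exact/measurable_EFinP.
  under eq_integral do rewrite /= ger0_norm ?crit_ker_ge0//.
  by rewrite ltey.
have kia : mu.-integrable `[a, b] (EFin \o (fun u => crit_ker k (f u))) by exact: integrableS ki.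
pose J := Rintegral mu U (fun u => crit_ker k (f u)).
have IJ : I = J%:E by rewrite /J /Rintegral fineK// integrable_fin_num.
rewrite IJ -EFinM lee_fin.
(* With this choice the second term of Young's inequality integrates to at most [k * M / 2], half of
   the left-hand side. *)
pose B := M / (2 * (1 + N)).
have B0 : 0 < B by rewrite divr_gt0// mulr_gt0.
have c1 : mu.-integrable `[a, b] (EFin \o (fun=> (1 : R))).
  exact: (@bounded_itv_integrable _ _ _ _ _ _ `|1|).
have i2 := integrable_rZ mab k (f2i a b).
have i12 := integrable_rD mab c1 i2.
have i3 := integrable_rZ mab B i12.
have i4 := integrable_rZ mab ((B ^+ 3)^-1) kia.
have Jab : Rintegral mu `[a, b] (fun u => crit_ker k (f u)) <= J.
  rewrite -lee_fin /J /Rintegral !fineK ?integrable_fin_num//.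
  apply: ge0_subset_integral => //; first by apply: measurable_funTS; exact/measurable_EFinP.
  by move=> x _; rewrite lee_fin crit_ker_ge0.
have Nab : Rintegral mu `[a, b] (fun x => f x ^+ 2) <= N.
  rewrite -lee_fin /Rintegral fineK ?integrable_fin_num//.
  apply: le_trans hN; apply: ge0_subset_integral => //.
    by apply: measurable_funTS; apply/measurable_EFinP; exact: measurable_funX.
  by move=> x _; rewrite lee_fin sqr_ge0.
have step : k * M <= J / B ^+ 3 + B * (k * (1 + N)).
  have -> : k * M = Rintegral mu `[a, b] f by rewrite -FE// /M mulrC divfK// gt_eqF.
  apply: (@le_trans _ _ (Rintegral mu `[a, b] (fun u =>
     (B ^+ 3)^-1 * crit_ker k (f u) + B * (1 + k * f u ^+ 2)))).
    apply: le_Rintegral => //; first exact: (integrable_rD mab i4 i3).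
    move=> u _; have := young_crit (ltW k0) (f0 u) B0.
    by rewrite [f u ^+ 2 * k]mulrC [_ / _]mulrC.
  rewrite RintegralD// RintegralZl// RintegralZl// RintegralD// RintegralZl//.
  rewrite Rintegral_itv_cst// bak mul1r; apply: lerD.
    by rewrite mulrC ler_wpM2r// invr_ge0 exprn_ge0// ltW.
  by rewrite ler_wpM2l ?(ltW B0)// mulrDr mulr1 lerD2l ler_wpM2l// ltW.
have e : B * (k * (1 + N)) = k * M / 2.
  by rewrite /B; field; rewrite gt_eqF.
rewrite e in step.
have step2 : k * M / 2 <= J / B ^+ 3 by lra.
have eB : J / B ^+ 3 = J * 8 * (1 + N) ^+ 3 / M ^+ 3.
  by rewrite /B; field; rewrite !gt_eqF.
rewrite eB ler_pdivlMr ?exprn_gt0// in step2.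
rewrite -(@ler_pM2l _ k)//.
have -> : k * (16 * (1 + N) ^+ 3 / k * J) = 2 * (J * 8 * (1 + N) ^+ 3).
  by field; rewrite gt_eqF.
have -> : k * M ^+ 4 = 2 * (k * M / 2 * M ^+ 3) by field.
by rewrite ler_pM2l.
Qed.

Lemma integral_window (u k c : R) : 0 <= k -> 0 <= c ->
  (\int[mu]_s (if `|u - s| <= k then c else 0)%:E = (2 * k * c)%:E)%E.
Proof.
move=> k0 c0.
have -> : (\int[mu]_s (if `|u - s| <= k then c else 0)%:E =
    \int[mu]_(s in `[(u - k)%R, (u + k)%R]) (c)%:E)%E.
  rewrite [RHS]integral_mkcond; apply: eq_integral => s _; rewrite patchE mem_setE in_itv/=.
  rewrite ler_distlC; have -> : (u - k <= s <= u + k) = (u - k <= s <= u + k) by [].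
  by case: ifP.
rewrite integral_cst//= lebesgue_measure_itv/= lte_fin.
have [k0'|] := ltP (u - k) (u + k); first by rewrite -EFinD -EFinM; congr EFin; ring.
move=> k0'; have -> : k = 0 by lra.
by rewrite mulr0 mul0r mule0.
Qed.

(** In the variables [s] and [h = t - s], integrating first in [s], the window of width [2 |h|]
    around [u] cancels the factor [1 / |h|] of [quot4_le]. What remains is [crit_ker |h| (f u)],
    whose integral in [h] is at most [4 f(u)^2]. No maximal function is involved. *)
Lemma quot4_integral_lty (a b : R) : a < b ->
  (\int[mu]_(s in `[a, b]) \int[mu]_(t in `[a, b]) (quot4 s t)%:E < +oo)%E.
Proof.
move=> ab; pose H := b - a; have H0 : 0 < H by rewrite subr_gt0.
pose U0 := `[a - H, b + H]%classic.
have mitv (x y : R) : measurable (`[x, y]%classic : set (measurableTypeR R)) by exact: measurable_itvR.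
have mU0 : measurable (U0 : set (measurableTypeR R)) by exact: measurable_itvR.
pose N := Rintegral mu U0 (fun x => f x ^+ 2).
have N0 : 0 <= N by apply: Rintegral_ge0 => x _; exact: sqr_ge0.
have NE : (\int[mu]_(x in U0) (f x ^+ 2)%:E = N%:E)%E.
  by rewrite /N /Rintegral fineK// integrable_fin_num//; exact: f2i.
pose C := 16 * (1 + N) ^+ 3.
have C0 : 0 <= C by rewrite mulr_ge0// exprn_ge0// addr_ge0.
have mF1 : measurable_fun [set: measurableTypeR R * measurableTypeR R] (fun z => F z.1).
  exact: (measurableT_comp measurable_primitive measurable_fst).
have mq4 : measurable_fun [set: measurableTypeR R * measurableTypeR R]
    (fun z => quot4 z.1 (z.1 + z.2)).
  apply: measurable_funX; apply: measurable_funM.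
    apply: measurable_funB => //.
    apply: (measurableT_comp measurable_primitive).
    by apply: measurable_funD; [exact: measurable_fst|exact: measurable_snd].
  apply: measurable_fun_invr; apply: measurable_funB; last exact: measurable_fst.
  by apply: measurable_funD; [exact: measurable_fst|exact: measurable_snd].
have mq4s s : measurable_fun setT (fun t => (quot4 s t)%:E).
  apply/measurable_EFinP; apply: measurable_funX; apply: measurable_funM.
    by apply: measurable_funB => //; exact: measurable_primitive.
  by apply: measurable_fun_invr; exact: measurable_funB.
have q40 x y : 0 <= quot4 x (x + y) by exact: quot4_ge0.
have mker : measurable_fun [set: measurableTypeR R * measurableTypeR R]
    (fun z => crit_ker `|z.1| (f z.2)).
  apply: measurable_crit_ker.
    by apply: measurable_fun_normr; exact: measurable_fst.
  exact: (measurableT_comp mf measurable_snd).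
have stepA : (\int[mu]_(s in `[a, b]) \int[mu]_(t in `[a, b]) (quot4 s t)%:E <=
   \int[mu]_(s in `[a, b]) \int[mu]_(h in `[(- H)%R, H]) (quot4 s (s + h)%R)%:E)%E.
  have mq4' : measurable_fun [set: measurableTypeR R * measurableTypeR R]
     (fun z => quot4 z.1 z.2).
    apply: measurable_funX; apply: measurable_funM.
      apply: measurable_funB => //.
      exact: (measurableT_comp measurable_primitive measurable_snd).
    by apply: measurable_fun_invr; apply: measurable_funB; [exact: measurable_snd|exact: measurable_fst].
  apply: ge0_le_integral => //.
  - by move=> s _; apply: integral_ge0 => t _; rewrite lee_fin quot4_ge0.
  - apply: measurable_funTS.
    by apply: (@measurable_inner _ quot4) => // x y; exact: quot4_ge0.
  - apply: measurable_funTS.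
    exact: (@measurable_inner _ (fun s h => quot4 s (s + h))).
  - move=> s /=; rewrite in_itv/= => /andP[as_ sb].
    rewrite (@integral_shift _ _ _ s)//; last by move=> t; rewrite lee_fin quot4_ge0.
    rewrite shift_preimage_itvcc; apply: ge0_subset_integral => //.
    + apply: measurable_funTS.
      by apply: (measurableT_comp (mq4s s)); exact: measurable_funD.
    + by move=> h _; rewrite lee_fin quot4_ge0.
    + by apply: subset_itv; rewrite bnd_simp /H; lra.
apply: (le_lt_trans stepA).
rewrite (@tonelli_sets _ (fun s h => quot4 s (s + h)))//.
have stepD (h : R) : `|h| <= H ->
    (\int[mu]_(s in `[a, b]) (quot4 s (s + h)%R)%:E <=
     (2 * C)%:E * \int[mu]_(u in U0) (crit_ker `|h| (f u))%:E)%E.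
  move=> hH.
  (* On the diagonal the quotient is 0 by the convention on division by 0. *)
  have [->|hn0] := eqVneq h 0.
    rewrite integral0_eq; last first.
      by move=> s _; rewrite /quot4 addr0 !subrr mul0r expr0n.
    apply: mule_ge0; first by rewrite lee_fin mulr_ge0.
    by apply: integral_ge0 => u _; rewrite lee_fin crit_ker_ge0.
  have h0 : 0 < `|h| by rewrite normr_gt0.
  pose psi (s u : R) := if `|u - s| <= `|h| then crit_ker `|h| (f u) else 0.
  have psi0 s u : 0 <= psi s u by rewrite /psi; case: ifP => // _; exact: crit_ker_ge0.
  have mpsi : measurable_fun [set: measurableTypeR R * measurableTypeR R]
      (fun z => psi z.1 z.2).
    apply: measurable_fun_ifT => //.
      apply: measurable_fun_ler => //; apply: measurable_fun_normr.
      by apply: measurable_funB; [exact: measurable_snd|exact: measurable_fst].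
    apply: measurable_crit_ker => //; exact: (measurableT_comp mf measurable_snd).
  have Ch0 : 0 <= C / `|h| by rewrite divr_ge0.
  apply: (@le_trans _ _ (\int[mu]_(s in `[a, b]) ((C / `|h|)%:E *
      \int[mu]_(u in U0) (psi s u)%:E))%E).
    apply: ge0_le_integral => //.
    - by move=> s _; rewrite lee_fin quot4_ge0.
    - apply: measurable_funTS; apply/measurable_EFinP.
      apply: measurable_funX; apply: measurable_funM.
        apply: measurable_funB; last exact: measurable_primitive.
        by apply: (measurableT_comp measurable_primitive); exact: measurable_funD.
      apply: measurable_fun_invr; apply: measurable_funB => //; exact: measurable_funD.
    - apply: measurable_funTS; apply: measurable_funeM.
      exact: (measurable_inner mpsi psi0 mU0).
    - move=> s /=; rewrite in_itv/= => /andP[as_ sb].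
      have sub : `[s - `|h|, s + `|h|]%classic `<=` U0.
        by apply: subset_itv; rewrite bnd_simp; lra.
      have st : s + h = s + `|h| \/ s + h = s - `|h|.
        have [h1|h1] := leP 0 h; first by left; rewrite ger0_norm.
        by right; rewrite ltr0_norm// opprK.
      apply: le_trans (quot4_le h0 st N0 _) _.
        rewrite -NE; apply: ge0_subset_integral => //.
          by apply: measurable_funTS; apply/measurable_EFinP; exact: measurable_funX.
        by move=> x _; rewrite lee_fin sqr_ge0.
      rewrite -/C lee_pmul2l ?lte_fin ?divr_gt0 ?mulr_gt0 ?exprn_gt0 ?ltr_wpDr//.
      rewrite integral_mkcond [leRHS]integral_mkcond.
      apply: ge0_le_integral => //.
      - by move=> u _; rewrite patchE; case: ifPn => // _; rewrite lee_fin crit_ker_ge0.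
      - apply/(measurable_restrictT _ _).1 => //; apply: measurable_funTS.
        by apply/measurable_EFinP; apply: measurable_crit_ker => //; exact: mf.
      - apply/(measurable_restrictT _ _).1 => //; apply: measurable_funTS.
        apply/measurable_EFinP; apply: measurable_fun_ifT => //.
          by apply: measurable_fun_ler => //; apply: measurable_fun_normr; exact: measurable_funB.
        by apply: measurable_crit_ker => //; exact: mf.
      - move=> u _; rewrite !patchE; case: ifPn => [/set_mem us|_]; last first.
          by case: ifPn => // _; rewrite lee_fin.
        rewrite mem_set; last exact: sub.
        rewrite lee_fin /psi; move: us; rewrite /= in_itv/= => us.
        by rewrite ler_distl us.
  rewrite ge0_integralZl_EFin//; last 2 first.
  - by move=> s _; apply: integral_ge0 => u _; rewrite lee_fin.
  - by apply: measurable_funTS; exact: (measurable_inner mpsi psi0 mU0).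
  apply: (@le_trans _ _ ((C / `|h|)%:E * \int[mu]_s \int[mu]_(u in U0) (psi s u)%:E)%E).
    apply: lee_wpmul2l; [by rewrite lee_fin|apply: ge0_subset_integral => //].
    - exact: (measurable_inner mpsi psi0 mU0).
    - by move=> s _; apply: integral_ge0 => u _; rewrite lee_fin.
  rewrite tonelli_sets//.
  have -> : (\int[mu]_(u in U0) \int[mu]_s (psi s u)%:E =
     (2 * `|h|)%:E * \int[mu]_(u in U0) (crit_ker `|h| (f u))%:E)%E.
    rewrite -ge0_integralZl_EFin ?mulr_ge0//.
    - apply: eq_integral => u _; rewrite integral_window ?crit_ker_ge0//.
    - by move=> u _; rewrite lee_fin crit_ker_ge0.
    - by apply: measurable_funTS; apply/measurable_EFinP; apply: measurable_crit_ker => //; exact: mf.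
  rewrite muleA -EFinM.
  by have -> : C / `|h| * (2 * `|h|) = 2 * C by field; rewrite gt_eqF.
have mkerh : measurable_fun setT (fun h : measurableTypeR R =>
   \int[mu]_(u in U0) (crit_ker `|h| (f u))%:E)%E.
  by apply: (@measurable_inner _ (fun h u => crit_ker `|h| (f u))) => // *; exact: crit_ker_ge0.
apply: (@le_lt_trans _ _ (\int[mu]_(h in `[(- H)%R, H]) ((2 * C)%:E *
    \int[mu]_(u in U0) (crit_ker `|h| (f u))%:E))%E).
  apply: ge0_le_integral => //.
  - by move=> h _; apply: integral_ge0 => s _; rewrite lee_fin.
  - apply: measurable_funTS; apply: (@measurable_inner _ (fun h s => quot4 s (s + h))) => //.
    apply: measurable_funX; apply: measurable_funM.
      apply: measurable_funB; last exact: (measurableT_comp measurable_primitive measurable_snd).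
      apply: (measurableT_comp measurable_primitive).
      by apply: measurable_funD; [exact: measurable_snd|exact: measurable_fst].
    apply: measurable_fun_invr; apply: measurable_funB; last exact: measurable_snd.
    by apply: measurable_funD; [exact: measurable_snd|exact: measurable_fst].
  - by apply: measurable_funTS; exact: measurable_funeM.
  - by move=> h /=; rewrite in_itv/= -ler_norml; exact: stepD.
have C20 : 0 <= 2 * C by rewrite mulr_ge0.
rewrite ge0_integralZl_EFin//; last 2 first.
- by move=> h _; apply: integral_ge0 => u _; rewrite lee_fin crit_ker_ge0.
- exact: measurable_funTS.
apply: lte_mul_pinfty => //.
rewrite (@tonelli_sets _ (fun h u => crit_ker `|h| (f u)))//; last first.
  by move=> *; exact: crit_ker_ge0.
have mh (z : R) : measurable_fun [set: measurableTypeR R] (fun h : R => (crit_ker `|h| z)%:E).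
  by apply/measurable_EFinP; apply: measurable_crit_ker => //; exact: measurable_fun_normr.
apply: (@le_lt_trans _ _ (\int[mu]_(u in U0) (4%:E * (f u ^+ 2)%:E))%E).
  apply: ge0_le_integral => //.
  - by move=> u _; apply: integral_ge0 => h _; rewrite lee_fin crit_ker_ge0.
  - apply: measurable_funTS; apply: (@measurable_inner _ (fun u h => crit_ker `|h| (f u))) => //.
      apply: measurable_crit_ker; last exact: (measurableT_comp mf measurable_fst).
      by apply: measurable_fun_normr; exact: measurable_snd.
    by move=> *; exact: crit_ker_ge0.
  - apply: measurable_funTS; apply: measurable_funeM; apply/measurable_EFinP; exact: measurable_funX.
  - move=> u _.
    have nn (h : R) : (0 <= (crit_ker `|h| (f u))%:E)%E by rewrite lee_fin crit_ker_ge0.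
    have nH : - H <= 0 by rewrite oppr_le0 ltW.
    rewrite (ge0_integral_itv_cat nH (ltW H0) (mh (f u)) nn).
    rewrite (cov_opp (measurable_itv `[- H, 0]) (mh (f u)) nn).
    have -> : -%R @^-1` `[- H, 0]%classic = `[0, H]%classic :> set R.
      by apply/seteqP; split => x /=; rewrite !in_itv/= lerN2 oppr_le0 andbC.
    have half : (\int[mu]_(h in `[0%R, H]) (crit_ker `|h| (f u))%:E <= (2 * f u ^+ 2)%:E)%E.
      rewrite (_ : (\int[mu]_(h in _) _)%E = (\int[mu]_(h in `[0%R, H]) (crit_ker h (f u))%:E)%E).
        exact: crit_ker_integral.
      by apply: eq_integral => h /set_mem/=; rewrite in_itv/= => /andP[h0 _]; rewrite ger0_norm.
    under eq_integral do rewrite normrN.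
    apply: (le_trans (leeD half half)); rewrite -EFinD -EFinM lee_fin; lra.
rewrite ge0_integralZl_EFin//.
- by rewrite NE -EFinM ltry.
- by move=> x _; rewrite lee_fin sqr_ge0.
- by apply: measurable_funTS; apply/measurable_EFinP; exact: measurable_funX.
Qed.

End difference_quotients.

(** * Calculus of W^{2,2} curves *)

Section W22_calculus.
Context {R : realType}.
Local Notation mu := (@lebesgue_measure R).
Implicit Types g h : R -> 'rV[R]_3.

Lemma deriv1D g h (t : R) : derivable g t 1 -> derivable h t 1 ->
  derivable (fun t => g t + h t) t 1 /\
  deriv1 (fun t => g t + h t) t = deriv1 g t + deriv1 h t.
Proof.
move=> dg dh; apply: deriv1_coordP => i; rewrite mxE.
have -> : (fun x => (g x + h x) 0 i) = (fun x => g x 0 i) + (fun x => h x 0 i).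
  by apply/funext => x; rewrite mxE.
exact: (is_deriveD (is_derive_coord i dg) (is_derive_coord i dh)).
Qed.

Lemma deriv1Z g (c t : R) : derivable g t 1 ->
  derivable (fun t => c *: g t) t 1 /\ deriv1 (fun t => c *: g t) t = c *: deriv1 g t.
Proof.
move=> dg; apply: deriv1_coordP => i; rewrite mxE.
have -> : (fun x => (c *: g x) 0 i) = c *: (fun x => g x 0 i).
  by apply/funext => x; rewrite mxE.
exact: (is_deriveZ c (is_derive_coord i dg)).
Qed.

Lemma W22D g h : W22 g -> W22 h -> W22 (fun t => g t + h t).
Proof.
move=> wg wh; have dg := wg.2.1; have dh := wh.2.1.
apply: W22I.
- by move=> t; rewrite wg.1 wh.1.
- by move=> t; have [] := deriv1D (dg t) (dh t).
- move=> i; have -> : (fun t => deriv1 (fun t => g t + h t) t 0 i) =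
     (fun t => deriv1 g t 0 i + deriv1 h t 0 i).
    by apply/funext => t; rewrite (deriv1D (dg t) (dh t)).2 mxE.
  by apply: H1_add; exact: W22_H1.
Qed.

Lemma W22Z g (c : R) : W22 g -> W22 (fun t => c *: g t).
Proof.
move=> wg; have dg := wg.2.1.
apply: W22I.
- by move=> t; rewrite wg.1.
- by move=> t; have [] := deriv1Z c (dg t).
- move=> i; have -> : (fun t => deriv1 (fun t => c *: g t) t 0 i) =
     (fun t => c * deriv1 g t 0 i).
    by apply/funext => t; rewrite (deriv1Z c (dg t)).2 mxE.
  by apply: H1_scale; exact: W22_H1.
Qed.

Lemma periodic_red (T : Type) (f : R -> T) (t : R) : (forall t, f (t + 1) = f t) ->
  f t = f (t - (Num.floor t)%:~R).
Proof.
move=> pf.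
have up x (n : nat) : f (x + n%:R) = f x.
  by elim: n => [|n ih]; rewrite ?addr0// -natr1 addrA pf.
case: (Num.floor t) => n; first by rewrite -[in LHS](subrK n%:R t) up.
by rewrite NegzE mulrNz opprK -(up t n.+1).
Qed.

Lemma frac_itv (t : R) : 0 <= t - (Num.floor t)%:~R < 1.
Proof.
have := floorD1_gt t; rewrite intrD1 => h.
by rewrite subr_ge0 floor_le/= ltrBlDl.
Qed.

Lemma W22_continuous g i : W22 g -> continuous (fun t => deriv1 g t 0 i).
Proof. by move=> wg; apply: H1_continuous; exact: W22_H1. Qed.

Lemma W22_deriv_bounded g : W22 g -> exists2 L, 0 < L &
  forall t, enorm (deriv1 g t) <= L.
Proof.
move=> wg.
have b i : exists2 K, 0 <= K & forall t, `|deriv1 g t 0 i| <= K.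
  have [P [ndP hP]] := W22_H1 i wg.
  have D0 : 0 <= P 1 - P 0 by rewrite subr_ge0 ndP.
  exists (`|deriv1 g 0 0 i| + (1 + (P 1 - P 0))); first by rewrite addr_ge0// addr_ge0.
  move=> t; rewrite (@periodic_red _ (deriv1 g) t (deriv1_periodic wg.1)).
  have /andP[u0 u1] := frac_itv t; move: (t - _) u0 u1 => u u0 u1.
  have := hP 0 u u0; rewrite subr0 => h.
  have h2 : (deriv1 g u 0 i - deriv1 g 0 0 i) ^+ 2 <= P 1 - P 0.
    apply: le_trans h _; have := ndP u 1 (ltW u1); have := ndP 0 u u0 => h1 h2.
    by apply: (@le_trans _ _ (1 * (P u - P 0))); [rewrite ler_wpM2r ?subr_ge0// ltW|lra].
  have h3 : `|deriv1 g u 0 i - deriv1 g 0 0 i| <= 1 + (P 1 - P 0).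
    move: h2; rewrite -(real_normK (num_real (_ - _))); move: (`|_|) (normr_ge0 (deriv1 g u 0 i - deriv1 g 0 0 i)) => z z0 h2.
    by have := sqr_ge0 (z - 1); rewrite sqrrB; nra.
  rewrite -[deriv1 g u 0 i](subrK (deriv1 g 0 0 i)) addrC.
  by rewrite (le_trans (ler_normD _ _))// lerD2l.
have [K0 p0 h0] := b 0; have [K1 p1 h1] := b 1; have [K2 p2 h2] := b 2%:R.
exists (K0 + K1 + K2 + 1); first lra.
move=> t; apply: (le_trans (enorm_le_sum _)); rewrite sum3.
have := h0 t; have := h1 t; have := h2 t; lra.
Qed.

Lemma MVT_signed (f df : R -> R) (s t : R) :
  (forall x : R, is_derive x 1 f (df x)) -> exists2 xi,
    (s <= xi <= t) || (t <= xi <= s) & f t - f s = df xi * (t - s).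
Proof.
move=> hd; have cf := is_derive_continuous hd.
have [st|ts|->] := ltgtP s t.
- have [xi + E] := MVT st (fun x _ => hd x) (continuous_subspaceT cf).
  by rewrite in_itv/= => /andP[/ltW a /ltW b]; exists xi => //; rewrite a b.
- have [xi + E] := MVT ts (fun x _ => hd x) (continuous_subspaceT cf).
  rewrite in_itv/= => /andP[/ltW a /ltW b]; exists xi; first by rewrite a b orbT.
  by rewrite -opprB E -mulrN opprB.
- by exists t; rewrite ?lexx// !subrr mulr0.
Qed.

(** The factor 3 comes from applying the mean value theorem to each coordinate separately. *)
Lemma curve_lipschitz g (L : R) : (forall t, derivable g t 1) ->
  (forall t, enorm (deriv1 g t) <= L) ->
  forall s t, enorm (g t - g s) <= 3 * L * `|t - s|.
Proof.
move=> dg hL s t; apply: (le_trans (enorm_le_sum _)).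
have h i : `|(g t - g s) 0 i| <= L * `|t - s|.
  have [xi _ E] := MVT_signed s t (fun x => is_derive_coord i (dg x)).
  rewrite !mxE E normrM ler_wpM2r// (le_trans (enorm_coord _ _))//.
rewrite sum3; have := h 0; have := h 1; have := h 2%:R; lra.
Qed.

(** In each coordinate the remainder is [d] times the change of the tangent up to an intermediate
    point, which the increment of [F] bounds. The product of [d] and that increment is nonnegative
    for either sign of [d], so one formula serves both sides. *)
Lemma taylor_remainder g (G : 'I_3 -> R -> R) (f F : R -> R) :
  (forall t, derivable g t 1) ->
  (forall i, measurable_fun setT (G i)) ->
  (forall i s t, s <= t -> deriv1 g t 0 i - deriv1 g s 0 i = Rintegral mu `[s, t] (G i)) ->
  (forall i x, `|G i x| <= f x) -> (forall x, 0 <= f x) ->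
  (forall a b, mu.-integrable `[a, b] (EFin \o f)) ->
  (forall s t, s <= t -> F t - F s = Rintegral mu `[s, t] f) ->
  forall s d, enorm (g (s + d) - g s - d *: deriv1 g s) <= 3 * (d * (F (s + d) - F s)).
Proof.
move=> dg mG FTC Gf f0 fi FE s d.
have ndF : {homo F : x y / x <= y}.
  by move=> x y xy; rewrite -subr_ge0 FE// Rintegral_ge0.
have osc i x y : x <= y -> `|deriv1 g y 0 i - deriv1 g x 0 i| <= F y - F x.
  move=> xy; have mI := measurable_itvR `[x, y].
  have Gi : mu.-integrable `[x, y] (EFin \o G i).
    apply: (@le_integrable_r _ _ _ mu _ mI (G i) f); [|by move=> z _; exact: Gf|exact: fi].
    by apply: measurable_funTS; exact: mG.
  rewrite FTC// FE//; apply: le_trans (le_normr_Rintegral _ Gi) _ => //.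
  apply: le_Rintegral => //; exact: (integrable_norm Gi).
have h i : `|(g (s + d) - g s - d *: deriv1 g s) 0 i| <= d * (F (s + d) - F s).
  have [xi hxi E] := MVT_signed s (s + d) (fun x => is_derive_coord i (dg x)).
  rewrite !mxE E [s + d - s]addrAC subrr add0r mulrC -mulrBr normrM.
  case/orP: hxi => /andP[a b].
    have d0 : 0 <= d by rewrite -(lerDl s) (le_trans a).
    rewrite ger0_norm// ler_wpM2l// (le_trans (osc i _ _ a))// lerB//.
    exact: ndF.
  have d0 : d <= 0 by rewrite -(gerDl s) (le_trans a).
  rewrite ler0_norm// -[leRHS]mulrNN opprB ler_wpM2l ?oppr_ge0//.
  by rewrite distrC (le_trans (osc i _ _ b))// lerB// ndF.
apply: (le_trans (enorm_le_sum _)).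
by rewrite sum3; have := h 0; have := h 1; have := h 2%:R; lra.
Qed.

Lemma is_derive_dot_sqr (u u' : 'rV[R]_3) (e : R) :
  is_derive e 1 (fun e : R => dot (u + e *: u') (u + e *: u')) (2 * dot (u + e *: u') u').
Proof.
have -> : (fun e : R => dot (u + e *: u') (u + e *: u')) =
  (fun e : R => dot u u + (2 * dot u u') * e + dot u' u' * (e * e)).
  by apply/funext => x; rewrite !dotLE (dotC u' u); ring.
by apply: is_derive_eq; rewrite /GRing.scale/= !dotLE; ring.
Qed.

End W22_calculus.

(** * The tangent-point kernel *)

Section kernels.
Context {R : realType}.
Local Notation mu := (@lebesgue_measure R).
Implicit Types (g h : R -> 'rV[R]_3) (u v : 'rV[R]_3).

Definition TPk (q : R) g (s t : R) : R :=
  powR (inv_rtp (g s) (g t) (deriv1 g s)) q * enorm (deriv1 g s) * enorm (deriv1 g t).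

(** The case [x == y] is absorbed by division by 0 being 0. *)
Lemma inv_rtpE (x y tau : 'rV[R]_3) : inv_rtp x y tau =
  2 * Num.sqrt (cross_norm2 tau (y - x)) / (enorm tau * dot (y - x) (y - x)).
Proof.
rewrite /inv_rtp; case: eqP => // ->; rewrite subrr.
have -> : dot (0 : 'rV[R]_3) 0 = 0 by rewrite dotE !mxE !mulr0 !addr0.
by rewrite mulr0 invr0 mulr0.
Qed.

Lemma TPk_ge0 q g s t : 0 <= TPk q g s t.
Proof. by rewrite !mulr_ge0 ?powR_ge0 ?enorm_ge0. Qed.

Lemma measurable_dot d (T : measurableType d) (D : set T) (u v : T -> 'rV[R]_3) :
  (forall i, measurable_fun D (fun x => u x 0 i)) ->
  (forall i, measurable_fun D (fun x => v x 0 i)) ->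
  measurable_fun D (fun x => dot (u x) (v x)).
Proof.
move=> mu mv; under eq_fun do rewrite dotE.
by apply: measurable_funD; [apply: measurable_funD|]; apply: measurable_funM.
Qed.

Lemma measurable_cross d (T : measurableType d) (D : set T) (u v : T -> 'rV[R]_3) :
  (forall i, measurable_fun D (fun x => u x 0 i)) ->
  (forall i, measurable_fun D (fun x => v x 0 i)) ->
  measurable_fun D (fun x => cross_norm2 (u x) (v x)).
Proof.
move=> mu mv; apply: measurable_funB.
  by apply: measurable_funM; exact: measurable_dot.
by apply: measurable_funX; exact: measurable_dot.
Qed.

Lemma measurable_enorm d (T : measurableType d) (D : set T) (u : T -> 'rV[R]_3) :
  (forall i, measurable_fun D (fun x => u x 0 i)) ->
  measurable_fun D (fun x => enorm (u x)).
Proof. by move=> mu; apply: measurable_fun_sqrt; exact: measurable_dot. Qed.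

Lemma curve_measurable g i : (forall t, derivable g t 1) ->
  measurable_fun [set: measurableTypeR R] (fun t => g t 0 i).
Proof.
move=> dg; apply: continuous_measurable_fun.
exact: (is_derive_continuous (fun t => is_derive_coord i (dg t))).
Qed.

Lemma deriv_measurable g i : W22 g ->
  measurable_fun [set: measurableTypeR R] (fun t => deriv1 g t 0 i).
Proof. by move=> wg; apply: continuous_measurable_fun; exact: W22_continuous. Qed.

Lemma measurable_tp_kernel d (T : measurableType d) (D : set T)
    (x y tau sg : T -> 'rV[R]_3) q :
  (forall i, measurable_fun D (fun z => x z 0 i)) ->
  (forall i, measurable_fun D (fun z => y z 0 i)) ->
  (forall i, measurable_fun D (fun z => tau z 0 i)) ->
  (forall i, measurable_fun D (fun z => sg z 0 i)) ->
  measurable_fun D (fun z => powR (inv_rtp (x z) (y z) (tau z)) q *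
    enorm (tau z) * enorm (sg z)).
Proof.
move=> m1 m2 d1 d2.
have mD i : measurable_fun D (fun z => (y z - x z) 0 i).
  by under eq_fun do rewrite !mxE; exact: measurable_funB.
apply: measurable_funM; last exact: measurable_enorm.
apply: measurable_funM; last exact: measurable_enorm.
apply: measurable_fun_powR; under eq_fun do rewrite inv_rtpE.
apply: measurable_funM.
  by apply: measurable_funM => //; apply: measurable_fun_sqrt; exact: measurable_cross.
apply: measurable_fun_invr; apply: measurable_funM; first exact: measurable_enorm.
exact: measurable_dot.
Qed.

Lemma measurable_TPk q g : W22 g ->
  measurable_fun [set: measurableTypeR R * measurableTypeR R]
    (fun z => TPk q g z.1 z.2).
Proof.
move=> wg; apply: measurable_tp_kernel => i.
- exact: (measurableT_comp (curve_measurable i wg.2.1) measurable_fst).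
- exact: (measurableT_comp (curve_measurable i wg.2.1) measurable_snd).
- exact: (measurableT_comp (deriv_measurable i wg) measurable_fst).
- exact: (measurableT_comp (deriv_measurable i wg) measurable_snd).
Qed.

Lemma TP_prod q g : W22 g ->
  TP q g = Rintegral (mu \x mu)%E (`[0, 1] `*` `[0, 1])%classic (fun z => TPk q g z.1 z.2).
Proof.
move=> wg; rewrite /TP /Rintegral; congr fine.
by apply: (@tonelli_sets_prod _ (TPk q g)); [exact: measurable_TPk|exact: TPk_ge0|exact: measurable_itvR|exact: measurable_itvR].
Qed.

(** The length of [tau] occurs with power [- q] from the radius and once from the line element,
    hence the exponent [(1 - q) / 2] on its square. *)
Lemma tp_kernel_prodpow q (x y tau sg : 'rV[R]_3) : 0 < q ->
  0 < enorm tau -> 0 < enorm sg -> 0 < dot (y - x) (y - x) ->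
  powR (inv_rtp x y tau) q * enorm tau * enorm sg =
  powR 2 q * prodpow ((1 - q) / 2) (- q) (2^-1)
    (powR (cross_norm2 tau (y - x)) (q / 2))
    (dot tau tau) (dot (y - x) (y - x)) (dot sg sg).
Proof.
move=> q0 us ut b0; rewrite inv_rtpE.
set N := cross_norm2 _ _; set b := dot (y - x) _ in b0 *.
set a := dot tau _; set c := dot sg _.
have N0 : 0 <= N by exact: cross_norm2_ge0.
have a0 : 0 < a by rewrite /a -enorm_dot exprn_gt0.
have c0 : 0 < c by rewrite /c -enorm_dot exprn_gt0.
have -> : enorm tau = powR a 2^-1 by rewrite powR12_sqrt// ltW.
have -> : enorm sg = powR c 2^-1 by rewrite powR12_sqrt// ltW.
rewrite -(powR12_sqrt N0).
have -> : (powR a 2^-1 * b)^-1 = powR (powR a 2^-1 * b) (- 1).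
  by rewrite powR_inv1// mulr_ge0 ?powR_ge0// ltW.
have -> : powR (2 * powR N 2^-1 * powR (powR a 2^-1 * b) (- 1)) q =
    powR 2 q * powR N (q / 2) * (powR a (- (q / 2)) * powR b (- q)).
  rewrite [LHS]powRM ?mulr_ge0 ?powR_ge0//; congr (_ * _).
    by rewrite [LHS]powRM ?powR_ge0// -powRrM [2^-1 * q]mulrC.
  rewrite -powRrM mulN1r [LHS]powRM ?powR_ge0 ?(ltW b0)// -powRrM.
  by rewrite mulrN [2^-1 * q]mulrC.
rewrite /prodpow.
have -> : powR a ((1 - q) / 2) = powR a (- (q / 2)) * powR a 2^-1.
  rewrite -powRD; last by rewrite (gt_eqF a0) implybT.
  by congr powR; field.
by ring.
Qed.

(** Derivative of [cross_norm2] at [(u, v)] in the direction [(u', v')]. *)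
Definition dcross u v u' v' : R :=
  2 * dot u u' * dot v v + 2 * dot u u * dot v v' - 2 * dot u v * (dot u' v + dot u v').

Lemma dcross_shear u r u' r' (d : R) :
  dcross u (r + d *: u) u' (r' + d *: u') = dcross u r u' r'.
Proof. by rewrite /dcross !dotE !mxE; ring. Qed.

Lemma is_derive_cross u v u' v' (e : R) :
  is_derive e 1 (fun e : R => cross_norm2 (u + e *: u') (v + e *: v'))
    (dcross (u + e *: u') (v + e *: v') u' v').
Proof.
pose p x := dot u u + (2 * dot u u') * x + dot u' u' * (x * x).
pose r x := dot v v + (2 * dot v v') * x + dot v' v' * (x * x).
pose s x := dot u v + (dot u v' + dot u' v) * x + dot u' v' * (x * x).
have -> : (fun e : R => cross_norm2 (u + e *: u') (v + e *: v')) =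
    (fun x : R => p x * r x - s x * s x).
  by apply/funext => x; rewrite /cross_norm2 !dotLE (dotC u' u) (dotC v' v) /p /r /s; ring.
rewrite /p /r /s; apply: is_derive_eq; rewrite /GRing.scale/= /dcross !dotLE.
by rewrite (dotC u' u) (dotC v' v); ring.
Qed.

Lemma dcross_bound u v u' v' (L r : R) : enorm u <= L -> enorm u' <= L ->
  enorm v <= r -> enorm v' <= r ->
  0 <= cross_norm2 u v <= 8 * L ^+ 2 * r ^+ 2 /\ `|dcross u v u' v'| <= 8 * L ^+ 2 * r ^+ 2.
Proof.
move=> uL uL' vr vr'.
have [u0 u0' v0 v0'] := And4 (enorm_ge0 u) (enorm_ge0 u') (enorm_ge0 v) (enorm_ge0 v').
have L0 : 0 <= L by exact: le_trans uL. have r0 : 0 <= r by exact: le_trans vr.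
have duu : `|dot u u'| <= L ^+ 2.
  by apply: (le_trans (cauchy_dot _ _)); rewrite expr2 ler_pM.
have dvv : `|dot v v'| <= r ^+ 2.
  by apply: (le_trans (cauchy_dot _ _)); rewrite expr2 ler_pM.
have duv : `|dot u v| <= L * r by apply: (le_trans (cauchy_dot _ _)); rewrite ler_pM.
have du'v : `|dot u' v| <= L * r by apply: (le_trans (cauchy_dot _ _)); rewrite ler_pM.
have duv' : `|dot u v'| <= L * r by apply: (le_trans (cauchy_dot _ _)); rewrite ler_pM.
have du2 : dot u u <= L ^+ 2 by rewrite -enorm_dot ler_sqr.
have dv2 : dot v v <= r ^+ 2 by rewrite -enorm_dot ler_sqr.
have LL : 0 <= L ^+ 2 by exact: sqr_ge0. have rr : 0 <= r ^+ 2 by exact: sqr_ge0.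
split.
  rewrite cross_norm2_ge0 (le_trans (cross_norm2_le _ _))//.
  apply: (@le_trans _ _ (L ^+ 2 * r ^+ 2)); first by rewrite ler_pM ?dot_ge0.
  by rewrite -mulrA ler_peMl ?mulr_ge0// ler1n.
have t1 : `|2 * dot u u' * dot v v| <= 2 * (L ^+ 2 * r ^+ 2).
  rewrite -mulrA normrM ger0_norm// ler_wpM2l// normrM ler_pM// ger0_norm//; exact: dot_ge0.
have t2 : `|2 * dot u u * dot v v'| <= 2 * (L ^+ 2 * r ^+ 2).
  rewrite -mulrA normrM ger0_norm// ler_wpM2l// normrM ler_pM// ger0_norm//; exact: dot_ge0.
have t3 : `|2 * dot u v * (dot u' v + dot u v')| <= 4 * (L ^+ 2 * r ^+ 2).
  have -> : 4 * (L ^+ 2 * r ^+ 2) = 2 * (L * r) * (2 * (L * r)) by ring.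
  rewrite normrM ler_pM//; first by rewrite normrM ger0_norm// ler_wpM2l.
  by rewrite (le_trans (ler_normD _ _))//; lra.
have := ler_normD (2 * dot u u' * dot v v) (2 * dot u u * dot v v').
have := ler_normB (2 * dot u u' * dot v v + 2 * dot u u * dot v v') (2 * dot u v * (dot u' v + dot u v')).
rewrite /dcross; lra.
Qed.

Lemma enorm_rev u v : enorm u - enorm v <= enorm (u + v).
Proof.
rewrite lerBlDr -{1}(addrK v u); apply: le_trans (enormD _ _) _.
by rewrite enormN.
Qed.

Lemma dprodpow_add (al be ga n a b c dn da db dc dn' da' db' dc' : R) :
  dprodpow al be ga n a b c (dn + dn') (da + da') (db + db') (dc + dc') =
  dprodpow al be ga n a b c dn da db dc + dprodpow al be ga n a b c dn' da' db' dc'.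
Proof. by rewrite /dprodpow; ring. Qed.

Lemma powR_cancel (l p : R) : 0 < l -> powR l p * powR l (- p) = 1.
Proof. by move=> l0; rewrite powRN mulfV// gt_eqF// powR_gt0. Qed.

(** Homogeneity: the factor [powR l q] of the numerator cancels against the power [- q] of [l * b],
    in the value and in the derivative alike. With [l] the squared parameter distance this removes
    the singularity on the diagonal. *)
Lemma prodpow_scale (al q ga n a b c dn da db dc l : R) : 0 < l -> 0 <= b ->
  prodpow al (- q) ga (powR l q * n) a (l * b) c = prodpow al (- q) ga n a b c /\
  dprodpow al (- q) ga (powR l q * n) a (l * b) c (powR l q * dn) da (l * db) dc =
  dprodpow al (- q) ga n a b c dn da db dc.
Proof.
move=> l0 b0; have c1 := powR_cancel q l0.
have e1 : powR (l * b) (- q) = powR l (- q) * powR b (- q) by rewrite powRM// ltW.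
have e2 : l * powR (l * b) (- q - 1) = powR l (- q) * powR b (- q - 1).
  rewrite (powRM _ (ltW l0) b0) mulrA; congr (_ * _).
  have ln0 : l != 0 by rewrite gt_eqF.
  rewrite powRD; last by rewrite ln0 implybT.
  by rewrite (powR_inv1 (ltW l0)) mulrCA mulfV// mulr1.
split; rewrite ?/prodpow ?/dprodpow e1.
  by rewrite -[X in _ = X]mul1r -c1; ring.
have -> : l * db * (powR l q * n * - q * powR (l * b) (- q - 1) * powR a al * powR c ga) =
   db * (powR l q * n * - q * (l * powR (l * b) (- q - 1)) * powR a al * powR c ga) by ring.
rewrite e2; set X := powR l q in c1 *; set Y := powR l (- q) in c1 *.
transitivity ((X * Y) * dprodpow al (- q) ga n a b c dn da db dc).
  by rewrite /dprodpow; ring.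
by rewrite c1 mul1r.
Qed.

(* [l] is the squared parameter distance, [nu] the normalised squared area. *)
Lemma powR_area_scale (q nu dnu l : R) : 0 < l -> 0 <= nu ->
  powR (l ^+ 2 * nu) (q / 2) = powR l q * powR nu (q / 2) /\
  q / 2 * powR (l ^+ 2 * nu) (q / 2 - 1) * (l ^+ 2 * dnu) =
    powR l q * (q / 2 * powR nu (q / 2 - 1) * dnu).
Proof.
move=> l0 nu0.
have e p : powR (l ^+ 2) p = powR l (2 * p).
  by rewrite powRrM (powR_mulrn 2 (ltW l0)).
split; rewrite powRM ?sqr_ge0// e.
  by rewrite mulrCA mulfV// mulr1.
have -> : powR l q = powR l (2 * (q / 2 - 1)) * l ^+ 2.
  rewrite -(powR_mulrn 2 (ltW l0)) -powRD; last by rewrite (gt_eqF l0) implybT.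
  by congr powR; field.
by ring.
Qed.

End kernels.

(** * Pointwise bounds on the kernel and its variation *)

Section tp_pointwise.
Context {R : realType}.
Implicit Types (u v w D : 'rV[R]_3).

(** The kernel as a function of tangent, chord and second tangent, taken as independent vectors so
    that it can be differentiated along lines. *)
Definition tpker (q : R) tau D sg : R :=
  powR (2 * Num.sqrt (cross_norm2 tau D) / (enorm tau * dot D D)) q * enorm tau * enorm sg.

Definition dtpker (q : R) tau D sg tau' D' sg' : R :=
  powR 2 q * dprodpow ((1 - q) / 2) (- q) 2^-1
    (powR (cross_norm2 tau D) (q / 2)) (dot tau tau) (dot D D) (dot sg sg)
    (q / 2 * powR (cross_norm2 tau D) (q / 2 - 1) * dcross tau D tau' D')
    (2 * dot tau tau') (2 * dot D D') (2 * dot sg sg').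

Lemma TPk_tpker q (g : R -> 'rV[R]_3) s t :
  TPk q g s t = tpker q (deriv1 g s) (g t - g s) (deriv1 g t).
Proof. by rewrite /TPk /tpker inv_rtpE. Qed.

Lemma tpker_prodpow q tau D sg : 0 < q ->
  0 < enorm tau -> 0 < enorm sg -> 0 < dot D D ->
  tpker q tau D sg = powR 2 q * prodpow ((1 - q) / 2) (- q) (2^-1)
    (powR (cross_norm2 tau D) (q / 2)) (dot tau tau) (dot D D) (dot sg sg).
Proof.
move=> q0 t0 s0 D0; have := @tp_kernel_prodpow _ q 0 D tau sg q0 t0 s0.
by rewrite subr0 inv_rtpE subr0; exact.
Qed.

Lemma cross_norm20 tau : cross_norm2 tau 0 = 0 :> R.
Proof. by rewrite /cross_norm2 !dotE !mxE !mulr0 !addr0 mulr0 expr0n subrr. Qed.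

(** For [q > 2] both powers of the vanishing area have a positive exponent. *)
Lemma dtpker0 q tau sg tau' D' sg' : 2 < q -> dtpker q tau 0 sg tau' D' sg' = 0.
Proof.
move=> q2; have h1 : powR 0 (q / 2) = 0 :> R.
  by rewrite powR0// gt_eqF// divr_gt0// (lt_trans _ q2).
have h2 : powR 0 (q / 2 - 1) = 0 :> R.
  by rewrite powR0// gt_eqF// subr_gt0 ltr_pdivlMr// mul1r.
by rewrite /dtpker /dprodpow cross_norm20 h1 h2; ring.
Qed.

Lemma dtpker_add q tau D sg tau1 D1 sg1 tau2 D2 sg2 :
  dtpker q tau D sg (tau1 + tau2) (D1 + D2) (sg1 + sg2) =
  dtpker q tau D sg tau1 D1 sg1 + dtpker q tau D sg tau2 D2 sg2.
Proof.
rewrite /dtpker -mulrDr -dprodpow_add; congr (_ * dprodpow _ _ _ _ _ _ _ _ _ _ _).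
- by rewrite -mulrDr /dcross !dotLE; ring.
- by rewrite dotLE mulrDr.
- by rewrite dotLE mulrDr.
- by rewrite dotLE mulrDr.
Qed.

(** The place where [q <= 4] enters: the kernel grows like the power [q] of the mean [M] of the
    second derivatives. *)
Lemma powR_half_le (q M : R) : 0 < q -> q <= 4 -> 0 <= M ->
  powR (M ^+ 2) (q / 2) <= 1 + M ^+ 4.
Proof.
move=> q0 q4 M0; have M4 : 0 <= M ^+ 4 by rewrite exprn_ge0.
have q20 : 0 <= q / 2 by rewrite divr_ge0// ltW.
have [M1|M1] := leP (M ^+ 2) 1.
  apply: (@le_trans _ _ 1); last by rewrite lerDl.
  have := ge0_ler_powR q20; move=> /(_ (M ^+ 2) 1).
  by rewrite !nnegrE sqr_ge0 ler01 M1 powR1 => /(_ isT isT isT).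
apply: (@le_trans _ _ (powR (M ^+ 2) 2)).
  by apply: ler_powR; [exact: ltW|rewrite ler_pdivrMr//; lra].
rewrite (powR_mulrn 2) ?sqr_ge0//.
have -> : (M ^+ 2) ^+ 2 = M ^+ 4 by ring.
by rewrite lerDr.
Qed.

(** [d] is the signed parameter distance and [M] the mean of the second derivatives between the two
    points. After a shear the chord is a Taylor remainder of size [d^2 M], so the squared area is of
    order [d^4 M^2] and the kernel of order [M^q], uniformly in [e]. *)
Lemma tp_pointwise (q c L : R) : 2 < q -> q <= 4 -> 0 < c -> exists2 C, 0 <= C &
  forall u u' D D' w w' (d M dl : R), 0 < dl -> dl <= 1 -> d != 0 -> 0 <= M ->
  (forall e, `|e| < dl -> c <= enorm (u + e *: u') <= L) ->
  (forall e, `|e| < dl -> c <= enorm (w + e *: w') <= L) ->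
  (forall e, `|e| < dl -> c * `|d| <= enorm (D + e *: D') <= L * `|d|) ->
  enorm u' <= L -> enorm w' <= L -> enorm D' <= L * `|d| ->
  enorm (D - d *: u) <= 3 * (d ^+ 2 * M) -> enorm (D' - d *: u') <= 3 * (d ^+ 2 * M) ->
  forall e : R, `|e| < dl ->
  [/\ is_derive e 1 (fun e => tpker q (u + e *: u') (D + e *: D') (w + e *: w'))
        (dtpker q (u + e *: u') (D + e *: D') (w + e *: w') u' D' w'),
      `|tpker q (u + e *: u') (D + e *: D') (w + e *: w')| <= C * (1 + M ^+ 4) &
      `|dtpker q (u + e *: u') (D + e *: D') (w + e *: w') u' D' w'| <= C * (1 + M ^+ 4)].
Proof.
move=> q2 q4 c0; have q0 : 0 < q by rewrite (lt_trans _ q2).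
have c20 : 0 < c ^+ 2 by rewrite exprn_gt0.
(* The upper end [2 * L ^+ 2] also covers the derivatives [2 * dot] of the squared lengths. *)
have [C0 C00 hC] := prodpow_bound ((1 - q) / 2) (- q) 2^-1 (2 * L ^+ 2) c20.
(* [8 * L ^+ 2] is the constant of [dcross_bound]; 36 is the square of 6, the sum of the two Taylor
   constants 3 when [|e| <= 1]. *)
pose K := 8 * L ^+ 2 * 36.
have K0 : 0 <= K by rewrite /K mulr_ge0// mulr_ge0// sqr_ge0.
pose C := powR 2 q * (C0 * (q / 2 * powR K (q / 2))).
have q20 : 0 <= q / 2 by rewrite divr_ge0// ltW.
exists C; first by rewrite mulr_ge0 ?powR_ge0// mulr_ge0// mulr_ge0// powR_ge0.
move=> u u' D D' w w' d M dl dl0 dl1 dn0 M0 hu hw hD uL wL DL r0 r1 e he.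
pose l := d ^+ 2; have l0 : 0 < l by rewrite lt_def sqr_ge0 sqrf_eq0 dn0.
have nd : `|d| ^+ 2 = l by rewrite real_normK ?num_real.
have posu x : `|x| < dl -> 0 < enorm (u + x *: u') by move=> /hu/andP[h _]; exact: lt_le_trans h.
have posw x : `|x| < dl -> 0 < enorm (w + x *: w') by move=> /hw/andP[h _]; exact: lt_le_trans h.
have posD x : `|x| < dl -> 0 < dot (D + x *: D') (D + x *: D').
  move=> /hD/andP[h _]; rewrite -enorm_dot exprn_gt0//; apply: lt_le_trans h.
  by rewrite mulr_gt0// normr_gt0.
set ue := u + e *: u'; set De := D + e *: D'; set we := w + e *: w'.
have dsq v v' : is_derive e 1 (fun e : R => dot (v + e *: v') (v + e *: v')) (2 * dot (v + e *: v') v').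
  exact: is_derive_dot_sqr.
have dN := is_derive_cross u D u' D' e.
have q21 : 1 < q / 2 by rewrite ltr_pdivlMr// mul1r.
have dn := is_derive_powR_ge0 q21 (fun y => cross_norm2_ge0 (u + y *: u') (D + y *: D')) dN.
have L0 : 0 <= L by exact: le_trans (enorm_ge0 _) uL.
have dpos v : 0 < enorm v -> 0 < dot v v by move=> h; rewrite -enorm_dot exprn_gt0.
have dk : is_derive e 1 (fun e => tpker q (u + e *: u') (D + e *: D') (w + e *: w'))
        (dtpker q ue De we u' D' w').
  have h := is_derive_prodpow ((1 - q) / 2) (- q) 2^-1 (dpos _ (posu e he)) (posD e he)
    (dpos _ (posw e he)) dn (dsq u u') (dsq D D') (dsq w w').
  have {}h := is_deriveZ (powR 2 q) h.
  apply: near_eq_is_derive h.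
  have : \forall x \near e, `|x| < dl.
    have : e \in `]- dl, dl[ by rewrite in_itv/= -ltr_norml.
    by move=> /near_in_itvoo; apply: filterS => x; rewrite in_itv/= -ltr_norml.
  apply: filterS => x hx; rewrite tpker_prodpow//; [exact: posu|exact: posw|exact: posD].
(* normalisation by the squared parameter distance [l] *)
pose re := (D - d *: u) + e *: (D' - d *: u').
have DeE : De = re + d *: ue.
  by apply/rowP => i; rewrite !mxE; ring.
have D'E : D' = (D' - d *: u') + d *: u' by rewrite subrK.
pose nu := cross_norm2 ue re / l ^+ 2.
pose dnu := dcross ue re u' (D' - d *: u') / l ^+ 2.
have l2 : l ^+ 2 != 0 by rewrite expf_neq0// gt_eqF.
have NE : cross_norm2 ue De = l ^+ 2 * nu.
  by rewrite DeE cross_norm2_shear /nu mulrC divfK.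
have dNE : dcross ue De u' D' = l ^+ 2 * dnu.
  by rewrite DeE {1}D'E dcross_shear /dnu mulrC divfK.
have e1 : `|e| <= 1 by rewrite (le_trans (ltW he)).
have rb : enorm re <= 6 * (l * M).
  apply: (le_trans (enormD _ _)); rewrite enormZ.
  have := ler_wpM2r (enorm_ge0 (D' - d *: u')) e1; rewrite mul1r.
  by move: r0 r1; rewrite -/l; lra.
have rb' : enorm (D' - d *: u') <= 6 * (l * M).
  apply: (le_trans r1); rewrite -/l.
  have : 0 <= l * M by rewrite mulr_ge0// ltW.
  by lra.
have /andP[uc uL2] := hu e he.
have [] := dcross_bound uL2 uL rb rb'.
have -> : 8 * L ^+ 2 * (6 * (l * M)) ^+ 2 = l ^+ 2 * (K * M ^+ 2) by rewrite /K; ring.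
move=> /andP[N0 Nb] dNb.
have l20 : 0 < l ^+ 2 by rewrite exprn_gt0.
have nu0 : 0 <= nu by rewrite divr_ge0// ltW.
have nub : nu <= K * M ^+ 2 by rewrite ler_pdivrMr// mulrC.
have dnub : `|dnu| <= K * M ^+ 2.
  by rewrite normrM normfV (gtr0_norm l20) ler_pdivrMr// mulrC.
pose b := dot De De / l.
have b0 : 0 <= b by rewrite divr_ge0 ?dot_ge0// ltW.
have bE : dot De De = l * b by rewrite /b [RHS]mulrC divfK// gt_eqF.
pose db := 2 * dot De D' / l.
have dbE : 2 * dot De D' = l * db by rewrite /db [RHS]mulrC divfK// gt_eqF.
have [ar1 ar2] := powR_area_scale q dnu l0 nu0.
pose n := powR nu (q / 2); pose dn' := q / 2 * powR nu (q / 2 - 1) * dnu.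
have [sc1 sc2] := @prodpow_scale _ ((1 - q) / 2) q 2^-1 n (dot ue ue) b (dot we we) dn'
  (2 * dot ue u') db (2 * dot we w') l l0 b0.
(* The factor [q / 2], larger than 1, comes from differentiating the power; with it [W] bounds both
   the numerator and its derivative. *)
pose W := q / 2 * powR (K * M ^+ 2) (q / 2).
have powle (x y p : R) : 0 <= p -> 0 <= x -> x <= y -> powR x p <= powR y p.
  by move=> p0 x0 xy; apply: (ge0_ler_powR p0); rewrite ?nnegrE// (le_trans x0).
have KM0 : 0 <= K * M ^+ 2 by rewrite mulr_ge0 ?sqr_ge0.
have nW : `|n| <= W.
  rewrite ger0_norm ?powR_ge0// (le_trans (powle _ _ _ q20 nu0 nub))//.
  by rewrite ler_peMl ?powR_ge0// ltW.
have q210 : 0 <= q / 2 - 1 by rewrite subr_ge0 ltW.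
have dnW : `|dn'| <= W.
  rewrite /dn' -mulrA normrM ger0_norm// ler_wpM2l// normrM ger0_norm ?powR_ge0//.
  have -> : powR (K * M ^+ 2) (q / 2) = powR (K * M ^+ 2) (q / 2 - 1) * (K * M ^+ 2).
    have [->|k0] := eqVneq (K * M ^+ 2) 0.
      by rewrite mulr0 powR0// gt_eqF// (lt_trans _ q21).
    by rewrite -[X in _ = _ * X]powRr1// -powRD ?subrK// k0 implybT.
  by apply: ler_pM; rewrite ?powR_ge0// powle.
have Lsq x : 0 <= x -> x <= L -> x ^+ 2 <= 2 * L ^+ 2.
  move=> x0 xL; apply: (@le_trans _ _ (L ^+ 2)); first by rewrite ler_sqr ?nnegrE.
  by rewrite ler_peMl ?sqr_ge0// ler1n.
have rng v : c <= enorm v <= L -> c ^+ 2 <= dot v v <= 2 * L ^+ 2.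
  move=> /andP[cv vL]; rewrite -enorm_dot Lsq ?enorm_ge0// andbT.
  by rewrite ler_sqr ?nnegrE ?(ltW c0)// enorm_ge0.
have db2 v v' : enorm v <= L -> enorm v' <= L -> `|2 * dot v v'| <= 2 * L ^+ 2.
  move=> h1 h2; rewrite normrM ger0_norm// ler_wpM2l//.
  by apply: (le_trans (cauchy_dot _ _)); rewrite expr2 ler_pM ?enorm_ge0.
have rngb : c ^+ 2 <= b <= 2 * L ^+ 2.
  have /andP[h1 h2] := hD e he.
  rewrite /b ler_pdivlMr// ler_pdivrMr// -enorm_dot -nd.
  apply/andP; split.
    by rewrite -exprMn ler_sqr ?nnegrE ?mulr_ge0 ?(ltW c0)// enorm_ge0.
  apply: (@le_trans _ _ ((L * `|d|) ^+ 2)).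
    by rewrite ler_sqr ?nnegrE ?mulr_ge0 ?enorm_ge0.
  by rewrite exprMn ler_wpM2r ?sqr_ge0// ler_peMl ?sqr_ge0// ler1n.
have dbb : `|db| <= 2 * L ^+ 2.
  have /andP[_ h2] := hD e he.
  rewrite /db normrM normfV (gtr0_norm l0) ler_pdivrMr// normrM ger0_norm// -mulrA ler_wpM2l//.
  apply: (le_trans (cauchy_dot _ _)); rewrite -nd -exprMn expr2.
  by apply: ler_pM; rewrite ?enorm_ge0.
have /andP[_ wL2] := hw e he.
have [k1 k2] := hC n (dot ue ue) b (dot we we) dn' (2 * dot ue u') db (2 * dot we w') W nW dnW
  (rng _ (hu e he)) rngb (rng _ (hw e he)) (db2 _ _ uL2 uL) dbb (db2 _ _ wL2 wL).
have Wle : powR 2 q * (C0 * W) <= C * (1 + M ^+ 4).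
  have -> : C * (1 + M ^+ 4) = powR 2 q * (C0 * (q / 2 * (powR K (q / 2) * (1 + M ^+ 4)))).
    by rewrite /C; ring.
  do 3 (apply: ler_wpM2l; first by rewrite ?powR_ge0).
  rewrite powRM ?sqr_ge0//; apply: ler_wpM2l; first exact: powR_ge0.
  exact: powR_half_le.
split => //.
- rewrite tpker_prodpow//; [|exact: posu|exact: posw|exact: posD].
  rewrite -/ue -/De -/we NE ar1 bE sc1 normrM ger0_norm ?powR_ge0//.
  by apply: le_trans Wle; rewrite ler_wpM2l// powR_ge0.
- rewrite /dtpker NE ar1 bE dbE dNE ar2 sc2 normrM ger0_norm ?powR_ge0//.
  by apply: le_trans Wle; rewrite ler_wpM2l// powR_ge0.
Qed.

End tp_pointwise.

(** * First variation of the tangent-point energy *)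

Section tp_variation.
Context {R : realType}.
Local Notation mu := (@lebesgue_measure R).
Implicit Types (g h : R -> 'rV[R]_3).
Local Notation II := (`[0%R, 1%R] `*` `[0%R, 1%R] : set (measurableTypeR R * measurableTypeR R))%classic.

Lemma measurable_II : measurable II.
Proof. by apply: measurableX; exact: measurable_itvR. Qed.

(** A shift by a period moves [t] to its representative nearest to [s]; all shifts in question stay
    inside the square over [[-1, 2]]. *)
Lemma quot4_shift_integrable (f F : R -> R) (c : R) :
  measurable_fun setT f -> (forall x, 0 <= f x) ->
  (forall a b, (\int[mu]_(x in `[a, b]) (f x ^+ 2)%:E < +oo)%E) ->
  (forall s t, s <= t -> F t - F s = Rintegral mu `[s, t] f) ->
  `|c| <= 1 ->
  (mu \x mu)%E.-integrable II (EFin \o (fun z => quot4 F z.1 (z.2 + c))).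
Proof.
move=> mf f0 f2 FE c1; have mF := measurable_primitive f0 FE.
have mq (a : R) : measurable_fun [set: measurableTypeR R * measurableTypeR R]
    (fun z => quot4 F z.1 (z.2 + a)).
  rewrite /quot4.
  have m2 : measurable_fun [set: measurableTypeR R * measurableTypeR R]
      (fun z : measurableTypeR R * measurableTypeR R => z.2 + a : R).
    by apply: measurable_funD => //; exact: measurable_snd.
  apply: measurable_funX; apply: measurable_funM.
    apply: measurable_funB.
      exact: (measurableT_comp mF m2).
    exact: (measurableT_comp mF (@measurable_fst _ _ _ _)).
  by apply: measurable_fun_invr; apply: measurable_funB => //; exact: measurable_fst.
apply/integrableP; split.
  apply/measurable_EFinP; apply: measurable_funS (mq c) => //; exact: measurable_II.
under eq_integral do rewrite /= ger0_norm ?quot4_ge0//.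
rewrite -(@tonelli_sets_prod _ (fun s t => quot4 F s (t + c)))//; first last.
- by move=> x y; exact: quot4_ge0.
have lt12 : -1 < 2 :> R by lra.
apply: le_lt_trans (quot4_integral_lty mf f0 f2 FE lt12).
have mq0 : measurable_fun [set: measurableTypeR R * measurableTypeR R]
    (fun z => quot4 F z.1 z.2).
  by have := mq 0; congr (measurable_fun _ _); apply/funext => z; rewrite addr0.
have mq1 (s : R) : measurable_fun setT (fun y : R => (quot4 F s y)%:E).
  apply/measurable_EFinP; rewrite /quot4; apply: measurable_funX; apply: measurable_funM.
    exact: measurable_funB.
  by apply: measurable_fun_invr; exact: measurable_funB.
have minn : measurable_fun setT (fun s : measurableTypeR R =>
    \int[mu]_(t in `[(-1)%R, 2%R]) (quot4 F s t)%:E)%E.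
  by apply: (measurable_inner mq0) => // x y; exact: quot4_ge0.
apply: (@le_trans _ _ (\int[mu]_(s in `[0%R, 1%R]) \int[mu]_(t in `[(-1)%R, 2%R]) (quot4 F s t)%:E)%E).
  apply: ge0_le_integral => //.
  - by move=> s _; apply: integral_ge0 => t _; rewrite lee_fin quot4_ge0.
  - apply: measurable_funTS.
    apply: (@measurable_inner _ (fun s t => quot4 F s (t + c))) => // x y.
    exact: quot4_ge0.
  - exact: measurable_funTS.
  - move=> s _; under eq_integral do rewrite addrC.
    have -> : `[0%R, 1%R]%classic = (+%R c) @^-1` `[c, 1 + c] :> set R.
      by rewrite shift_preimage_itvcc subrr addrK.
    rewrite -(integral_shift c _ (mq1 s))//; last first.
    + by move=> x; rewrite lee_fin quot4_ge0.
    apply: ge0_subset_integral => //.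
    + by apply: measurable_funTS; exact: (mq1 s).
    + by move=> x _; rewrite lee_fin quot4_ge0.
    + by move=> x /=; rewrite !in_itv/= => /andP[? ?]; move: c1; rewrite ler_norml => /andP[? ?]; apply/andP; split; lra.
apply: ge0_subset_integral => //.
- exact: measurable_funTS.
- by move=> s _; apply: integral_ge0 => t _; rewrite lee_fin quot4_ge0.
- by move=> x /=; rewrite !in_itv/= => /andP[? ?]; apply/andP; split; lra.
Qed.

(** The chord bound is asked for parameters at most half a period apart, where [|t - s|] is the
    distance on the circle. *)
Definition bilip (c : R) g := (forall t, c <= enorm (deriv1 g t)) /\
  forall s t, `|t - s| <= 1 / 2 -> c * `|t - s| <= enorm (g t - g s).

Definition vary g h (e : R) : R -> 'rV[R]_3 := fun t => g t + e *: h t.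

Lemma vary_W22 g h e : W22 g -> W22 h -> W22 (vary g h e).
Proof. by move=> wg wh; exact: (W22D wg (W22Z e wh)). Qed.

Lemma vary_deriv g h e t : W22 g -> W22 h ->
  deriv1 (vary g h e) t = deriv1 g t + e *: deriv1 h t.
Proof.
move=> [_ [dg _]] [_ [dh _]]; have [dz zE] := deriv1Z e (dh t).
by have [_ ->] := deriv1D (dg t) dz; rewrite zE.
Qed.

Definition dTPk q g h (z : R * R) : R :=
  dtpker q (deriv1 g z.1) (g z.2 - g z.1) (deriv1 g z.2)
    (deriv1 h z.1) (h z.2 - h z.1) (deriv1 h z.2).

(** [f] sums the absolute coordinates of both second derivatives, so that a single mean controls the
    Taylor remainders of the curve and of its variation. *)
Lemma second_dominant g h : W22 g -> W22 h -> exists f F : R -> R,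
  [/\ measurable_fun setT f, forall x, 0 <= f x,
      forall a b, (\int[mu]_(x in `[a, b]) (f x ^+ 2)%:E < +oo)%E,
      forall s t, s <= t -> F t - F s = Rintegral mu `[s, t] f &
      forall s d, enorm (g (s + d) - g s - d *: deriv1 g s) <= 3 * (d * (F (s + d) - F s)) /\
        enorm (h (s + d) - h s - d *: deriv1 h s) <= 3 * (d * (F (s + d) - F s))].
Proof.
move=> wg wh; have [G [mG _ G2 GE _]] := W22_second wg; have [H [mH _ H2 HE _]] := W22_second wh.
pose f x := (`|G 0 x| + `|G 1 x| + `|G 2%:R x|) + (`|H 0 x| + `|H 1 x| + `|H 2%:R x|).
have mf : measurable_fun setT f.
  by do !apply: measurable_funD; exact: measurable_fun_normr.
have f0 x : 0 <= f x by rewrite !addr_ge0.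
have sq a b c d e k : (a + b + c + (d + e + k)) ^+ 2 <=
    6 * (a ^+ 2 + b ^+ 2 + c ^+ 2 + (d ^+ 2 + e ^+ 2 + k ^+ 2)) :> R.
  have := sqr_ge0 (a - b); have := sqr_ge0 (a - c); have := sqr_ge0 (a - d).
  have := sqr_ge0 (a - e); have := sqr_ge0 (a - k); have := sqr_ge0 (b - c).
  have := sqr_ge0 (b - d); have := sqr_ge0 (b - e); have := sqr_ge0 (b - k).
  have := sqr_ge0 (c - d); have := sqr_ge0 (c - e); have := sqr_ge0 (c - k).
  have := sqr_ge0 (d - e); have := sqr_ge0 (d - k); have := sqr_ge0 (e - k).
  by lra.
have f2 a b : (\int[mu]_(x in `[a, b]) (f x ^+ 2)%:E < +oo)%E.
  have iG i : mu.-integrable `[a, b] (EFin \o (fun x => G i x ^+ 2)).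
    by have [] := square_integrable_itv (mG i) (G2 i a b).
  have iH i : mu.-integrable `[a, b] (EFin \o (fun x => H i x ^+ 2)).
    by have [] := square_integrable_itv (mH i) (H2 i a b).
  have mI := @measurable_itvR R `[a, b].
  have : mu.-integrable `[a, b] (EFin \o (fun x => f x ^+ 2)).
    apply: (le_integrable_r mI (g := fun x => 6 * ((G 0 x ^+ 2 + G 1 x ^+ 2 + G 2%:R x ^+ 2) +
      (H 0 x ^+ 2 + H 1 x ^+ 2 + H 2%:R x ^+ 2)))).
    + by apply: (@measurable_funS _ _ _ _ setT) => //; exact: measurable_funX.
    + move=> x _; rewrite ger0_norm ?sqr_ge0//; apply: (le_trans (sq _ _ _ _ _ _)).
      by rewrite !real_normK ?num_real.
    + by apply: integrable_rZ => //; do !(apply: integrable_rD => //).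
  move=> /integrableP[_]; under eq_integral do rewrite /= ger0_norm ?sqr_ge0//.
  done.
have fi a b : mu.-integrable `[a, b] (EFin \o f).
  by have [] := square_integrable_itv mf (f2 a b).
have [F FE] := signed_primitive fi.
have [_ [dg _]] := wg; have [_ [dh _]] := wh.
exists f, F; split => // s d; split.
  apply: (taylor_remainder (G := G) (f := f)) => // i x.
  have : `|G i x| <= `|G 0 x| + `|G 1 x| + `|G 2%:R x|.
    have := sum3 (fun i => `|G i x|); rewrite (bigD1 i)//= => <-.
    by rewrite lerDl sumr_ge0.
  have : 0 <= `|H 0 x| + `|H 1 x| + `|H 2%:R x| by rewrite !addr_ge0.
  by rewrite /f; lra.
apply: (taylor_remainder (G := H) (f := f)) => // i x.
have : `|H i x| <= `|H 0 x| + `|H 1 x| + `|H 2%:R x|.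
  have := sum3 (fun i => `|H i x|); rewrite (bigD1 i)//= => <-.
  by rewrite lerDl sumr_ge0.
have : 0 <= `|G 0 x| + `|G 1 x| + `|G 2%:R x| by rewrite !addr_ge0.
by rewrite /f; lra.
Qed.

Lemma vary_bounds g h c : W22 g -> W22 h -> 0 < c -> bilip c g ->
  exists L dl, [/\ 0 < dl, dl <= 1,
    forall e t, `|e| < dl -> c / 2 <= enorm (deriv1 g t + e *: deriv1 h t) <= L,
    forall e s t, `|e| < dl -> `|t - s| <= 1 / 2 ->
      c / 2 * `|t - s| <= enorm ((g t - g s) + e *: (h t - h s)) <= L * `|t - s| &
    forall s t, enorm (deriv1 h t) <= L /\ enorm (h t - h s) <= L * `|t - s|].
Proof.
move=> wg wh c0 [cg cd].
have [Lg Lg0 hLg] := W22_deriv_bounded wg; have [Lh Lh0 hLh] := W22_deriv_bounded wh.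
have [_ [dg _]] := wg; have [_ [dh _]] := wh.
have lg := curve_lipschitz dg hLg; have lh := curve_lipschitz dh hLh.
(* [curve_lipschitz] gives [h] the constant [3 * Lh]; this range of [e] preserves half of the
   bi-Lipschitz constant. *)
pose dl := Num.min 1 (c / (6 * Lh)).
have dl1 : dl <= 1 by rewrite ge_min lexx.
have dlh : dl * (6 * Lh) <= c.
  by rewrite -ler_pdivlMr ?mulr_gt0// ge_min lexx orbT.
exists (3 * (Lg + Lh)), dl; split => //.
- by rewrite lt_min ltr01 divr_gt0// mulr_gt0.
- move=> e t he; have eh : `|e| * enorm (deriv1 h t) <= dl * Lh.
    by apply: ler_pM => //; [exact: enorm_ge0|exact: ltW].
  have eh1 : `|e| * enorm (deriv1 h t) <= Lh.
    by apply: (le_trans eh); rewrite ger_pMl.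
  have := enorm_rev (deriv1 g t) (e *: deriv1 h t); have := enormD (deriv1 g t) (e *: deriv1 h t).
  rewrite enormZ; have := cg t; have := hLg t; move: eh eh1 dlh.
  by move: (`|e| * _) (enorm (deriv1 g t)) (enorm (_ + _)) => x y z; clear; lra.
- move=> e s t he d2; have eh : `|e| * enorm (h t - h s) <= dl * (3 * Lh * `|t - s|).
    by apply: ler_pM => //; [exact: enorm_ge0|exact: ltW].
  have d0 : 0 <= `|t - s| by [].
  have eh1 : `|e| * enorm (h t - h s) <= 3 * Lh * `|t - s|.
    by apply: (le_trans eh); rewrite ler_piMl// !mulr_ge0// ltW.
  have eh2 : dl * (3 * Lh * `|t - s|) <= c / 2 * `|t - s|.
    by rewrite !mulrA ler_wpM2r//; move: dlh; clear; lra.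
  have := enorm_rev (g t - g s) (e *: (h t - h s)); have := enormD (g t - g s) (e *: (h t - h s)).
  rewrite enormZ; have := cd s t d2; have := lg s t.
  by move: eh eh1 eh2; clear; nra.
- move=> s t; split; first by have := hLh t; move: Lg0 Lh0; clear; lra.
  apply: (le_trans (lh s t)); rewrite ler_wpM2r//; by move: Lg0; clear; lra.
Qed.

Lemma periodic_near (s t : R) : 0 <= s <= 1 -> 0 <= t <= 1 ->
  exists k : R, [/\ k = 0 \/ k = 1 \/ k = -1, `|k| <= 1, `|t + k - s| <= 1 / 2 &
    forall (T : Type) (f : R -> T), (forall x, f (x + 1) = f x) -> f (t + k) = f t].
Proof.
move=> /andP[s0 s1] /andP[t0 t1].
have [h1|h1] := leP (t - s) (1 / 2); last first.
  exists (-1); split; [by right; right|by rewrite normrN1|by rewrite ler_norml; lra|].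
  by move=> T f fp; rewrite -[in RHS](subrK 1 t) fp.
have [h2|h2] := leP (- (1 / 2)) (t - s).
  exists 0; split; [by left|by rewrite normr0|by rewrite ler_norml; lra|].
  by move=> T f fp; rewrite addr0.
by exists 1; split; [right; left|rewrite normr1|rewrite ler_norml; lra|].
Qed.

(** Off the diagonal [tp_pointwise] applies to the representative of [t] nearest to [s]; the fourth
    power of the mean is integrable over the square and dominates the kernel together with its
    variation. *)
Lemma TP_variation q c g h : 2 < q -> q <= 4 -> W22 g -> W22 h -> 0 < c -> bilip c g ->
  [/\ (mu \x mu)%E.-integrable II (EFin \o (fun z => TPk q g z.1 z.2)),
      (mu \x mu)%E.-integrable II (EFin \o dTPk q g h) &
      is_derive (0 : R) 1 (fun e => TP q (vary g h e)) (Rintegral (mu \x mu)%E II (dTPk q g h))].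
Proof.
move=> q2 q4 wg wh c0 bg.
have [L [dl [dl0 dl1 hu hD hh]]] := vary_bounds wg wh c0 bg.
have [f [F [mf f0 f2 FE tay]]] := second_dominant wg wh.
have c20 : 0 < c / 2 by rewrite divr_gt0.
have [C C0 hC] := @tp_pointwise R q (c / 2) L q2 q4 c20.
pose Q c (z : R * R) := quot4 F z.1 (z.2 + c).
(* The sum over three shifts dominates whichever representative is the nearest. *)
pose G (z : R * R) := C * (1 + (Q 0 z + Q 1 z + Q (-1) z)).
have Q0 a z : 0 <= Q a z by exact: quot4_ge0.
have G0 z : 0 <= G z by rewrite mulr_ge0// addr_ge0// !addr_ge0.
have iG : (mu \x mu)%E.-integrable II (EFin \o G).
  have mII := measurable_II.
  have iQ a : `|a| <= 1 -> (mu \x mu)%E.-integrable II (EFin \o Q a).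
    by move=> ha; exact: (quot4_shift_integrable mf f0 f2 FE ha).
  apply: integrable_rZ => //; apply: integrable_rD => //.
    apply/integrableP; split; first exact: measurable_cst.
    rewrite /= integral_cst//= product_measure1E; [|exact: measurable_itvR..].
    have m1 : mu `[0%R, 1%R] = 1%E by rewrite lebesgue_measure_itv/= lte_fin ltr01 oppr0 adde0.
    by rewrite [X in (_ * (X * _))%E]m1 [X in (_ * (_ * X))%E]m1 !mule1 normr1 ltry.
  apply: integrable_rD => //; last by apply: iQ; rewrite normrN1.
  by apply: integrable_rD => //; apply: iQ; rewrite ?normr0 ?normr1.
pose U e (z : R * R) := deriv1 g z.1 + e *: deriv1 h z.1.
pose D e (z : R * R) := (g z.2 - g z.1) + e *: (h z.2 - h z.1).
pose W e (z : R * R) := deriv1 g z.2 + e *: deriv1 h z.2.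
pose K e z := tpker q (U e z) (D e z) (W e z).
pose dK e z := dtpker q (U e z) (D e z) (W e z) (deriv1 h z.1) (h z.2 - h z.1) (deriv1 h z.2).
have KE e z : TPk q (vary g h e) z.1 z.2 = K e z.
  rewrite TPk_tpker (vary_deriv e z.1 wg wh) (vary_deriv e z.2 wg wh) /K /U /W; congr (tpker _ _ _ _).
  by rewrite /D /vary; apply/rowP => i; rewrite !mxE; ring.
have pt (e : R) z : `|e| < dl -> II z ->
    [/\ is_derive e 1 (K^~ z) (dK e z), `|K e z| <= G z & `|dK e z| <= G z].
  case: z => s t he [/=]; rewrite !in_itv/= => hs ht.
  have [k [k3 k1 d2 per]] := periodic_near hs ht.
  set d := t + k - s in d2 *.
  have tk : t + k = s + d by rewrite /d; ring.
  have [pg _] := wg; have [ph _] := wh.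
  have gt : g t = g (s + d) by rewrite -tk (per _ g pg).
  have ht' : h t = h (s + d) by rewrite -tk (per _ h ph).
  have gs x y : `|(x + y) - x| = `|y| :> R by rewrite addrC addKr.
  (* The same point of the circle, including the endpoints 0 and 1 of the period: kernel and
     variation vanish there. *)
  have [d0|dn0] := eqVneq d 0.
    have D0 x : D x (s, t) = 0.
      by rewrite /D /= gt ht' d0 addr0 !subrr scaler0 addr0.
    have K0 x : K x (s, t) = 0.
      rewrite /K D0 /tpker cross_norm20 sqrtr0 mulr0 mul0r powR0 ?mul0r//.
      by rewrite gt_eqF// (lt_trans _ q2).
    have dK0 : dK e (s, t) = 0 by rewrite /dK D0 dtpker0.
    rewrite K0 dK0 normr0; split => //.
    have -> : K^~ (s, t) = cst 0 by apply/funext => x; exact: K0.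
    exact: is_derive_cst.
  pose M := (F (s + d) - F s) / d.
  have nd := primitive_nd f0 FE.
  have M0 : 0 <= M.
    rewrite /M; have [dp|dp] := ltP 0 d.
      by rewrite divr_ge0// ?(ltW dp)// subr_ge0 nd// lerDl ltW.
    by rewrite -mulrNN -invrN divr_ge0// ?oppr_ge0// subr_le0 nd// gerDl.
  have dM : d ^+ 2 * M = d * (F (s + d) - F s).
    by rewrite /M; field.
  have M4 : M ^+ 4 = Q k (s, t).
    by rewrite /Q /quot4 /= tk /M; congr ((_ / _) ^+ 4); ring.
  have CG : C * (1 + M ^+ 4) <= G (s, t).
    rewrite M4 /G ler_wpM2l// lerD2l.
    have := Q0 0 (s, t); have := Q0 1 (s, t); have := Q0 (-1) (s, t).
    case: k3 => [->|[->|->]];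
      by move: (Q 0 _) (Q 1 _) (Q (-1) _) => x y z; clear; lra.
  have [] := hC (deriv1 g s) (deriv1 h s) (g t - g s) (h t - h s) (deriv1 g t) (deriv1 h t) d M dl
    dl0 dl1 dn0 M0 _ _ _ _ _ _ _ _ e he.
  - by move=> x hx; exact: hu.
  - by move=> x hx; exact: hu.
  - by move=> x hx; have := hD x s (s + d) hx; rewrite gt ht' gs; exact.
  - by have [] := hh s s.
  - by have [] := hh s t.
  - by have [_] := hh s (s + d); rewrite ht' gs.
  - by rewrite dM gt; have [] := tay s d.
  - by rewrite dM ht'; have [] := tay s d.
  move=> h1 h2 h3; split; first exact: h1.
  - exact: le_trans h2 CG.
  - exact: le_trans h3 CG.
have mK e : measurable_fun II (K e).
  have := measurable_TPk q (vary_W22 e wg wh).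
  move=> /(measurable_funS measurableT (@subsetT _ II)).
  by congr (measurable_fun _ _); apply/funext => z; rewrite KE.
have [idK dTP] := is_derive_Rintegral dl0 measurable_II (fun e _ => mK e)
  (fun e z he Bz => let: And3 a _ _ := pt e z he Bz in a)
  (fun e z he Bz => let: And3 _ a b := pt e z he Bz in conj a b) G0 iG.
have dK0 : dK 0 = dTPk q g h.
  by apply/funext => z; rewrite /dK /U /D /W !scale0r !addr0.
rewrite dK0 in idK dTP; split; [|exact: idK|].
- have z0 : `|0 : R| < dl by rewrite normr0.
  have : (mu \x mu)%E.-integrable II (EFin \o K 0).
    by apply: le_integrable_r iG; [exact: measurable_II|exact: mK|move=> z hz; have [] := pt 0 z z0 hz].
  congr (integrable _ _ _); apply/funext => z /=; congr EFin.
  by rewrite -KE /vary; congr (TPk _ _ _ _); apply/funext => x; rewrite scale0r addr0.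
- have -> : (fun e => TP q (vary g h e)) = (fun e => Rintegral (mu \x mu)%E II (K e)).
    apply/funext => e; rewrite TP_prod; last exact: vary_W22.
    by congr Rintegral; apply/funext => z; rewrite KE.
  exact: dTP.
Qed.

End tp_variation.

(** * Directional derivatives of length, bending and total energy *)

Section gateaux.
Context {R : realType}.
Local Notation mu := (@lebesgue_measure R).
Implicit Types (g h : R -> 'rV[R]_3) (G H : 'I_3 -> R -> R).
Local Notation II := (`[0%R, 1%R] `*` `[0%R, 1%R] : set (measurableTypeR R * measurableTypeR R))%classic.
Local Notation I01 := (`[0%R, 1%R] : set (measurableTypeR R))%classic.

Definition dirD (F : (R -> 'rV[R]_3) -> R) g h : R := 'D_1 (fun e : R => F (vary g h e)) (0 : R).

(** Besides existence it records additivity in the direction, which is what summing over a symmetry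
    orbit uses. *)
Definition gateaux (F : (R -> 'rV[R]_3) -> R) g :=
  (forall h, W22 h -> derivable (fun e : R => F (vary g h e)) (0 : R) 1) /\
  forall h1 h2, W22 h1 -> W22 h2 ->
    dirD F g (fun t => h1 t + h2 t) = dirD F g h1 + dirD F g h2.

Lemma dirD_val F g h l :
  is_derive (0 : R) 1 (fun e : R => F (vary g h e)) l -> dirD F g h = l.
Proof. by case. Qed.

Lemma gateauxI F g (D : (R -> 'rV[R]_3) -> R) :
  (forall h, W22 h -> is_derive (0 : R) 1 (fun e : R => F (vary g h e)) (D h)) ->
  (forall h1 h2, W22 h1 -> W22 h2 -> D (fun t => h1 t + h2 t) = D h1 + D h2) ->
  gateaux F g.
Proof.
move=> FD DD; split=> [h /FD[]//|h1 h2 w1 w2].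
by rewrite (dirD_val (FD _ (W22D w1 w2))) (dirD_val (FD _ w1)) (dirD_val (FD _ w2)) DD.
Qed.

Lemma gateaux_dirD F g h : gateaux F g -> W22 h ->
  is_derive (0 : R) 1 (fun e : R => F (vary g h e)) (dirD F g h).
Proof. by move=> [dF _] wh; split => //; exact: dF. Qed.

Lemma vary0 g h : vary g h 0 = g.
Proof. by apply/funext => t; rewrite /vary scale0r addr0. Qed.

Lemma dcross_add (u v u1 v1 u2 v2 : 'rV[R]_3) :
  dcross u v (u1 + u2) (v1 + v2) = dcross u v u1 v1 + dcross u v u2 v2.
Proof. by rewrite /dcross !dotLE; ring. Qed.

Lemma TP_gateaux q c g : 2 < q -> q <= 4 -> W22 g -> 0 < c -> bilip c g ->
  gateaux (TP q) g.
Proof.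
move=> q2 q4 wg c0 bg.
apply: (@gateauxI _ _ (fun h => Rintegral (mu \x mu)%E II (dTPk q g h))) => [h wh|h1 h2 w1 w2].
  by have [] := TP_variation q2 q4 wg wh c0 bg.
have [_ i1 _] := TP_variation q2 q4 wg w1 c0 bg.
have [_ i2 _] := TP_variation q2 q4 wg w2 c0 bg.
apply: etrans (RintegralD measurable_II i1 i2).
congr Rintegral; apply/funext => z; rewrite /dTPk -dtpker_add.
have [_ [d1 _]] := w1; have [_ [d2 _]] := w2.
have [_ ->] := deriv1D (d1 z.1) (d2 z.1); have [_ ->] := deriv1D (d1 z.2) (d2 z.2).
by congr (dtpker _ _ _ _ _ _ _); apply/rowP => i; rewrite !mxE; ring.
Qed.

(** Length and bending share this integrand, a numerator times a power of the squared speed; the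
    last two bases of [prodpow] are set to 1. *)
Lemma kernel_variation (al c : R) g h (n dn : R -> R -> R) (w : R -> R) :
  W22 g -> W22 h -> 0 < c -> bilip c g ->
  (forall (e t : R), is_derive e 1 (n^~ t) (dn e t)) ->
  (forall e, measurable_fun I01 (n e)) ->
  (forall e t, `|e| < 1 -> `|n e t| <= w t /\ `|dn e t| <= w t) ->
  mu.-integrable I01 (EFin \o w) ->
  let D t := dprodpow al 0 0 (n 0 t) (dot (deriv1 g t) (deriv1 g t)) 1 1 (dn 0 t)
    (2 * dot (deriv1 g t) (deriv1 h t)) 0 0 in
  mu.-integrable I01 (EFin \o D) /\
  is_derive (0 : R) 1 (fun e => Rintegral mu I01 (fun t => n e t *
      powR (dot (deriv1 (vary g h e) t) (deriv1 (vary g h e) t)) al))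
    (Rintegral mu I01 D).
Proof.
move=> wg wh c0 bg dnE mn nw iw D.
have [L [dl [dl0 dl1 hu _ hh]]] := vary_bounds wg wh c0 bg.
pose U e t := deriv1 g t + e *: deriv1 h t.
pose m := Num.min 1 ((c / 2) ^+ 2); pose M := Num.max 1 (2 * L ^+ 2).
have m0 : 0 < m by rewrite lt_min ltr01 exprn_gt0// divr_gt0.
have [C C0 hC] := prodpow_bound al 0 0 M m0.
pose K e t := prodpow al 0 0 (n e t) (dot (U e t) (U e t)) 1 1.
pose dK e t := dprodpow al 0 0 (n e t) (dot (U e t) (U e t)) 1 1 (dn e t)
  (2 * dot (U e t) (deriv1 h t)) 0 0.
have c2 : 0 < c / 2 by rewrite divr_gt0.
have rng e t : `|e| < dl -> m <= dot (U e t) (U e t) <= M.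
  move=> he; have /andP[h1 h2] := hu e t he.
  rewrite -enorm_dot ge_min le_max; apply/andP; split; apply/orP; right.
    by rewrite ler_sqr ?nnegrE ?(ltW c2)// enorm_ge0.
  have hL : 0 <= L by exact: le_trans (enorm_ge0 _) h2.
  apply: (@le_trans _ _ (L ^+ 2)); first by rewrite ler_sqr ?nnegrE ?enorm_ge0.
  by rewrite ler_peMl ?sqr_ge0// ler1n.
have M1 : m <= 1 <= M by rewrite ge_min le_max !lexx.
have M0 : 0 <= M by rewrite le_max ler01.
have pt (e t : R) : `|e| < dl ->
    [/\ is_derive e 1 (K^~ t) (dK e t), `|K e t| <= C * w t & `|dK e t| <= C * w t].
  move=> he; have /andP[r1 r2] := rng e t he.
  have e1 : `|e| < 1 by exact: lt_le_trans he dl1.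
  have [nw1 nw2] := nw e t e1; have [_ hU] := andP (hu e t he).
  have dU : `|2 * dot (U e t) (deriv1 h t)| <= M.
    rewrite le_max normrM ger0_norm//; apply/orP; right.
    rewrite ler_wpM2l//; apply: (le_trans (cauchy_dot _ _)); rewrite expr2.
    by have [h1 _] := hh t t; apply: ler_pM; rewrite ?enorm_ge0.
  have z0 : `|0 : R| <= M by rewrite normr0.
  have [b1 b2] := hC _ _ _ _ _ _ _ _ _ nw1 nw2 (rng e t he) M1 M1 dU z0 z0.
  split => //; apply: is_derive_prodpow => //; first exact: lt_le_trans r1.
  exact: is_derive_dot_sqr.
have KE e : (fun t => n e t * powR (dot (deriv1 (vary g h e) t) (deriv1 (vary g h e) t)) al) = K e.
  by apply/funext => t; rewrite /K /prodpow !powR1 !mulr1 !vary_deriv.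
have mK e : measurable_fun I01 (K e).
  rewrite -KE; apply: measurable_funM; first exact: mn.
  apply: measurable_fun_powR; apply: measurable_funTS.
  by apply: measurable_dot => i; apply: deriv_measurable; exact: vary_W22.
have iG : mu.-integrable I01 (EFin \o (fun t => C * `|w t|)).
  by apply: integrable_rZ => //; exact: integrable_abse iw.
have nn t : 0 <= C * `|w t| by rewrite mulr_ge0.
have le1 e t : `|e| < dl -> `|K e t| <= C * `|w t| /\ `|dK e t| <= C * `|w t|.
  move=> he; have [_ h1 h2] := pt e t he.
  have : C * w t <= C * `|w t| by rewrite ler_wpM2l// ler_norm.
  by move=> h3; split; [exact: le_trans h1 h3|exact: le_trans h2 h3].
have [i1 d1] := is_derive_Rintegral dl0 (measurable_itvR _) (fun e _ => mK e)
  (fun e t he _ => let: And3 a _ _ := pt e t he in a) (fun e t he _ => le1 e t he) nn iG.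
have dE : dK 0 = D by apply/funext => t; rewrite /dK /U scale0r addr0.
rewrite dE in i1 d1; split; first exact: i1.
by under eq_fun do rewrite KE.
Qed.

Lemma powR_half (x : R) : 0 <= x -> powR x (2^-1) = Num.sqrt x.
Proof. exact: powR12_sqrt. Qed.

Lemma length_variation c g h : W22 g -> W22 h -> 0 < c -> bilip c g ->
  let D t := dprodpow 2^-1 0 0 1 (dot (deriv1 g t) (deriv1 g t)) 1 1 0
    (2 * dot (deriv1 g t) (deriv1 h t)) 0 0 in
  mu.-integrable I01 (EFin \o D) /\
  is_derive (0 : R) 1 (fun e => curve_length (vary g h e)) (Rintegral mu I01 D).
Proof.
move=> wg wh c0 bg D.
have i1 : mu.-integrable I01 (EFin \o (fun=> 1 : R)).
  have := @bounded_itv_integrable R (fun=> 1) true false 0 1 1.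
  by apply => //; move=> z; rewrite normr1.
have bd (e t : R) : `|e| < 1 -> `|1 : R| <= 1 /\ `|0 : R| <= 1 by rewrite normr1 normr0.
have [h1 h2] := @kernel_variation 2^-1 c g h (fun _ _ => 1) (fun _ _ => 0) (fun=> 1) wg wh c0 bg
  (fun e t => is_derive_cst _ _ _) (fun e => @measurable_cst _ _ _ _ _ _) bd i1.
split; first exact: h1.
have -> : (fun e => curve_length (vary g h e)) = (fun e => Rintegral mu I01 (fun t => 1 *
      powR (dot (deriv1 (vary g h e) t) (deriv1 (vary g h e) t)) 2^-1)).
  apply/funext => e; congr Rintegral; apply/funext => t.
  by rewrite mul1r powR_half ?dot_ge0.
exact: h2.
Qed.

Lemma length_gateaux c g : W22 g -> 0 < c -> bilip c g -> gateaux (@curve_length R) g.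
Proof.
move=> wg c0 bg.
pose D h t := dprodpow 2^-1 0 0 1 (dot (deriv1 g t) (deriv1 g t)) 1 1 0
    (2 * dot (deriv1 g t) (deriv1 h t)) 0 0 : R.
apply: (@gateauxI _ _ (fun h => Rintegral mu I01 (D h))) => [h wh|h1 h2 w1 w2].
  by have [] := length_variation wg wh c0 bg.
have [i1 _] := length_variation wg w1 c0 bg.
have [i2 _] := length_variation wg w2 c0 bg.
apply: etrans (RintegralD (measurable_itvR _) i1 i2).
congr Rintegral; apply/funext => t; rewrite /D -dprodpow_add.
have [_ [d1 _]] := w1; have [_ [d2 _]] := w2.
by have [_ ->] := deriv1D (d1 t) (d2 t); rewrite dotDr mulrDr !addr0.
Qed.

(** A chosen square integrable representative of the second derivative, which adds and scales
    pointwise, unlike [deriv1 (deriv1 g)] at points where that derivative fails to exist. *)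
Definition second g G :=
  [/\ forall i, measurable_fun setT (G i),
      forall i a b, (\int[mu]_(x in `[a, b]) (G i x ^+ 2)%:E < +oo)%E &
      {ae mu, forall x : R, forall i,
        is_derive x 1 (fun t => deriv1 g t 0 i) (G i x)}].

Lemma W22_has_second g : W22 g -> exists G, second g G.
Proof. by move=> wg; have [G [? _ ? _ ?]] := W22_second wg; exists G. Qed.

Lemma second_add g h G H : W22 g -> W22 h -> second g G -> second h H ->
  second (fun t => g t + h t) (fun i t => G i t + H i t).
Proof.
move=> wg wh [mG G2 aG] [mH H2 aH]; split.
- by move=> i; exact: measurable_funD.
- move=> i a b; have mI := @measurable_itvR R `[a, b].
  have [_ iG] := square_integrable_itv (mG i) (G2 i a b).
  have [_ iH] := square_integrable_itv (mH i) (H2 i a b).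
  have : mu.-integrable `[a, b] (EFin \o (fun x => (G i x + H i x) ^+ 2)).
    apply: (le_integrable_r mI (g := fun x => 2 * (G i x ^+ 2 + H i x ^+ 2))).
    + by apply: measurable_funTS; apply: measurable_funX; apply: measurable_funD; [exact: mG|exact: mH].
    + move=> x _; rewrite ger0_norm ?sqr_ge0//.
      by have := sqr_ge0 (G i x - H i x); lra.
    + by apply: integrable_rZ => //; apply: integrable_rD.
  by move=> /integrableP[_]; under eq_integral do rewrite /= ger0_norm ?sqr_ge0//.
- have aGH := @filterI _ _ (ae_filter_ringOfSetsType mu) _ _ aG aH.
  apply: filterS aGH.
  move=> x [h1 h2] i.
  have -> : (fun t => deriv1 (fun t => g t + h t) t 0 i) =
     (fun t => deriv1 g t 0 i + deriv1 h t 0 i).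
    apply/funext => t; have [_ [d1 _]] := wg; have [_ [d2 _]] := wh.
    by have [_ ->] := deriv1D (d1 t) (d2 t); rewrite mxE.
  exact: is_deriveD (h1 i) (h2 i).
Qed.

Lemma second_scale g G (c : R) : W22 g -> second g G ->
  second (fun t => c *: g t) (fun i t => c * G i t).
Proof.
move=> wg [mG G2 aG]; split.
- by move=> i; exact: measurable_funM.
- move=> i a b; have mI := @measurable_itvR R `[a, b].
  have [_ iG] := square_integrable_itv (mG i) (G2 i a b).
  have := integrable_rZ mI (c ^+ 2) iG.
  move=> /integrableP[_]; under eq_integral do rewrite /= -exprMn ger0_norm ?sqr_ge0//.
  done.
- apply: filterS aG; first exact: (ae_filter_ringOfSetsType mu).
  move=> x h1 i.
  have -> : (fun t => deriv1 (fun t => c *: g t) t 0 i) = (fun t => c * deriv1 g t 0 i).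
    apply/funext => t; have [_ [d1 _]] := wg.
    by have [_ ->] := deriv1Z c (d1 t); rewrite mxE.
  exact: (is_deriveZ c (h1 i)).
Qed.

(* [bending] integrates the pointwise second derivative, whose measurability is not obvious *)
Lemma bending_second g G : W22 g -> second g G -> bending g =
  Rintegral mu I01 (fun t => cross_norm2 (deriv1 g t) (\row_i G i t) / enorm (deriv1 g t) ^+ 5).
Proof.
move=> wg [mG G2 aG]; rewrite /bending /Rintegral; congr fine.
have nn u v : 0 <= cross_norm2 u v / enorm u ^+ 5 :> R.
  by rewrite divr_ge0 ?cross_norm2_ge0// exprn_ge0// enorm_ge0.
apply: ge0_integral_ae_eq_nonmeas.
- exact: measurable_itvR.
- by move=> x; rewrite lee_fin nn.
- by move=> x; rewrite lee_fin nn.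
- apply/measurable_EFinP; apply: measurable_funTS; apply: measurable_funM.
    apply: measurable_cross => i; first exact: deriv_measurable.
    by under eq_fun do rewrite mxE; exact: mG.
  apply: measurable_fun_invr; apply: measurable_funX; apply: measurable_enorm => i.
  exact: deriv_measurable.
- apply: filterS aG; first exact: (ae_filter_ringOfSetsType mu).
  move=> x h _; congr (EFin (cross_norm2 _ _ / _)).
  by have [] := @deriv1_coordP R (deriv1 g) x (\row_i G i x) (fun i => eq_ind_r _ (h i) (mxE _ _ _ _)).
Qed.

Definition dbend g G h H (t : R) : R :=
  dprodpow (- (5 / 2)) 0 0 (cross_norm2 (deriv1 g t) (\row_i G i t))
    (dot (deriv1 g t) (deriv1 g t)) 1 1
    (dcross (deriv1 g t) (\row_i G i t) (deriv1 h t) (\row_i H i t))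
    (2 * dot (deriv1 g t) (deriv1 h t)) 0 0.

Lemma powR_fifth (a : R) : 0 <= a -> powR (a ^+ 2) (- (5 / 2)) = (a ^+ 5)^-1.
Proof.
move=> a0; rewrite powRN; congr (_^-1).
rewrite -(powR_mulrn 2)// -powRrM.
have -> : 2 * (5 / 2) = 5%:R :> R by field.
by rewrite powR_mulrn.
Qed.

Lemma bending_variation c g h G H : W22 g -> W22 h -> second g G -> second h H ->
  0 < c -> bilip c g ->
  mu.-integrable I01 (EFin \o dbend g G h H) /\
  is_derive (0 : R) 1 (fun e => bending (vary g h e)) (Rintegral mu I01 (dbend g G h H)).
Proof.
move=> wg wh sG sH c0 bg.
have [Lg Lg0 hLg] := W22_deriv_bounded wg; have [Lh Lh0 hLh] := W22_deriv_bounded wh.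
pose u t := deriv1 g t; pose u' t := deriv1 h t.
pose v t : 'rV[R]_3 := \row_i G i t; pose v' t : 'rV[R]_3 := \row_i H i t.
pose n e t := cross_norm2 (u t + e *: u' t) (v t + e *: v' t).
pose dn e t := dcross (u t + e *: u' t) (v t + e *: v' t) (u' t) (v' t).
pose r t := enorm (v t) + enorm (v' t).
pose w t := 8 * (Lg + Lh) ^+ 2 * (r t ^+ 2).
have [mG G2 aG] := sG; have [mH H2 aH] := sH.
have mI := @measurable_itvR R `[0%R, 1%R].
have mv i : measurable_fun setT (fun t : R => v t 0 i).
  by rewrite /v; under eq_fun do rewrite mxE; exact: mG.
have mv' i : measurable_fun setT (fun t : R => v' t 0 i).
  by rewrite /v'; under eq_fun do rewrite mxE; exact: mH.
have iw : mu.-integrable I01 (EFin \o w).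
  apply: integrable_rZ => //.
  have iG i : mu.-integrable I01 (EFin \o (fun x => G i x ^+ 2)).
    by have [] := square_integrable_itv (mG i) (G2 i 0 1).
  have iH i : mu.-integrable I01 (EFin \o (fun x => H i x ^+ 2)).
    by have [] := square_integrable_itv (mH i) (H2 i 0 1).
  apply: (le_integrable_r mI (g := fun x => 2 * ((G 0 x ^+ 2 + G 1 x ^+ 2 + G 2%:R x ^+ 2) +
      (H 0 x ^+ 2 + H 1 x ^+ 2 + H 2%:R x ^+ 2)))).
  - apply: measurable_funTS; apply: measurable_funX; apply: measurable_funD;
      exact: measurable_enorm.
  - move=> x _; rewrite ger0_norm ?sqr_ge0// /r.
    have -> : G 0 x ^+ 2 + G 1 x ^+ 2 + G 2%:R x ^+ 2 = enorm (v x) ^+ 2.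
      by rewrite enorm_sqr sum3 !mxE.
    have -> : H 0 x ^+ 2 + H 1 x ^+ 2 + H 2%:R x ^+ 2 = enorm (v' x) ^+ 2.
      by rewrite enorm_sqr sum3 !mxE.
    by have := sqr_ge0 (enorm (v x) - enorm (v' x)); move: (enorm _) (enorm _) => a b; lra.
  - by apply: integrable_rZ => //; do !(apply: integrable_rD => //).
have mn e : measurable_fun I01 (n e).
  apply: measurable_funTS; apply: measurable_cross => i.
    under eq_fun do rewrite !mxE; apply: measurable_funD; first exact: deriv_measurable.
    by apply: measurable_funM => //; exact: deriv_measurable.
  under eq_fun do rewrite !mxE; apply: measurable_funD; first exact: mG.
  by apply: measurable_funM => //; exact: mH.
have nw e t : `|e| < 1 -> `|n e t| <= w t /\ `|dn e t| <= w t.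
  move=> e1; have eb a b : enorm (a + e *: b) <= enorm a + enorm b.
    apply: (le_trans (enormD _ _)); rewrite lerD2l enormZ ler_piMl ?enorm_ge0//; exact: ltW.
  have hu : enorm (u t + e *: u' t) <= Lg + Lh.
    by apply: (le_trans (eb _ _)); apply: lerD; [exact: hLg|exact: hLh].
  have hu' : enorm (u' t) <= Lg + Lh by apply: (le_trans (hLh t)); rewrite lerDr ltW.
  have hv : enorm (v t + e *: v' t) <= r t by exact: eb.
  have hv' : enorm (v' t) <= r t by rewrite lerDr enorm_ge0.
  have [/andP[n0 nb] dnb] := dcross_bound hu hu' hv hv'.
  by split => //; rewrite ger0_norm.
have [h1 h2] := @kernel_variation (- (5 / 2)) c g h n dn w wg wh c0 bg
  (fun e t => is_derive_cross _ _ _ _ e) mn nw iw.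
have DE : (fun t => dprodpow (- (5 / 2)) 0 0 (n 0 t) (dot (deriv1 g t) (deriv1 g t)) 1 1 (dn 0 t)
    (2 * dot (deriv1 g t) (deriv1 h t)) 0 0) = dbend g G h H.
  by apply/funext => t; rewrite /dbend /n /dn !scale0r !addr0.
rewrite DE in h1 h2; split => //.
have -> : (fun e => bending (vary g h e)) = (fun e => Rintegral mu I01 (fun t => n e t *
      powR (dot (deriv1 (vary g h e) t) (deriv1 (vary g h e) t)) (- (5 / 2)))).
  apply/funext => e.
  have s1 := second_add wg (W22Z e wh) sG (second_scale e wh sH).
  rewrite (bending_second (vary_W22 e wg wh) s1); congr Rintegral; apply/funext => t.
  rewrite -enorm_dot powR_fifth ?enorm_ge0//; congr (_ / _).
  rewrite vary_deriv// /n; congr cross_norm2.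
  by apply/rowP => i; rewrite !mxE.
exact: h2.
Qed.

Lemma bending_gateaux c g : W22 g -> 0 < c -> bilip c g -> gateaux (@bending R) g.
Proof.
move=> wg c0 bg; have [G sG] := W22_has_second wg; split.
  by move=> h wh; have [H sH] := W22_has_second wh; have [_ []] := bending_variation wg wh sG sH c0 bg.
move=> h1 h2 w1 w2; have [H1 s1] := W22_has_second w1; have [H2 s2] := W22_has_second w2.
have [i1 d1] := bending_variation wg w1 sG s1 c0 bg.
have [i2 d2] := bending_variation wg w2 sG s2 c0 bg.
have [_ d3] := bending_variation wg (W22D w1 w2) sG (second_add w1 w2 s1 s2) c0 bg.
rewrite (dirD_val d1) (dirD_val d2) (dirD_val d3).
apply: etrans (RintegralD (measurable_itvR _) i1 i2).
congr Rintegral; apply/funext => t; rewrite /dbend -dprodpow_add.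
have [_ [e1 _]] := w1; have [_ [e2 _]] := w2.
have [_ ->] := deriv1D (e1 t) (e2 t).
have -> : (\row_i (H1 i t + H2 i t) : 'rV[R]_3) = (\row_i H1 i t) + (\row_i H2 i t).
  by apply/rowP => i; rewrite !mxE.
congr (dprodpow _ _ _ _ _ _ _ _ _ _ _); rewrite ?addr0//.
  exact: dcross_add.
by rewrite dotDr mulrDr.
Qed.

Lemma Etheta_gateaux q theta c g : 2 < q -> q <= 4 -> W22 g -> 0 < c -> bilip c g ->
  0 < TP q g -> gateaux (Etheta q theta) g.
Proof.
move=> q2 q4 wg c0 bg TP0; pose p := 1 / (q - 2).
have bB := bending_gateaux wg c0 bg; have bT := TP_gateaux q2 q4 wg c0 bg.
apply: (@gateauxI _ _ (fun h => dirD (@bending R) g h +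
    theta * (p * powR (TP q g) (p - 1) * dirD (TP q) g h))) => [h wh|h1 h2 w1 w2].
  have d1 := gateaux_dirD bB wh; have d2 := gateaux_dirD bT wh.
  have := @is_derive_powR_pos R (fun e => TP q (vary g h e)) 0 _ p _ d2.
  rewrite vary0 => /(_ TP0) d3.
  exact: (is_deriveD d1 (is_deriveZ theta d3)).
rewrite (bB.2 _ _ w1 w2) (bT.2 _ _ w1 w2) !mulrDr.
by rewrite -!addrA; congr (_ + _); rewrite addrCA.
Qed.

End gateaux.

(** * Invariance under reparametrisation and coordinate signs *)

Section reparametrisation.
Context {R : realType}.
Local Notation mu := (@lebesgue_measure R).
Implicit Types (g h : R -> 'rV[R]_3) (u v : 'rV[R]_3) (s : 'I_3 -> R).
Local Notation I01 := (`[0%R, 1%R] : set (measurableTypeR R))%classic.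

Lemma cov_period (tau dtau : R -> R) (sg : bool) (f : R -> \bar R) :
  (forall x : R, is_derive x 1 tau (dtau x)) -> continuous dtau ->
  (forall x, 0 < (-1) ^+ sg * dtau x) -> (forall y, exists x, tau x = y) ->
  (forall x, tau (x + 1) = tau x + (-1) ^+ sg) ->
  measurable_fun setT f -> (forall x, 0 <= f x)%E -> (forall x, f (x + 1)%R = f x) ->
  (\int[mu]_(x in `[0%R, 1%R]) (f (tau x) * `|dtau x|%:E) =
   \int[mu]_(x in `[0%R, 1%R]) f x)%E.
Proof.
move=> dt cdt dt0 st tp mf f0 fp.
(* The left end of the image of one period, which is [tau 1] when the orientation is reversed; the
   preimage of [[c, c + 1]] is then exactly [[0, 1]]. *)
pose c := if sg then tau 1 else tau 0.
rewrite -(ge0_integral_period c mf f0 fp) (cov dt cdt dt0 st (measurable_itvR _) mf f0).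
congr integral; apply/seteqP.
have dmono : {mono (fun x => (-1) ^+ sg * tau x) : x y / x <= y}.
  by apply: (@gt0_derive_mono _ _ (fun x => (-1) ^+ sg * dtau x)) => //.
have t1 : tau 1 = tau 0 + (-1) ^+ sg by rewrite -tp add0r.
have E (x : R) : (c <= tau x <= c + 1) <-> (0 <= x <= 1).
  rewrite -(dmono 0 x) -(dmono x 1) /c t1; case: (sg) => /=;
    rewrite ?expr1 ?expr0; split => /andP[? ?]; apply/andP; split; lra.
by split => x /=; rewrite !in_itv/= => /E.
Qed.

(** The change of variables for the constant 1 on a null set shows that [|dtau|] integrates to 0
    over the preimage, while [|dtau|] is positive. *)
Lemma null_preimage (tau dtau : R -> R) (sg : bool) (P : R -> Prop) :
  (forall x : R, is_derive x 1 tau (dtau x)) -> continuous dtau ->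
  (forall x, 0 < (-1) ^+ sg * dtau x) -> (forall y, exists x, tau x = y) ->
  {ae mu, forall x : R, P x} -> {ae mu, forall x : R, P (tau x)}.
Proof.
move=> dt cdt dt0 st [N [mN N0 PN]].
have mt : measurable_fun [set: measurableTypeR R] (tau : _ -> measurableTypeR R).
  exact: continuous_measurable_fun (is_derive_continuous dt).
have mT : measurable (tau @^-1` N).
  by rewrite -[X in measurable X]setTI; exact: mt.
have := cov dt cdt dt0 st mN (measurable_cst (1 : \bar R)%E) (fun=> lee01).
have -> : (\int[mu]_(y in N) cst 1 y = 0)%E.
  by rewrite integral_cst// mul1e; exact: N0.
move=> /esym i0.
have mn : measurable_fun [set: measurableTypeR R] (fun x => `|dtau x|).
  by apply: measurable_fun_normr; exact: continuous_measurable_fun.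
have i0' : (\int[mu]_(x in tau @^-1` N) `|(`|dtau x|)%:E| = 0)%E.
  by rewrite -[RHS]i0; apply: eq_integral => x _; rewrite mul1e/= normr_id.
have ae0 : {ae mu, forall x, (tau @^-1` N) x -> (`|dtau x|)%:E = 0%E}.
  apply/(ae_eq_integral_abs mu mT) => //.
  by apply/measurable_EFinP; exact: measurable_funTS.
apply: filterS ae0; first exact: (ae_filter_ringOfSetsType mu).
move=> x x0; apply: contrapT => nP.
have [/eqP] := x0 (PN _ nP); rewrite normr_eq0 => /eqP d0.
by have := dt0 x; rewrite d0 mulr0 ltxx.
Qed.

Definition sgmul s v : 'rV[R]_3 := \row_i (s i * v 0 i).

Lemma sgmulD s u v : sgmul s (u + v) = sgmul s u + sgmul s v.
Proof. by apply/rowP => i; rewrite !mxE mulrDr. Qed.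

Lemma sgmulZ s (c : R) u : sgmul s (c *: u) = c *: sgmul s u.
Proof. by apply/rowP => i; rewrite !mxE mulrCA. Qed.

Lemma sgmulN s u : sgmul s (- u) = - sgmul s u.
Proof. by apply/rowP => i; rewrite !mxE mulrN. Qed.

Lemma dot_sgmul s u v : (forall i, s i ^+ 2 = 1) -> dot (sgmul s u) (sgmul s v) = dot u v.
Proof.
by move=> s1; apply: eq_bigr => i _; rewrite !mxE mulrACA -expr2 s1 mul1r.
Qed.

Lemma enorm_sgmul s u : (forall i, s i ^+ 2 = 1) -> enorm (sgmul s u) = enorm u.
Proof. by move=> s1; rewrite /enorm dot_sgmul. Qed.

Lemma cross_sgmul s u v : (forall i, s i ^+ 2 = 1) ->
  cross_norm2 (sgmul s u) (sgmul s v) = cross_norm2 u v.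
Proof. by move=> s1; rewrite /cross_norm2 !dot_sgmul. Qed.

Lemma lagrange u v : cross_norm2 u v = (u 0 0 * v 0 1 - u 0 1 * v 0 0) ^+ 2 +
  (u 0 0 * v 0 2%:R - u 0 2%:R * v 0 0) ^+ 2 + (u 0 1 * v 0 2%:R - u 0 2%:R * v 0 1) ^+ 2.
Proof. by rewrite /cross_norm2 !dotE; ring. Qed.

Definition reparam (sg : bool) (tau dtau : R -> R) :=
  [/\ forall x : R, is_derive x 1 tau (dtau x), continuous dtau,
      forall x, 0 < (-1) ^+ sg * dtau x, forall y, exists x, tau x = y &
      forall x, tau (x + 1) = tau x + (-1) ^+ sg].

(** Coordinate signs and change of parameter in one operation: it covers the passage to arclength,
    with all signs 1, and the dihedral action. *)
Definition rep s (tau : R -> R) g : R -> 'rV[R]_3 := fun t => sgmul s (g (tau t)).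

Lemma rep_deriv s (tau dtau : R -> R) g (t : R) : derivable g (tau t) 1 ->
  is_derive t 1 tau (dtau t) -> derivable (rep s tau g) t 1 /\
  deriv1 (rep s tau g) t = dtau t *: sgmul s (deriv1 g (tau t)).
Proof.
move=> dg dt; apply: deriv1_coordP => i.
have di := is_derive_coord i dg.
have := is_deriveZ (s i) (is_derive1_comp di dt).
rewrite !mxE mulrCA /GRing.scale/=.
have -> : (s i \*: ((fun x => g x 0 i) \o tau)) = (fun x => rep s tau g x 0 i).
  by apply/funext => x; rewrite mxE.
by rewrite [_ * dtau t]mulrC.
Qed.

Section energies.
Variables (sg : bool) (tau dtau : R -> R) (s : 'I_3 -> R) (g : R -> 'rV[R]_3).
Hypotheses (rt : reparam sg tau dtau) (s1 : forall i, s i ^+ 2 = 1).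
Hypotheses (wg : W22 g) (wr : W22 (rep s tau g)).

Let drep t : deriv1 (rep s tau g) t = dtau t *: sgmul s (deriv1 g (tau t)).
Proof. by have [dt _ _ _ _] := rt; have [_ [dg _]] := wg; have [] := rep_deriv s (dg (tau t)) (dt t). Qed.

Let ed_gt0 t : 0 < `|dtau t|.
Proof.
have [_ _ /(_ t) + _ _] := rt; rewrite normr_gt0; apply: contraTneq => ->.
by rewrite mulr0 ltxx.
Qed.

Lemma length_rep : curve_length (rep s tau g) = curve_length g.
Proof.
have [dt cdt dt0 st tp] := rt.
rewrite /curve_length /Rintegral.
apply: (congr1 fine).
transitivity (\int[mu]_(t in `[0%R, 1%R]) ((enorm (deriv1 g (tau t)))%:E * `|dtau t|%:E))%E.
  by apply: eq_integral => t _; rewrite drep enormZ (enorm_sgmul _ s1) -EFinM mulrC.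
apply: (cov_period dt cdt dt0 st tp (f := fun t => (enorm (deriv1 g t))%:E)).
- by apply/measurable_EFinP/measurable_enorm => i; exact: deriv_measurable.
- by move=> x; rewrite lee_fin enorm_ge0.
- by move=> x; rewrite (deriv1_periodic wg.1).
Qed.

Lemma TPk_rep q t t' : TPk q (rep s tau g) t t' =
  TPk q g (tau t) (tau t') * (`|dtau t| * `|dtau t'|).
Proof.
have alg (x a b c d : R) : x * (a * b) * (c * d) = x * b * d * (a * c) by ring.
rewrite !TPk_tpker !drep /rep -sgmulN -sgmulD /tpker.
set D := g (tau t') - g (tau t).
rewrite -sgmulZ cross_sgmul// !enormZ !sgmulZ !enormZ !enorm_sgmul// dot_sgmul//.
have -> : cross_norm2 (dtau t *: deriv1 g (tau t)) D =
    `|dtau t| ^+ 2 * cross_norm2 (deriv1 g (tau t)) D.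
  by rewrite /cross_norm2 !dotLE real_normK ?num_real//; ring.
rewrite sqrtrM ?sqr_ge0// sqrtr_sqr normr_id.
have -> : 2 * (`|dtau t| * Num.sqrt (cross_norm2 (deriv1 g (tau t)) D)) /
    (`|dtau t| * enorm (deriv1 g (tau t)) * dot D D) =
    2 * Num.sqrt (cross_norm2 (deriv1 g (tau t)) D) / (enorm (deriv1 g (tau t)) * dot D D).
  by rewrite -(mulrA `|dtau t| (enorm _)) mulrCA -mulf_div divff ?mul1r// gt_eqF.
by rewrite alg.
Qed.

Lemma TP_rep q : TP q (rep s tau g) = TP q g.
Proof.
have [dt cdt dt0 st tp] := rt.
rewrite /TP.
apply: (congr1 fine).
have mk := measurable_TPk q wg.
have k0 x y : 0 <= TPk q g x y by exact: TPk_ge0.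
have m1 x : measurable_fun [set: measurableTypeR R] (fun y => (TPk q g x y)%:E).
  apply/measurable_EFinP.
  exact: (measurableT_comp mk (measurable_fun_pair (measurable_cst x) (@measurable_id _ _ _))).
have p1 x y : TPk q g x (y + 1) = TPk q g x y.
  by rewrite /TPk (deriv1_periodic wg.1) wg.1.
have p2 x y : TPk q g (x + 1) y = TPk q g x y.
  by rewrite /TPk (deriv1_periodic wg.1) wg.1.
pose F x := (\int[mu]_(y in `[0%R, 1%R]) (TPk q g x y)%:E)%E.
have F0 x : (0 <= F x)%E by apply: integral_ge0 => y _; rewrite lee_fin.
transitivity (\int[mu]_(x in `[0%R, 1%R]) (F (tau x) * `|dtau x|%:E))%E; last first.
  apply: (cov_period dt cdt dt0 st tp _ F0).
    exact: (measurable_inner mk k0 (measurable_itvR _)).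
  by move=> x; apply: eq_integral => y _; rewrite p2.
apply: eq_integral => x _.
have k0E y : (0 <= (TPk q g (tau x) y)%:E)%E by rewrite lee_fin.
have cE := cov_period dt cdt dt0 st tp (m1 (tau x)) k0E (fun y => congr1 EFin (p1 _ y)).
rewrite /F -[X in (X * _)%E]cE.
rewrite -ge0_integralZr; last 4 first.
- exact: measurable_itvR.
- apply: emeasurable_funM.
    apply: measurable_funTS; apply: (measurableT_comp (m1 (tau x))).
    exact: continuous_measurable_fun (is_derive_continuous dt).
  apply/measurable_EFinP/measurable_fun_normr/measurable_funTS.
  exact: continuous_measurable_fun.
- by move=> y _; apply: mule_ge0; rewrite lee_fin.
- by rewrite lee_fin.
apply: eq_integral => y _.
by rewrite -/(TPk q (rep s tau g) x y) TPk_rep -!EFinM -mulrA [`|dtau y| * _]mulrC.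
Qed.

(* The cross products of [u = s.g'(tau)] with the two second derivatives differ by the
   factor [tau'^2], as is seen by differentiating the vanishing cross product of [u] with
   the new velocity; [tau] itself need not be twice differentiable. *)
Lemma bending_rep : bending (rep s tau g) = bending g.
Proof.
have [dt cdt dt0 st tp] := rt.
have [G [mG pG iG _ aG]] := W22_second wg; have [H sH] := W22_has_second wr.
rewrite (bending_second wg (And3 mG iG aG)) (bending_second wr sH) /Rintegral.
apply: (congr1 fine).
have [mH _ aH] := sH.
have mrow i : measurable_fun [set: measurableTypeR R] (fun t => (\row_i G i t : 'rV[R]_3) 0 i).
  by apply: eq_measurable_fun (mG i) => x _; rewrite mxE.
have mrowH i : measurable_fun [set: measurableTypeR R] (fun t => (\row_i H i t : 'rV[R]_3) 0 i).
  by apply: eq_measurable_fun (mH i) => x _; rewrite mxE.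
have mb h (K : 'I_3 -> R -> R) : W22 h ->
    (forall i, measurable_fun [set: measurableTypeR R] (fun t => (\row_i K i t : 'rV[R]_3) 0 i)) ->
    measurable_fun [set: measurableTypeR R]
      (fun t => (cross_norm2 (deriv1 h t) (\row_i K i t) / enorm (deriv1 h t) ^+ 5)%:E).
  move=> wh mK; apply/measurable_EFinP/measurable_funM.
    by apply: measurable_cross => // i; exact: deriv_measurable.
  apply/measurable_fun_invr/measurable_funX/measurable_enorm => i.
  exact: deriv_measurable.
have b0 (t : R) : (0 <= (cross_norm2 (deriv1 g t) (\row_i G i t) / enorm (deriv1 g t) ^+ 5)%:E)%E.
  by rewrite lee_fin divr_ge0 ?cross_norm2_ge0// exprn_ge0// enorm_ge0.
have bp (t : R) : (cross_norm2 (deriv1 g (t + 1)) (\row_i G i (t + 1)) / enorm (deriv1 g (t + 1)) ^+ 5)%:E =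
    (cross_norm2 (deriv1 g t) (\row_i G i t) / enorm (deriv1 g t) ^+ 5)%:E.
  rewrite (deriv1_periodic wg.1); congr (cross_norm2 _ _ / _)%:E.
  by apply/rowP => i; rewrite !mxE pG.
apply: etrans (cov_period dt cdt dt0 st tp (mb _ _ wg mrow) b0 bp).
apply: ae_eq_integral.
- exact: measurable_itvR.
- by apply: measurable_funTS; exact: mb.
- apply: emeasurable_funM.
    apply: measurable_funTS; apply: (measurableT_comp (mb _ _ wg mrow)).
    exact: continuous_measurable_fun (is_derive_continuous dt).
  apply/measurable_EFinP/measurable_fun_normr/measurable_funTS.
  exact: continuous_measurable_fun.
have aG' := null_preimage dt cdt dt0 st aG.
have aGH := @filterI _ _ (ae_filter_ringOfSetsType mu) _ _ aG' aH.
apply: (@filterS _ _ (ae_filter_ringOfSetsType mu) _ _ _ aGH).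
move=> t [dGt dHt] _; rewrite -EFinM; congr EFin.
set u := deriv1 g (tau t); set U := (\row_i G i (tau t) : 'rV[R]_3).
set V := (\row_i H i t : 'rV[R]_3).
have key i j : (s i * u 0 i) * V 0 j - (s j * u 0 j) * V 0 i =
    (dtau t ^+ 2 * (s i * s j)) * (u 0 i * U 0 j - u 0 j * U 0 i).
  have d1 k : is_derive t 1 (fun x => s k * deriv1 g (tau x) 0 k) (s k * (G k (tau t) * dtau t)).
    exact: (is_deriveZ (s k) (is_derive1_comp (dGt k) (dt t))).
  have h0 (k l : 'I_3) x : deriv1 (rep s tau g) x 0 k * (s l * deriv1 g (tau x) 0 l) =
      dtau x * (s k * deriv1 g (tau x) 0 k) * (s l * deriv1 g (tau x) 0 l).
    by rewrite drep !mxE.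
  have d2 := is_deriveB (is_deriveM (dHt i) (d1 j)) (is_deriveM (dHt j) (d1 i)).
  have e0 : ((fun x => deriv1 (rep s tau g) x 0 i) * (fun x => s j * deriv1 g (tau x) 0 j) -
     (fun x => deriv1 (rep s tau g) x 0 j) * (fun x => s i * deriv1 g (tau x) 0 i)) = cst 0.
    apply/funext => x.
    rewrite -[LHS]/(deriv1 (rep s tau g) x 0 i * (s j * deriv1 g (tau x) 0 j) -
      deriv1 (rep s tau g) x 0 j * (s i * deriv1 g (tau x) 0 i)) !h0.
    by rewrite /cst; ring.
  have := @derive_val _ _ _ _ _ _ _ d2; rewrite e0 derive_cst => /esym.
  rewrite !drep /GRing.scale/= !mxE -/u => E.
  apply/eqP; rewrite -subr_eq0 -oppr_eq0; apply/eqP; rewrite -[RHS]E.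
  by ring.
(* One factor [dtau t] from the new tangent and two from [key], squared; dividing by the fifth power
   of the speed leaves the Jacobian. *)
have -> : cross_norm2 (deriv1 (rep s tau g) t) V = dtau t ^+ 6 * cross_norm2 u U.
  rewrite drep -sgmulZ !lagrange -/u !mxE !(mulrCA (s _) (dtau t)) -!(mulrA (dtau t)) -!mulrBr.
  have := key 0 1; have := key 0 2%:R; have := key 1 2%:R; rewrite !mxE => -> -> ->.
  have ss i j (X : R) : (dtau t * (dtau t ^+ 2 * (s i * s j) * X)) ^+ 2 = dtau t ^+ 6 * X ^+ 2.
    by transitivity (dtau t ^+ 6 * X ^+ 2 * (s i ^+ 2 * s j ^+ 2)); [ring|rewrite !s1 !mulr1].
  by rewrite !ss; ring.
rewrite drep enormZ enorm_sgmul// -/u exprMn.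
have -> : dtau t ^+ 6 = `|dtau t| ^+ 6 by rewrite -normrX ger0_norm// exprn_even_ge0.
rewrite exprSr -(mulrA (`|dtau t| ^+ 5)) -mulf_div divff ?mul1r; last by rewrite expf_neq0// gt_eqF.
by ring.
Qed.

End energies.
End reparametrisation.

(** * Scaling of length and energies *)

Section scaling.
Context {R : realType}.
Local Notation mu := (@lebesgue_measure R).
Implicit Types (g h : R -> 'rV[R]_3) (u v : 'rV[R]_3).

(** An infinite integral stays infinite after scaling and [fine] sends both sides to 0, so the
    identity holds beyond the integrable case. *)
Lemma ge0_RintegralZ d (T : measurableType d) (nu : {measure set T -> \bar R})
    (D : set T) (f : T -> R) (c : R) : 0 < c -> measurable D -> measurable_fun D f ->
  (forall x, 0 <= f x) -> Rintegral nu D (fun x => c * f x) = c * Rintegral nu D f.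
Proof.
move=> c0 mD mf f0; rewrite /Rintegral.
under eq_integral do rewrite EFinM.
rewrite ge0_integralZl_EFin ?(ltW c0)//; last 2 first.
- by move=> x _; rewrite lee_fin.
- exact/measurable_EFinP.
case: (integral _ _ _) => [r//| |] /=; first by rewrite gt0_muley ?lte_fin// mulr0.
by rewrite gt0_muleNy ?lte_fin// mulr0.
Qed.

Lemma length_scale (c : R) g : 0 < c -> W22 g ->
  curve_length (fun t => c *: g t) = c * curve_length g.
Proof.
move=> c0 wg; rewrite /curve_length -ge0_RintegralZ//.
- congr Rintegral; apply/funext => t; have [_ ->] := deriv1Z c (wg.2.1 t).
  by rewrite enormZ gtr0_norm.
- by apply: measurable_enorm => i; apply: measurable_funTS; exact: deriv_measurable.
- by move=> t; exact: enorm_ge0.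
Qed.

Lemma bending_scale (c : R) g : 0 < c -> W22 g ->
  bending (fun t => c *: g t) = c^-1 * bending g.
Proof.
move=> c0 wg; have [G sG] := W22_has_second wg.
rewrite (bending_second wg sG) (bending_second (W22Z c wg) (second_scale c wg sG)).
rewrite -ge0_RintegralZ ?invr_gt0//.
- congr Rintegral; apply/funext => t.
  have [_ ->] := deriv1Z c (wg.2.1 t); rewrite enormZ gtr0_norm//.
  have -> : (\row_i (c * G i t) : 'rV[R]_3) = c *: (\row_i G i t).
    by apply/rowP => i; rewrite !mxE.
  have -> u v : cross_norm2 (c *: u) (c *: v) = c ^+ 4 * cross_norm2 u v.
    by rewrite /cross_norm2 !dotLE; ring.
  rewrite exprMn -mulf_div; congr (_ * _).
  by rewrite [c ^+ 5]exprS invfM mulrCA divff ?mulr1// expf_neq0// gt_eqF.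
- have [mG _ _] := sG; apply: measurable_funM.
    apply: measurable_cross => i; apply: measurable_funTS; first exact: deriv_measurable.
    by under eq_fun do rewrite mxE; exact: mG.
  apply: measurable_fun_invr; apply: measurable_funX; apply: measurable_enorm => i.
  by apply: measurable_funTS; exact: deriv_measurable.
- by move=> t; rewrite divr_ge0 ?cross_norm2_ge0// exprn_ge0// enorm_ge0.
Qed.

Lemma TP_scale (c : R) q g : 0 < c -> W22 g ->
  TP q (fun t => c *: g t) = powR c (2 - q) * TP q g.
Proof.
have alg (x a b d e : R) : a * x * (b * d) * (b * e) = b ^+ 2 * a * (x * d * e) by ring.
move=> c0 wg; have ce := lt0r_neq0 c0; rewrite !TP_prod//; last exact: W22Z.
rewrite -ge0_RintegralZ ?powR_gt0//.
- congr Rintegral; apply/funext => -[s t] /=; rewrite !TPk_tpker.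
  have [_ ->] := deriv1Z c (wg.2.1 s); have [_ ->] := deriv1Z c (wg.2.1 t).
  rewrite -scalerBr /tpker !enormZ gtr0_norm//.
  set u := deriv1 g s; set D := g t - g s.
  have -> : cross_norm2 (c *: u) (c *: D) = (c ^+ 2) ^+ 2 * cross_norm2 u D.
    by rewrite /cross_norm2 !dotLE; ring.
  rewrite sqrtrM ?sqr_ge0// sqrtr_sqr ger0_norm ?sqr_ge0// dotZl dotZr.
  have -> : 2 * (c ^+ 2 * Num.sqrt (cross_norm2 u D)) / (c * enorm u * (c * (c * dot D D))) =
      c^-1 * (2 * Num.sqrt (cross_norm2 u D) / (enorm u * dot D D)).
    rewrite mulrCA (_ : c * enorm u * (c * (c * dot D D)) = c ^+ 3 * (enorm u * dot D D)); last by ring.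
    rewrite -mulf_div; congr (_ * _).
    by rewrite [c ^+ 3]exprS invfM mulrCA divff ?mulr1// expf_neq0.
  rewrite powRM; last 2 first.
  - by rewrite invr_ge0 ltW.
  - by rewrite divr_ge0 ?mulr_ge0 ?sqrtr_ge0 ?enorm_ge0 ?dot_ge0.
  rewrite -powR_inv1 ?ltW// -powRrM mulN1r.
  have -> : powR c (2 - q) = c ^+ 2 * powR c (- q).
    by rewrite powRD ?ce ?implybT// powR_mulrn// ltW.
  by rewrite alg.
- by apply: measurableX; exact: measurable_itvR.
- by apply: measurable_funTS; exact: measurable_TPk.
- by move=> z; exact: TPk_ge0.
Qed.

(** The root [1 / (q - 2)] turns the scaling weight [2 - q] of [TP] into the weight -1 of the
    bending energy. *)
Lemma Etheta_scale (c : R) q theta g : 0 < c -> 2 < q -> W22 g ->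
  Etheta q theta (fun t => c *: g t) = c^-1 * Etheta q theta g.
Proof.
move=> c0 q2 wg; rewrite /Etheta bending_scale// TP_scale//.
rewrite powRM ?powR_ge0//; last first.
  by apply: fine_ge0; apply: integral_ge0 => s _; apply: integral_ge0 => t _; rewrite lee_fin TPk_ge0.
rewrite -powRrM (_ : (2 - q) * (1 / (q - 2)) = -1); last first.
  by field; rewrite subr_eq0 gt_eqF.
by rewrite powR_inv1 ?(ltW c0)// mulrDr mulrCA.
Qed.

End scaling.

(** * Arclength parametrisation and the dihedral action *)

Section arclength.
Context {R : realType}.
Local Notation mu := (@lebesgue_measure R).
Implicit Types g : R -> 'rV[R]_3.

Lemma continuous_itv_integrable (v : R -> R) (a b : R) : continuous v ->
  mu.-integrable `[a, b] (EFin \o v).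
Proof.
move=> cv; apply: continuous_compact_integrable; first exact: segment_compact.
exact: continuous_subspaceT.
Qed.

Lemma continuous_primitive (v : R -> R) : continuous v ->
  exists V : R -> R, forall x : R, is_derive x 1 V (v x).
Proof.
move=> cv; have vi a b := continuous_itv_integrable a b cv.
have [V hV] := signed_primitive vi; exists V => x.
have x1 : x < x + 1 by lra.
have x2 : x - 1 < x by lra.
have [dF eF] := continuous_FTC1_closed x1 (vi (x - 1) (x + 1)) x2 (cv x).
set F := (fun y : R => Rintegral mu [set` `[x - 1, y]] v) in dF eF.
have eqn : \forall y \near x, F y = V y - V (x - 1).
  have : x \in `]x - 1, x + 1[ by rewrite in_itv/= x1 x2.
  move=> /near_in_itvoo; apply: filterS => y; rewrite in_itv/= => /andP[ay yb].
  by rewrite hV// ltW.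
have dFx : is_derive x 1 F (v x) by split; [exact: dF|rewrite -derive1E eF].
have dfa : is_derive x 1 (fun y => V y - V (x - 1)) (v x) by exact: near_eq_is_derive dFx.
have -> : V = (fun y => (V y - V (x - 1)) + V (x - 1)) by apply/funext => y; rewrite subrK.
by apply: is_derive_eq; rewrite addr0.
Qed.

(** [sg x - x] is periodic, hence bounded, so [sg] reaches every value; its positive derivative
    makes it injective and its inverse differentiable. *)
Lemma diffeo_inverse (sg dsg : R -> R) : (forall x : R, is_derive x 1 sg (dsg x)) ->
  continuous dsg -> (forall x, 0 < dsg x) -> (forall x, sg (x + 1) = sg x + 1) ->
  exists tau : R -> R, [/\ cancel sg tau, cancel tau sg &
    reparam false tau (fun y => (dsg (tau y))^-1)].
Proof.
move=> ds cds ds0 s1; have mono := gt0_derive_mono ds ds0.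
have inj : injective sg by exact: inc_inj.
have cs := is_derive_continuous ds.
have bd x : `|sg x - x| <= `|sg 0| + 1.
  have fp t : sg (t + 1) - (t + 1) = sg t - t by rewrite s1; lra.
  rewrite (periodic_red x fp); have /andP[u0 u1] := frac_itv x.
  move: (x - _) u0 u1 => u u0 u1.
  have := s1 0; rewrite add0r => e; have := mono 0 u; have := mono u 1; rewrite e u0 (ltW u1).
  move=> h1 h2; have := ler_norm (sg 0); have := ler_norm (- sg 0); rewrite normrN => h3 h4.
  rewrite ler_norml; lra.
have surj y : exists x, sg x = y.
  pose K := `|sg 0| + 1.
  have [h1 h2] := (bd (y - K), bd (y + K)).
  have K0 : 0 <= K by rewrite addr_ge0.
  have ab : y - K <= y + K by lra.
  move: h1 h2; rewrite -/K !ler_norml => h1 h2.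
  have [|x _ <-] := @IVT _ sg _ _ y ab (continuous_subspaceT cs); last by exists x.
  have mm : sg (y - K) <= sg (y + K) by rewrite mono.
  by rewrite (min_idPl mm) (max_idPr mm); lra.
have [tau tauK] := choice surj.
have sK : cancel sg tau by move=> x; apply: inj; rewrite tauK.
exists tau; split => //; have dtau (y : R) : is_derive y 1 tau (dsg (tau y))^-1.
  rewrite -{1}(tauK y); apply: is_derive_inverse (ds _) _; last by rewrite gt_eqF.
  - by apply: (@filterE _ (nbhs (tau y))) => x; rewrite sK.
  - by apply: (@filterE _ (nbhs (tau y))) => x; exact: cs.
split => //.
- move=> y; apply: continuousV; first by rewrite gt_eqF.
  apply: (@continuous_comp _ _ _ tau dsg); last exact: cds.
  exact: (is_derive_continuous dtau).
- by move=> x; rewrite expr0 mul1r invr_gt0.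
- by move=> x; exists (sg x).
- by move=> x; apply: inj; rewrite expr0 s1 !tauK.
Qed.

Lemma enorm_rev_norm (u v : 'rV[R]_3) : `|enorm u - enorm v| <= enorm (u - v).
Proof.
have := enorm_rev u (v - u); have := enorm_rev v (u - v).
rewrite !subrKC (enorm_distC v u) ler_norml; lra.
Qed.

(** Normalisation is Lipschitz away from the origin, which lets the unit tangent inherit the
    increment control of [deriv1 g]. *)
Lemma normalise_lipschitz (m : R) (u v : 'rV[R]_3) : 0 < m -> m <= enorm u -> m <= enorm v ->
  enorm ((enorm u)^-1 *: u - (enorm v)^-1 *: v) <= 2 / m * enorm (u - v).
Proof.
move=> m0 mu1 mv1.
have [u0 v0] : 0 < enorm u /\ 0 < enorm v by split; apply: lt_le_trans m0 _.
have -> : (enorm u)^-1 *: u - (enorm v)^-1 *: v =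
    (enorm u)^-1 *: ((u - v) + ((enorm v - enorm u) / enorm v) *: v).
  by apply/rowP => i; rewrite !mxE; field; rewrite !gt_eqF.
rewrite enormZ gtr0_norm ?invr_gt0// mulrAC mulrC.
apply: ler_pM; rewrite ?invr_ge0 ?enorm_ge0 ?(ltW u0)//.
  apply: le_trans (enormD _ _) _; rewrite enormZ normrM normfV (gtr0_norm v0) mulfVK ?gt_eqF//.
  have := enorm_rev_norm v u; rewrite enorm_distC; lra.
by rewrite lef_pV2.
Qed.

Lemma W22_speed_continuous g : W22 g -> continuous (fun t => enorm (deriv1 g t)).
Proof.
move=> wg t; apply: (@continuous_comp _ _ _ (fun t => dot (deriv1 g t) (deriv1 g t)) Num.sqrt).
  have -> : (fun t => dot (deriv1 g t) (deriv1 g t)) =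
    (fun t => deriv1 g t 0 0 * deriv1 g t 0 0 + deriv1 g t 0 1 * deriv1 g t 0 1 + deriv1 g t 0 2%:R * deriv1 g t 0 2%:R).
    by apply/funext => x; rewrite dotE.
  have c i := @W22_continuous R g i wg t.
  by apply: cvgD; [apply: cvgD|]; apply: cvgM; exact: c.
exact: sqrt_continuous.
Qed.

Lemma periodic_min (v : R -> R) : continuous v -> (forall t, v (t + 1) = v t) ->
  exists x, forall t, v x <= v t.
Proof.
move=> cv pv; have [x _ hx] := @EVT_min R v 0 1 ler01 (continuous_subspaceT cv).
exists x => t; rewrite (periodic_red t pv) hx//.
by have /andP[u0 /ltW u1] := frac_itv t; rewrite in_itv/= u0 u1.
Qed.

Lemma is_derive_affine (f df : R -> R) (a b x : R) :
  is_derive (a * x + b) 1 f (df (a * x + b)) ->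
  is_derive x 1 (fun x => f (a * x + b)) (a * df (a * x + b)).
Proof.
move=> hf; have da : is_derive x 1 (fun x : R => a * x + b) a.
  by apply: is_derive_eq; rewrite addr0 /GRing.scale/= mulr1.
have := @is_derive1_comp R f (fun x : R => a * x + b) x _ _ hf da; rewrite mulrC; exact.
Qed.

Definition d2s (j i : 'I_3) : R := if i == j then 1 else -1.
Definition d2off (j : 'I_3) : R := if j == 0 then 1 / 2 else if j == 1 then - (1 / 2) else 0.
(** [j] indexes the three half-turns by their axis; only [j = 1], the translation by half a period,
    preserves the orientation of the parameter. *)
Definition d2psi (j : 'I_3) (t : R) : R := (-1) ^+ (j != 1) * t + d2off j.
Definition d2act (j : 'I_3) g := rep (d2s j) (d2psi j) g.

Lemma d2s_sqr j i : d2s j i ^+ 2 = 1.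
Proof. by rewrite /d2s; case: ifP => _; rewrite ?expr1n ?sqrrN ?expr1n. Qed.

Lemma d2psi_reparam j : reparam (j != 1) (d2psi j) (fun=> (-1) ^+ (j != 1)).
Proof.
split.
- by move=> x; apply: is_derive_eq; rewrite addr0 /GRing.scale/= mulr1.
- by move=> x; exact: cvg_cst.
- by move=> x; rewrite -exprD -signr_odd oddD addbb expr0 ltr01.
- move=> y; exists ((-1) ^+ (j != 1) * (y - d2off j)).
  by rewrite /d2psi mulrA -exprD -signr_odd oddD addbb expr0 mul1r subrK.
- by move=> x; rewrite /d2psi mulrDr mulr1 addrAC.
Qed.

Lemma D2symP g : D2sym g <-> forall j, d2act j g = g.
Proof.
have rE (j : 'I_3) v : rotax j v = sgmul (d2s j) v.
  by apply/rowP => i; rewrite !mxE /d2s -val_eqE; case: ifP => _; rewrite ?mul1r ?mulN1r.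
have p0 t : d2psi 0 t = - t + 1 / 2 by rewrite /d2psi /d2off/= expr1 mulN1r.
have p1 t : d2psi 1 t = t - 1 / 2 by rewrite /d2psi /d2off/= expr0 mul1r.
have p2 t : d2psi 2%:R t = - t by rewrite /d2psi /d2off/= expr1 mulN1r addr0.
split=> [sg j|h t].
  apply/funext => t; have [s0 [s1 s2]] := sg t; rewrite /d2act /rep.
  have [->|[->|->]] : j = 0 \/ j = 1 \/ j = 2%:R.
    case: j => [[|[|[|//]]]] p; [left|right; left|right; right]; exact: val_inj.
  - by rewrite p0 -rE.
  - by rewrite p1 -rE.
  - by rewrite p2 -rE.
have e j : g t = sgmul (d2s j) (g (d2psi j t)) by rewrite -{1}(h j).
split; [|split]; [rewrite {1}(e 0) p0|rewrite {1}(e 1) p1|rewrite {1}(e 2%:R) p2]; by rewrite -rE.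
Qed.

Lemma d2_speed g j t : (forall t, derivable g t 1) -> d2act j g = g ->
  enorm (deriv1 g (d2psi j t)) = enorm (deriv1 g t).
Proof.
move=> dg gj; have [dp _ _ _ _] := d2psi_reparam j.
have [_ e] := rep_deriv (d2s j) (dg (d2psi j t)) (dp t).
rewrite -{2}gj e enormZ enorm_sgmul; last exact: d2s_sqr.
by rewrite normrX normrN1 expr1n mul1r.
Qed.

Lemma arclength_reparam g : W22 g -> curve_length g = 1 ->
  (forall t, 0 < enorm (deriv1 g t)) ->
  exists tau dtau : R -> R, [/\ reparam false tau dtau, {mono tau : x y / x <= y},
    W22 (fun t => g (tau t)), forall t, enorm (deriv1 (fun t => g (tau t)) t) = 1 &
    D2sym g -> D2sym (fun t => g (tau t))].
Proof.
move=> wg l1 v0; pose v t := enorm (deriv1 g t).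
have cv : continuous v by exact: W22_speed_continuous.
have pv t : v (t + 1) = v t by rewrite /v deriv1_periodic//; case: wg.
have [V dV] := continuous_primitive cv.
pose sg t := V t - V 0.
have dsg (x : R) : is_derive x 1 sg (v x).
  by have d := dV x; apply: is_derive_eq; rewrite subr0.
have sg0 : sg 0 = 0 by rewrite /sg subrr.
have sg1 : sg 1 = 1.
  have e := continuous_FTC2_cc ler01 dV cv.
  by rewrite -[RHS]l1 /curve_length /Rintegral e.
(* Both sides have the same derivative and agree at 0. *)
have aff (a b : R) : (forall x, v (a * x + b) = v x) ->
    forall x, sg (a * x + b) = a * sg x + sg b.
  move=> hv x; pose f x := sg (a * x + b) - a * sg x.
  have df (y : R) : is_derive y 1 f 0.
    have d1 := is_derive_affine (dsg (a * y + b)).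
    have d2 := dsg y.
    by apply: is_derive_eq; rewrite hv /GRing.scale/= subrr.
  have := is_derive_0_is_cst x 0 df; rewrite /f sg0 !mulr0 add0r subr0 => <-.
  by rewrite addrCA subrr addr0.
have sgp x : sg (x + 1) = sg x + 1.
  have h y : v (1 * y + 1) = v y by rewrite mul1r.
  by have := aff 1 1 h x; rewrite !mul1r sg1.
have [tau [sK tK rt]] := diffeo_inverse dsg cv v0 sgp.
have [dt cdt dt0 _ tp] := rt.
have dt0' x : 0 < (v (tau x))^-1 by have := dt0 x; rewrite expr0 mul1r.
exists tau, (fun y => (v (tau y))^-1).
have mono := gt0_derive_mono dt dt0'.
have [xm hm] := periodic_min cv pv; have m0 : 0 < v xm by exact: v0.
have vm x : (v (tau x))^-1 <= (v xm)^-1.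
  by rewrite lef_pV2 ?posrE; [exact: hm|exact: v0|exact: v0].
pose G t := g (tau t).
have GE : G = rep (fun=> 1) tau g.
  by apply/funext => t; apply/rowP => i; rewrite /rep !mxE mul1r.
have dG t : derivable G t 1 /\ deriv1 G t = (v (tau t))^-1 *: deriv1 g (tau t).
  have := @rep_deriv R (fun=> 1) tau (fun y => (v (tau y))^-1) g t (wg.2.1 (tau t)) (dt t); rewrite -GE => -[d ->]; split => //.
  by congr (_ *: _); apply/rowP => i; rewrite !mxE mul1r.
split; [exact: rt|exact: mono| | |].
- apply: W22I.
  + by move=> t; rewrite tp expr0 wg.1.
  + by move=> t; have [] := dG t.
  + move=> i; apply: (@H1_lip R _ (fun i t => deriv1 g t 0 i) (2 / v xm) (v xm)^-1 tau).
    * by rewrite divr_ge0// ltW.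
    * by rewrite invr_ge0 ltW.
    * by move=> x y; rewrite mono.
    * move=> s t st; have [xi _ ->] := MVT_signed s t dt.
      by apply: ler_wpM2r; [rewrite subr_ge0|exact: vm].
    * by move=> j; exact: W22_H1.
    * move=> s t st; rewrite -/G !(dG _).2.
      have h := @normalise_lipschitz _ (deriv1 g (tau t)) (deriv1 g (tau s)) m0 (hm _) (hm _).
      have h2 := enorm_coord ((v (tau t))^-1 *: deriv1 g (tau t) - (v (tau s))^-1 *: deriv1 g (tau s)) i.
      rewrite !mxE in h2 *; apply: le_trans h2 _; apply: le_trans h _.
      rewrite ler_wpM2l ?divr_ge0 ?(ltW m0)//; apply: le_trans (enorm_le_sum _) _.
      by rewrite !sum3 !mxE.
- move=> t; have vt0 : 0 < v (tau t) := v0 (tau t).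
  by rewrite -/G (dG t).2 enormZ (gtr0_norm (dt0' t)) -/(v (tau t)) (mulVf (lt0r_neq0 vt0)).
- move=> /D2symP sym; apply/D2symP => j.
  (* The half-period symmetry splits the unit length evenly: the arclength at [1 / 2] is [1 / 2]. *)
  have off : sg (d2off j) = d2off j.
    have hf i t : v ((-1) ^+ (i != 1) * t + d2off i) = v t by exact: d2_speed wg.2.1 (sym i).
    have h1 x : sg (x - 1 / 2) = sg x + sg (- (1 / 2)).
      by have := aff _ _ (hf 1) x; rewrite /d2off/= expr0 !mul1r.
    have e1 := h1 1; have e2 := h1 (1 / 2).
    rewrite subrr sg0 in e2; rewrite sg1 (_ : 1 - 1 / 2 = 1 / 2) in e1; last by field.
    by rewrite /d2off; case: ifP => _; [|case: ifP => _]; lra.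
  apply/funext => t; rewrite /d2act /rep.
  have -> : tau (d2psi j t) = d2psi j (tau t).
    apply: (can_inj tK); rewrite -[in RHS](sK (d2psi j (tau t))) /d2psi.
    rewrite aff; last by move=> x; exact: d2_speed wg.2.1 (sym j).
    by rewrite off tK.
  by have := congr1 (fun f => f (tau t)) (sym j).
Qed.

End arclength.

(** * Unit-speed curves of bounded bending energy *)

Section arclength_curves.
Context {R : realType}.
Local Notation mu := (@lebesgue_measure R).
Implicit Types (g h : R -> 'rV[R]_3) (Psi : 'I_3 -> R -> R).
Local Notation I01 := (`[0%R, 1%R] : set (measurableTypeR R))%classic.

Definition arc g := W22 g /\ forall t, enorm (deriv1 g t) = 1.

(* [Psi i] dominates the energy distribution of the [i]th tangent coordinate; this form of a
   bound on the bending energy is stable under pointwise limits. *)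
Definition tension g Psi (B : R) :=
  [/\ forall i, {homo Psi i : x y / x <= y},
      forall i x, Psi i (x + 1) = Psi i x + Psi i 1,
      forall i s t, s <= t ->
        (deriv1 g t 0 i - deriv1 g s 0 i) ^+ 2 <= (t - s) * (Psi i t - Psi i s),
      forall i, Psi i 0 = 0 & \sum_i Psi i 1 <= B].

Lemma arc_orthogonal g (w : 'rV[R]_3) (t : R) : arc g ->
  (forall i, is_derive t 1 (fun x => deriv1 g x 0 i) (w 0 i)) -> dot (deriv1 g t) w = 0.
Proof.
move=> [_ g1] dw.
have h : is_derive t 1 (fun x => dot (deriv1 g x) (deriv1 g x)) (2 * dot (deriv1 g t) w).
  have -> : (fun x => dot (deriv1 g x) (deriv1 g x)) =
    (fun t => deriv1 g t 0 0 * deriv1 g t 0 0 + deriv1 g t 0 1 * deriv1 g t 0 1 + deriv1 g t 0 2%:R * deriv1 g t 0 2%:R).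
    by apply/funext => x; rewrite dotE.
  have d0 := dw 0; have d1 := dw 1; have d2 := dw 2%:R.
  by apply: is_derive_eq; rewrite dotE /GRing.scale/=; ring.
have h2 : is_derive t 1 (fun x => dot (deriv1 g x) (deriv1 g x)) 0.
  have -> : (fun x => dot (deriv1 g x) (deriv1 g x)) = cst 1.
    by apply/funext => x; rewrite -enorm_dot g1 expr1n.
  exact: is_derive_cst.
have [_ e1] := h; have [_ e2] := h2.
by apply/eqP; rewrite -(@mulrI_eq0 _ 2 _ _) -?e1 ?e2//; exact/lregP.
Qed.

Lemma sqr_row3 (G : 'I_3 -> R -> R) t :
  dot (\row_i G i t) (\row_i G i t) = \sum_i G i t ^+ 2.
Proof. by apply: eq_bigr => i _; rewrite !mxE expr2. Qed.

Lemma Rintegral_sum3 (F : 'I_3 -> R -> R) :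
  (forall i, mu.-integrable I01 (EFin \o F i)) ->
  Rintegral mu I01 (fun t => \sum_i F i t) = \sum_i Rintegral mu I01 (F i).
Proof.
move=> iF; rewrite sum3.
under eq_Rintegral do rewrite sum3.
rewrite RintegralD//; first by congr (_ + _); rewrite RintegralD//; exact: measurable_itvR.
by apply: (integrable_rD (measurable_itvR _)).
Qed.

(** At unit speed the second derivative is orthogonal to the tangent, so the squared area is its
    squared length. *)
Lemma arc_bending g G : arc g -> second g G ->
  bending g = \sum_i Rintegral mu I01 (fun t => G i t ^+ 2).
Proof.
move=> ag sG; have [wg g1] := ag; have [mG iG aG] := sG.
rewrite (bending_second wg sG) -Rintegral_sum3; last first.
  by move=> i; exact: (square_integrable_itv (mG i) (iG i _ _)).2.
rewrite /Rintegral; congr fine; apply: ge0_integral_ae_eq_nonmeas.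
- exact: measurable_itvR.
- by move=> t; rewrite lee_fin g1 expr1n divr1 cross_norm2_ge0.
- by move=> t; rewrite lee_fin sumr_ge0// => i _; exact: sqr_ge0.
- apply/measurable_EFinP; apply: measurable_funTS; under eq_fun do rewrite sum3.
  by apply: measurable_funD; [apply: measurable_funD|]; apply: measurable_funX; exact: mG.
- apply: filterS aG; first exact: (ae_filter_ringOfSetsType mu).
  move=> x h _; rewrite g1 expr1n divr1 /cross_norm2 -enorm_dot g1 expr1n mul1r sqr_row3.
  rewrite (_ : dot (deriv1 g x) _ = 0); last by apply: (arc_orthogonal ag) => i; rewrite mxE.
  by rewrite expr0n/= subr0.
Qed.

Lemma arc_tension g : arc g -> exists Psi, tension g Psi (bending g).
Proof.
move=> ag; have [wg _] := ag; have [G [mG pG iG FTC aG]] := W22_second wg.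
have li i a b := square_integrable_itv (mG i) (iG i a b).
have /choice[P hP] i := signed_primitive (fun a b => (li i a b).2).
have sq0 i z : 0 <= G i z ^+ 2 by exact: sqr_ge0.
exists (fun i t => P i t - P i 0); split.
- move=> i x y xy; rewrite -subr_ge0 (_ : _ - _ = P i y - P i x); last by ring.
  by rewrite hP//; apply: Rintegral_ge0.
- move=> i x; have x1 : x <= x + 1 by rewrite lerDl.
  have := hP i _ _ x1; rewrite (hP i 0 1)// => e.
  have <- : P i (x + 1) - P i x = Rintegral mu `[0, 1] (fun z => G i z ^+ 2); last by ring.
  rewrite e /Rintegral; congr fine; apply: (ge0_integral_period (f := fun z => (G i z ^+ 2)%:E)).
  + by apply/measurable_EFinP; apply: measurable_funX; exact: mG.
  + by move=> z; rewrite lee_fin.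
  + by move=> z; rewrite pG.
- move=> i s t st; rewrite FTC// (_ : P i t - P i 0 - _ = P i t - P i s); last by ring.
  by rewrite hP//; exact: cauchy_schwarz_itv (li i _ _).1 (li i _ _).2.
- by move=> i; rewrite subrr.
- by rewrite (arc_bending ag (And3 mG iG aG)); apply: ler_sum => i _; rewrite hP.
Qed.

Lemma ae_neq (a : R) : {ae mu, forall x : R, x != a}.
Proof.
exists [set a]; split; [exact: measurable_set1|exact: lebesgue_measure_set1|].
by move=> x /= /negP; rewrite negbK => /eqP.
Qed.

(** Riesz's criterion bounds the square integral of the second derivative by the total increase of
    [Psi]; applied to a limit of tensions, this is lower semicontinuity of the bending energy. *)
Lemma tension_bending g Psi B : arc g -> tension g Psi B -> bending g <= B.
Proof.
move=> ag [nd per ctl P0 hB]; apply: le_trans hB; have [wg _] := ag.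
have [G [mG pG iG FTC aG]] := W22_second wg.
rewrite (arc_bending ag (And3 mG iG aG)); apply: ler_sum => i _.
have li := square_integrable_itv (mG i) (iG i 0 1).
have qv n : qvar (fun t => deriv1 g t 0 i) 0 1 n <= Psi i 1.
  by have := H1_qvar n ltr01 (ctl i); rewrite P0 subr0.
have [h [mh ih hE h2]] := riesz_H1 ltr01 (@W22_continuous _ _ i wg) qv.
have ae0 := ae_neq 0; have ae1 := ae_neq 1.
have aeh := ae_derive_primitive ltr01 ih hE.
have aeq : {ae mu, forall x : R, I01 x -> (G i x ^+ 2)%:E = (h x ^+ 2)%:E}.
  have FF := ae_filter_ringOfSetsType mu.
  have a1 := @filterI _ _ FF _ _ ae0 ae1; have a2 := @filterI _ _ FF _ _ aeh aG.
  apply: (@filterS _ _ FF _ _ _ (@filterI _ _ FF _ _ a1 a2)) => x [[x0 x1] [dh dG]]; rewrite /= in_itv/= => /andP[le0 le1].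
  have [|_ eh] := dh; first by rewrite !lt_def x0 le0 le1 eq_sym x1.
  by have [_ eG] := dG i; rewrite -eh -eG.
rewrite /Rintegral (ge0_integral_ae_eq_nonmeas (measurable_itvR _) _ _ _ aeq).
- rewrite -lee_fin fineK// ge0_fin_numE; first exact: le_lt_trans h2 (ltry _).
  by apply: integral_ge0 => x _; rewrite lee_fin sqr_ge0.
- by move=> x; rewrite lee_fin sqr_ge0.
- by move=> x; rewrite lee_fin sqr_ge0.
- by apply/measurable_EFinP; apply: measurable_funTS; exact: measurable_funX.
Qed.

Lemma tension_le g Psi B B' : B <= B' -> tension g Psi B -> tension g Psi B'.
Proof. by move=> BB [nd per ctl P0 hB]; split => //; exact: le_trans hB BB. Qed.

Lemma tension_holder g Psi B s t : tension g Psi B -> s <= t <= s + 1 ->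
  enorm (deriv1 g t - deriv1 g s) ^+ 2 <= (t - s) * B.
Proof.
move=> [nd per ctl P0 hB] /andP[st ts].
apply: (@le_trans _ _ ((t - s) * \sum_i Psi i 1)); last by rewrite ler_wpM2l ?subr_ge0.
rewrite enorm_sqr mulr_sumr.
apply: ler_sum => i _; rewrite !mxE; apply: (le_trans (ctl i s t st)).
apply: ler_wpM2l; first by rewrite subr_ge0.
by have := nd i _ _ ts; rewrite per; lra.
Qed.

Lemma tension_ge0 g Psi B : tension g Psi B -> 0 <= B.
Proof.
move=> [nd per ctl P0 hB]; apply: le_trans hB; apply: sumr_ge0 => i _; rewrite -(P0 i).
by apply: nd.
Qed.

Lemma tension_holder_abs g Psi B s t : tension g Psi B -> `|t - s| <= 1 ->
  enorm (deriv1 g t - deriv1 g s) ^+ 2 <= `|t - s| * B.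
Proof.
move=> tg; have [st|ts] := leP s t => h.
  by rewrite ger0_norm ?subr_ge0//; apply: tension_holder tg _; rewrite st; move: h; rewrite ler_norml; lra.
rewrite distrC enorm_distC gtr0_norm ?subr_gt0//; apply: tension_holder tg _.
by rewrite (ltW ts); move: h; rewrite ler_norml; lra.
Qed.

Lemma is_derive_dot g (w : 'rV[R]_3) (t : R) : derivable g t 1 ->
  is_derive t 1 (fun x => dot (g x) w) (dot (deriv1 g t) w).
Proof.
move=> dg; have d0 := is_derive_coord 0 dg; have d1 := is_derive_coord 1 dg.
have d2 := is_derive_coord 2%:R dg.
have -> : (fun x => dot (g x) w) =
    (fun x => w 0 0 * g x 0 0 + w 0 1 * g x 0 1 + w 0 2%:R * g x 0 2%:R).
  by apply/funext => x; rewrite dotE; ring.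
by apply: is_derive_eq; rewrite dotE /GRing.scale/=; ring.
Qed.

Lemma enorm_sub_unit (u v : 'rV[R]_3) : enorm u = 1 -> enorm v = 1 ->
  enorm (u - v) ^+ 2 = 2 - 2 * dot u v.
Proof.
move=> u1 v1; rewrite enorm_dot !dotLE -!enorm_dot u1 v1 (dotC v u); ring.
Qed.

(** Under these bounds the tangent moves by at most 1, so its component along the initial direction
    stays at least [1 / 2]. *)
Lemma arc_local_bilip g Psi B s t : arc g -> tension g Psi B ->
  `|t - s| <= 1 -> `|t - s| * B <= 1 -> `|t - s| / 2 <= enorm (g t - g s).
Proof.
move=> [wg g1] tg d1 dB.
have dd x := is_derive_dot (deriv1 g s) (wg.2.1 x).
have [xi hxi E] := MVT_signed s t dd.
have h : 1 / 2 <= dot (deriv1 g xi) (deriv1 g s).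
  have xs : `|xi - s| <= `|t - s|.
    case/orP: hxi => /andP[a b].
      by rewrite !ger0_norm ?subr_ge0 ?lerD2r// (le_trans a b).
    by rewrite !(distrC _ s) !ger0_norm ?subr_ge0 ?lerB// (le_trans a b).
  have := tension_holder_abs tg (le_trans xs d1).
  rewrite enorm_sub_unit// => hh.
  have : `|xi - s| * B <= 1 by apply: le_trans (ler_wpM2r (tension_ge0 tg) xs) dB.
  lra.
have := cauchy_dot (g t - g s) (deriv1 g s); rewrite g1 mulr1 => hc; apply: le_trans hc.
have e : dot (g t - g s) (deriv1 g s) = dot (g t) (deriv1 g s) - dot (g s) (deriv1 g s).
  by rewrite !dotLE.
rewrite e E normrM mulrC ler_wpM2r//; apply: le_trans (ler_norm _); lra.
Qed.

Lemma arc_lipschitz g s t : arc g -> enorm (g t - g s) <= 3 * `|t - s|.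
Proof.
move=> [wg g1]; have h x : enorm (deriv1 g x) <= 1 by rewrite g1.
by have := curve_lipschitz wg.2.1 h s t; rewrite mulr1.
Qed.

Lemma dot_dist_continuous g : arc g ->
  continuous (fun z : R * R => dot (g (z.1 + z.2) - g z.1) (g (z.1 + z.2) - g z.1)).
Proof.
move=> ag z.
have cg (i : 'I_3) : continuous (fun x : R => g x 0 i).
  exact: is_derive_continuous (fun x => is_derive_coord i (ag.1.2.1 x)).
pose F i (z : R * R) := g (z.1 + z.2) 0 i - g z.1 0 i.
have c1 i : {for z, continuous (F i)}.
  apply: (@cvgB _ R^o).
    apply: (@continuous_comp _ _ _ (fun z : R * R => z.1 + z.2) (fun x : R => g x 0 i)); last exact: cg.
    by apply: (@cvgD _ R^o); [exact: cvg_fst|exact: cvg_snd].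
  by apply: (@continuous_comp _ _ _ (fun z : R * R => z.1) (fun x : R => g x 0 i)); [exact: cvg_fst|exact: cg].
rewrite (_ : (fun z => _) = (fun z => F 0 z * F 0 z + F 1 z * F 1 z + F 2%:R z * F 2%:R z)).
  by apply: (@cvgD _ R^o); [apply: (@cvgD _ R^o)|]; apply: (@cvgM R); exact: c1.
by apply/funext => y; rewrite dotE !mxE.
Qed.

(** The gap [r] ranges over a compact interval away from 0 and 1. At an interior minimum [s] may be
    moved with the far end [s0 + r0] fixed, and the vanishing derivative is the orthogonality. *)
Lemma arc_min_pair g (dl : R) : arc g -> 0 < dl -> dl <= 1 / 2 ->
  exists s0 r0, [/\ dl <= r0 <= 1 - dl,
    forall s r, dl <= r <= 1 - dl -> enorm (g (s0 + r0) - g s0) <= enorm (g (s + r) - g s) &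
    [\/ r0 = dl, r0 = 1 - dl | dot (g (s0 + r0) - g s0) (deriv1 g s0) = 0]].
Proof.
move=> ag dl0 dl2; have [[pg [dg _]] _] := ag.
pose f (z : R * R) := dot (g (z.1 + z.2) - g z.1) (g (z.1 + z.2) - g z.1).
have cA : compact (`[0%R, 1%R] `*` `[dl, (1 - dl)%R] : set (R * R))%classic.
  by apply: compact_setX; exact: segment_compact.
have [|[s0 r0] + hmin] := @compact_EVT_min _ R f _ _ cA (continuous_subspaceT (dot_dist_continuous ag)).
  by exists (0, dl) => /=; rewrite !in_itv/= lexx ler01 lexx/=; split => //; lra.
rewrite inE /= !in_itv/= => -[s01 r01].
exists s0, r0.
have min' s r : dl <= r <= 1 - dl -> f (s0, r0) <= f (s, r).
  move=> hr; have fp x : f (x + 1, r) = f (x, r) by rewrite /f/= addrAC !pg.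
  rewrite (periodic_red s fp); apply: hmin; rewrite inE/= !in_itv/=; split => //.
  by have /andP[-> /ltW ->] := frac_itv s.
split => //.
  move=> s r hr; rewrite -ler_sqr ?nnegrE ?enorm_ge0// !enorm_dot.
  exact: min' hr.
have [e|n1] := eqVneq r0 dl; first by constructor 1.
have [e|n2] := eqVneq r0 (1 - dl); first by constructor 2.
constructor 3; pose t0 := s0 + r0.
have /andP[r1 r2] := r01.
have r1' : dl < r0 by rewrite lt_def n1.
have r2' : r0 < 1 - dl by rewrite lt_def eq_sym n2.
pose phi x := dot (g t0 - g x) (g t0 - g x).
have dphi (x : R) : is_derive x 1 phi (- (2 * dot (g t0 - g x) (deriv1 g x))).
  have d0 := is_derive_coord 0 (dg x); have d1 := is_derive_coord 1 (dg x).
  have d2 := is_derive_coord 2%:R (dg x).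
  have -> : phi = (fun x => (g t0 0 0 - g x 0 0) * (g t0 0 0 - g x 0 0) +
    (g t0 0 1 - g x 0 1) * (g t0 0 1 - g x 0 1) + (g t0 0 2%:R - g x 0 2%:R) * (g t0 0 2%:R - g x 0 2%:R)).
    by apply/funext => y; rewrite /phi dotE !mxE.
  by apply: is_derive_eq; rewrite dotE !mxE /GRing.scale/=; ring.
have h0 : is_derive s0 1 phi 0.
  apply: (@derive1_at_min R phi (t0 - (1 - dl)) (t0 - dl)).
  - lra.
  - by move=> t _; have [] := dphi t.
  - by rewrite in_itv/= /t0; lra.
  - move=> t; rewrite in_itv/= => /andP[a b].
    have := min' t (t0 - t); rewrite /f/= -/t0 subrKC => h; apply: h; lra.
have [_ e1] := dphi s0; have [_ e2] := h0; rewrite -/t0.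
by move: e1; rewrite e2 => e1; lra.
Qed.

Lemma arc_bilip_from_gap g Psi B dl d : arc g -> tension g Psi B ->
  0 < dl -> dl <= 1 / 2 -> dl * B <= 1 -> 0 <= d ->
  (forall s r, dl <= r <= 1 - dl -> d <= enorm (g (s + r) - g s)) ->
  bilip (Num.min (1 / 2) d) g.
Proof.
move=> ag tg dl0 dl2 dlB d0 gap; have B0 := tension_ge0 tg; set c := Num.min _ _.
have c1 : c <= 1 / 2 by rewrite ge_min lexx.
have cd : c <= d by rewrite ge_min lexx orbT.
split=> [t|s t h]; first by rewrite ag.2; lra.
have [le|lt] := leP `|t - s| dl.
  apply: (@le_trans _ _ (`|t - s| / 2)); first by rewrite mulrC ler_wpM2l//; lra.
  apply: arc_local_bilip ag tg _ _; first lra.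
  exact: le_trans (ler_wpM2r B0 le) dlB.
have c0 : 0 <= c by rewrite le_min d0 andbT; lra.
apply: (@le_trans _ _ d).
  by apply: le_trans cd; rewrite ler_piMr//; lra.
have [st|ts] := leP s t.
  move: h lt; rewrite ger0_norm ?subr_ge0// => h lt.
  by have := gap s (t - s); rewrite subrKC; apply; lra.
move: h lt; rewrite distrC gtr0_norm ?subr_gt0// => h lt.
by rewrite enorm_distC; have := gap t (s - t); rewrite subrKC; apply; lra.
Qed.

Lemma arc_bilip g : arc g -> injective_period g -> exists2 c, 0 < c & bilip c g.
Proof.
move=> ag inj; have [Psi tg] := arc_tension ag; have B0 := tension_ge0 tg.
(* Small enough for both [dl <= 1 / 2] and [dl * B <= 1]. *)
set B := bending g in tg B0; pose dl := 1 / (2 * (1 + B)).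
have dl0 : 0 < dl by rewrite divr_gt0//; lra.
have dlE : dl * (2 * (1 + B)) = 1 by rewrite /dl mul1r mulVf// gt_eqF//; lra.
have dl2 : dl <= 1 / 2 by nra.
have dlB : dl * B <= 1 by nra.
have [s0 [r0 [/andP[r1 r2] hmin _]]] := arc_min_pair ag dl0 dl2.
have d0 : 0 < enorm (g (s0 + r0) - g s0).
  rewrite enorm_gt0 subr_eq0; apply/negP => /eqP e.
  have pg := ag.1.1.
  have e1 := periodic_red s0 pg; have e2 := periodic_red (s0 + r0) pg.
  have := inj _ _ (frac_itv (s0 + r0)) (frac_itv s0); rewrite -e1 -e2 => /(_ e) e3.
  (* A coincidence would make [r0] an integer strictly between 0 and 1. *)
  have : r0 = (Num.floor (s0 + r0) - Num.floor s0)%:~R by rewrite intrB; lra.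
  move: (_ - _) => z rz; have : (0 < z < 1)%R by rewrite -(ltr_int R) -(ltr_int R z 1) -rz; lra.
  by rewrite gtz0_ge1 => /andP[a b]; have := le_lt_trans a b; rewrite ltxx.
exists (Num.min (1 / 2) (enorm (g (s0 + r0) - g s0))).
  by rewrite lt_min d0 andbT; lra.
exact: arc_bilip_from_gap ag tg dl0 dl2 dlB (ltW d0) hmin.
Qed.

End arclength_curves.

(** * Lower bounds on the tangent-point energy *)

Section tangent_point_bounds.
Context {R : realType}.
Local Notation mu := (@lebesgue_measure R).
Implicit Types (g h : R -> 'rV[R]_3) (Psi : 'I_3 -> R -> R).
Local Notation II := (`[0%R, 1%R] `*` `[0%R, 1%R] : set (measurableTypeR R * measurableTypeR R))%classic.

(** The perturbed chord has tangential part at most [3 / 8 * d] and length between [7 / 8 * d] and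
    [9 / 8 * d], so its normal part is at least [d / 2]; this bounds the tangent-point radius by
    [2 * d]. *)
Lemma inv_rtp_lower (u u0 D D0 : 'rV[R]_3) (d : R) : enorm u = 1 -> enorm u0 = 1 ->
  0 < d -> enorm D0 = d -> dot D0 u0 = 0 -> enorm (D - D0) <= d / 8 -> enorm (u - u0) <= 1 / 4 ->
  (2 * d)^-1 <= 2 * Num.sqrt (cross_norm2 u D) / dot D D.
Proof.
move=> u1 u01 d0 D0d perp hD hu.
have e1 : `|dot D u| <= 3 / 8 * d.
  have -> : dot D u = dot (D - D0) u + dot D0 (u - u0) by rewrite !dotLE perp; ring.
  apply: le_trans (ler_normD _ _) _.
  have := cauchy_dot (D - D0) u; have := cauchy_dot D0 (u - u0); rewrite u1 D0d mulr1 => h1 h2.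
  have : d * enorm (u - u0) <= d * (1 / 4) by rewrite ler_wpM2l// ltW.
  lra.
have n1 : 7 / 8 * d <= enorm D by have := enorm_rev D0 (D - D0); rewrite subrKC D0d; lra.
have n2 : enorm D <= 9 / 8 * d by have := enormD D0 (D - D0); rewrite subrKC D0d; lra.
rewrite -(enorm_dot D).
have S : d / 2 <= Num.sqrt (cross_norm2 u D).
  rewrite -[leLHS]gtr0_norm ?divr_gt0// -sqrtr_sqr; apply: ler_wsqrtr.
  rewrite /cross_norm2 -!enorm_dot u1 expr1n mul1r dotC -(real_normK (num_real (dot D u))).
  have := normr_ge0 (dot D u); move: (`|dot D u|) e1 (enorm D) n1 n2 => x xx n n1 n2 x0.
  nra.
have N0 : 0 < enorm D ^+ 2 by rewrite exprn_gt0//; lra.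
rewrite ler_pdivlMr// mulrC ler_pdivrMr ?mulr_gt0//.
by move: (enorm D) (Num.sqrt _) n1 n2 S => n y n1 n2 S; nra.
Qed.

Lemma sub_unit_itv (s rho : R) : 0 <= s <= 1 -> 0 <= rho -> rho <= 1 / 2 ->
  exists a, [/\ 0 <= a, a + rho <= 1, a <= s & s <= a + rho].
Proof.
move=> /andP[s0 s1] r0 r1; have [h|h] := leP s (1 / 2).
  by exists s; split; lra.
by exists (s - rho); split; lra.
Qed.

(** Integrability is assumed because [TP] would read an infinite integral as 0. *)
Lemma TP_box q g (a b rho c : R) : W22 g ->
  (mu \x mu)%E.-integrable II (EFin \o (fun z => TPk q g z.1 z.2)) ->
  0 <= rho -> 0 <= c -> 0 <= a -> a + rho <= 1 -> 0 <= b -> b + rho <= 1 ->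
  (forall s t, a <= s <= a + rho -> b <= t <= b + rho -> c <= TPk q g s t) ->
  rho ^+ 2 * c <= TP q g.
Proof.
move=> wg ik r0 c0 a0 a1 b0 b1 hk; rewrite TP_prod// /Rintegral.
set bx := (`[a, a + rho] `*` `[b, b + rho])%classic : set (measurableTypeR R * measurableTypeR R).
have mbx : measurable bx by apply: measurableX; exact: measurable_itvR.
have mk : measurable_fun [set: measurableTypeR R * measurableTypeR R]
  (fun z => (TPk q g z.1 z.2)%:E) by apply/measurable_EFinP; exact: measurable_TPk.
have fin : (\int[mu \x mu]_(z in II) (TPk q g z.1 z.2)%:E)%E \is a fin_num.
  have [_ ifin] := integrableP _ _ _ ik.
  rewrite ge0_fin_numE; last by apply: integral_ge0 => z _; rewrite lee_fin TPk_ge0.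
  apply: le_lt_trans ifin; rewrite le_eqVlt; apply/orP; left; apply/eqP.
  by apply: eq_integral => z _ /=; rewrite ger0_norm// TPk_ge0.
rewrite -lee_fin fineK//.
have sub : (bx `<=` II)%classic.
  move=> -[s t] [] /=; rewrite !in_itv/= => /andP[? ?] /andP[? ?]; split; lra.
apply: (@le_trans _ _ (\int[mu \x mu]_(z in bx) (TPk q g z.1 z.2)%:E)%E); last first.
  apply: ge0_subset_integral => //; first exact: measurable_II.
    exact: measurable_funTS.
  by move=> z _; rewrite lee_fin TPk_ge0.
apply: (@le_trans _ _ (\int[mu \x mu]_(z in bx) c%:E)%E); last first.
  apply: ge0_le_integral => //.
  - exact: measurable_funTS.
  - by move=> -[s t] [] /=; rewrite !in_itv/= => h1 h2; rewrite lee_fin; exact: hk.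
rewrite integral_cst//.
rewrite [X in (_ * X)%E](_ : _ = (mu `[a, (a + rho)%R] * mu `[b, (b + rho)%R])%E); last first.
  exact: product_measure1E (measurable_itvR _) (measurable_itvR _).
have e (x : R) : mu `[x, x + rho] = rho%:E.
  rewrite lebesgue_measure_itv/= lte_fin ltrDl; case: ltP => h.
    by rewrite -EFinB addrAC subrr add0r.
  by congr EFin; apply/eqP; rewrite eq_le r0 h.
by rewrite !e -!EFinM lee_fin mulrC -expr2.
Qed.

Lemma TP_lower q g Psi B (s0 t0 : R) : 2 < q -> arc g -> tension g Psi B ->
  (mu \x mu)%E.-integrable II (EFin \o (fun z => TPk q g z.1 z.2)) ->
  0 < enorm (g t0 - g s0) -> dot (g t0 - g s0) (deriv1 g s0) = 0 ->
  (1 / (48 * (1 + B)) * enorm (g t0 - g s0)) ^+ 2 * powR (2 * enorm (g t0 - g s0))^-1 q <= TP q g.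
Proof.
move=> q2 ag tg ik.
rewrite (periodic_red s0 ag.1.1) (periodic_red t0 ag.1.1).
rewrite (periodic_red s0 (deriv1_periodic ag.1.1)).
have := frac_itv s0; have := frac_itv t0; move: (t0 - _) (s0 - _) => {t0 s0} t0 s0 ht hs.
(* Moving both parameters by [eta * d] shifts the chord by at most [6 * eta * d <= d / 8]; since
   [d <= 3], the squared displacement of the tangent is at most [3 / 48], the square of [1 / 4]. *)
set d := enorm _ => d0 perp; set eta := 1 / _.
have B0 := tension_ge0 tg.
have eE : eta * (48 * (1 + B)) = 1 by rewrite /eta mul1r mulVf// gt_eqF//; lra.
have e0 : 0 < eta by rewrite divr_gt0//; lra.
have e1 : eta <= 1 / 48 by nra.
have e2 : eta * B <= 1 / 48 by nra.
have d3 : d <= 3.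
  apply: le_trans (arc_lipschitz s0 t0 ag) _.
  have : `|t0 - s0| <= 1 by rewrite ler_norml; lra.
  lra.
have r0 : 0 <= eta * d by rewrite mulr_ge0// ltW.
have r1 : eta * d <= 1 / 16 by nra.
have r2 : eta * d <= 1 / 2 by lra.
have [|a [a0 a1 a2 a3]] := @sub_unit_itv s0 (eta * d) _ r0 r2; first lra.
have [|b [b0 b1 b2 b3]] := @sub_unit_itv t0 (eta * d) _ r0 r2; first lra.
apply: (@TP_box q g a b) => //; first exact: ag.1.
  exact: powR_ge0.
move=> s t hs' ht'; rewrite TPk_tpker /tpker !ag.2 !mulr1 !mul1r.
have ds : `|s - s0| <= eta * d by rewrite ler_norml; lra.
have dt : `|t - t0| <= eta * d by rewrite ler_norml; lra.
apply: ge0_ler_powR.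
- lra.
- by rewrite nnegrE invr_ge0 mulr_ge0// ltW.
- by rewrite nnegrE divr_ge0 ?mulr_ge0 ?sqrtr_ge0 ?dot_ge0.
apply: (@inv_rtp_lower _ (deriv1 g s0) _ (g t0 - g s0)) => //; try exact: ag.2.
  have -> : g t - g s - (g t0 - g s0) = (g t - g t0) - (g s - g s0).
    by rewrite !opprD !opprK !addrA; do 2 rewrite addrAC; rewrite -!addrA; congr (_ + _); rewrite addrCA; congr (_ + _); rewrite addrC.
  apply: le_trans (enormD _ _) _; rewrite enormN.
  have := arc_lipschitz s0 s ag; have := arc_lipschitz t0 t ag; nra.
have hh := tension_holder_abs tg (le_trans ds (le_trans r1 _ : eta * d <= 1)).
rewrite -ler_sqr ?nnegrE ?enorm_ge0 ?divr_ge0//.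
apply: le_trans (hh _) _; first lra.
have : `|s - s0| * B <= eta * d * B by rewrite ler_wpM2r.
have : d * (eta * B) <= 3 * (1 / 48) by apply: ler_pM => //; [exact: ltW|rewrite mulr_ge0// ltW].
by rewrite expr2; lra.
Qed.

Lemma powR_root_le (x p M : R) : 0 < p -> 0 <= x -> powR x p <= M -> x <= powR M (1 / p).
Proof.
move=> p0 x0 h; have M0 : 0 <= M by exact: le_trans (powR_ge0 _ _) h.
have <- : powR (powR x p) (1 / p) = x by rewrite -powRrM mul1r divff ?gt_eqF// powRr1.
apply: ge0_ler_powR h; rewrite ?nnegrE ?powR_ge0//.
by rewrite divr_ge0// ltW.
Qed.

Lemma arc_bilip_uniform (q B T : R) : 2 < q -> q <= 4 -> 0 <= B -> exists2 c, 0 < c &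
  forall g Psi, arc g -> injective_period g -> tension g Psi B -> TP q g <= T -> bilip c g.
Proof.
move=> q2 q4 B0; pose dl := 1 / (2 * (1 + B)); pose eta := 1 / (48 * (1 + B)).
have dl0 : 0 < dl by rewrite divr_gt0//; lra.
have dlE : dl * (2 * (1 + B)) = 1 by rewrite /dl mul1r mulVf// gt_eqF//; lra.
have dl2 : dl <= 1 / 2 by nra.
have dlB : dl * B <= 1 by nra.
have e0 : 0 < eta by rewrite divr_gt0//; lra.
(* With [D] the smallest gap, [M] is the bound that [TP_lower] puts on the power [2 - q] of [2 * D],
   and [K] the resulting bound on its inverse. *)
pose M := 4 * (1 + `|T|) / eta ^+ 2; pose K := powR M (1 / (q - 2)).
have M0 : 0 < M by rewrite divr_gt0 ?exprn_gt0// mulr_gt0// ltr_wpDr.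
have K0 : 0 < K by exact: powR_gt0.
pose d := Num.min (dl / 2) (2 * K)^-1.
have d0 : 0 < d by rewrite lt_min divr_gt0//= invr_gt0 mulr_gt0.
exists (Num.min (1 / 2) d); first by rewrite lt_min d0 andbT; lra.
move=> g Psi ag inj tg hT; have [pg _] := ag.1.
apply: (arc_bilip_from_gap ag tg dl0 dl2 dlB (ltW d0)).
have [s0 [r0 [r01 hmin cr]]] := arc_min_pair ag dl0 dl2.
suff h : d <= enorm (g (s0 + r0) - g s0) by move=> s r hr; apply: le_trans h (hmin s r hr).
have loc s t : `|t - s| = dl -> d <= enorm (g t - g s).
  move=> e; apply: (@le_trans _ _ (dl / 2)); first by rewrite ge_min lexx.
  by rewrite -e; apply: (arc_local_bilip ag tg); rewrite e//; lra.
case: cr => [e|e|perp].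
- by apply: loc; rewrite addrAC subrr add0r e gtr0_norm.
- have -> : g (s0 + r0) = g (s0 - dl) by rewrite e addrA addrAC pg.
  by apply: loc; rewrite addrAC subrr add0r normrN gtr0_norm.
(* A qualitative constant depending on [g]; it serves to make the kernel integrable and the gap
   positive, so that [TP_lower] applies. *)
have [c c0 bc] := arc_bilip ag inj.
have [ik _ _] := TP_variation q2 q4 ag.1 ag.1 c0 bc.
set D := enorm _; have D0 : 0 < D.
  rewrite enorm_gt0 subr_eq0; apply/negP => /eqP e.
  have [r12|r12] := leP r0 (1 / 2).
    have := bc.2 s0 (s0 + r0); rewrite addrAC subrr add0r e subrr enorm0 ger0_norm; last lra.
    by move=> /(_ r12); nra.
  have := bc.2 s0 (s0 + r0 - 1); have -> : g (s0 + r0 - 1) = g s0.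
    by rewrite -[in RHS]e -[in RHS](subrK 1 (s0 + r0)) pg.
  rewrite subrr enorm0 (_ : s0 + r0 - 1 - s0 = r0 - 1); last by ring.
  rewrite ler0_norm; last lra.
  have r13 : - (r0 - 1) <= 1 / 2 by lra.
  by move=> /(_ r13); nra.
have := TP_lower q2 ag tg ik D0 perp; rewrite -/D -/eta => low.
rewrite /d ge_min; apply/orP; right.
have D20 : 0 < 2 * D by rewrite mulr_gt0.
set x := (2 * D)^-1 in low.
have x0 : 0 < x by rewrite invr_gt0.
have xD : x * (2 * D) = 1 by rewrite mulVf// gt_eqF.
have xq : powR x q = powR x (q - 2) * x ^+ 2.
  by rewrite -powR_mulrn ?(ltW x0)// -powRD ?subrK// (gt_eqF x0) implybT.
have e4 : (eta * D) ^+ 2 * powR x q = eta ^+ 2 / 4 * powR x (q - 2).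
  rewrite xq (_ : _ * _ = eta ^+ 2 / 4 * powR x (q - 2) * (x * (2 * D)) ^+ 2); last by field.
  by rewrite xD expr1n mulr1.
have xM : powR x (q - 2) <= M.
  rewrite /M ler_pdivlMr ?exprn_gt0//; move: low; rewrite e4 => low.
  by have := ler_norm T; move: (powR x _) hT low => y hT low hn; nra.
have q20 : 0 < q - 2 by rewrite subr_gt0.
have xK := powR_root_le q20 (ltW x0) xM; rewrite -/K in xK.
rewrite -[leLHS]mul1r ler_pdivrMr ?mulr_gt0//.
have := ler_wpM2r (ltW D20) xK; rewrite xD; lra.
Qed.

(* The symmetry forces [g 0] and [g (1/2)] onto the third axis, to which [g' 0] is orthogonal. *)
Lemma D2_perp g : (forall t, derivable g t 1) -> periodic1 g -> D2sym g ->
  dot (g (1 / 2) - g 0) (deriv1 g 0) = 0.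
Proof.
move=> dg pg sym.
have ev x : g x = rotax 2 (g (- x)) by have [_ []] := sym x.
have z x (i : 'I_3) : (i : nat) != 2%N -> g x 0 i = - g (- x) 0 i.
  by move=> i2; rewrite {1}ev mxE (negbTE i2).
have z0 (i : 'I_3) : (i : nat) != 2%N -> g 0 0 i = 0.
  by move=> /(z 0); rewrite oppr0; lra.
have z1 (i : 'I_3) : (i : nat) != 2%N -> g (1 / 2) 0 i = 0.
  move=> /(z (1 / 2)); rewrite -(pg (- (1 / 2))) (_ : - (1 / 2) + 1 = 1 / 2); last by field.
  lra.
have d2 : deriv1 g 0 0 2%:R = 0.
  have h0 := is_derive_coord 2%:R (dg 0).
  have h1 := is_derive_coord 2%:R (dg (-1 * 0 + 0)).
  have := @is_derive_affine R (fun x => g x 0 2%:R) (fun x => deriv1 g x 0 2%:R) (-1) 0 0 h1.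
  have -> : (fun x : R => g (-1 * x + 0) 0 2%:R) = (fun x => g x 0 2%:R).
    by apply/funext => x; rewrite mulN1r addr0 [in RHS]ev mxE.
  rewrite mulr0 addr0 => -[_ e1]; have [_ e2] := h0.
  by move: e1; rewrite e2; lra.
rewrite dotE d2 !mxE (z0 0 isT) (z0 1 isT) (z1 0 isT) (z1 1 isT); ring.
Qed.

Lemma D2_TP_gt0 q g : 2 < q -> q <= 4 -> arc g -> injective_period g -> D2sym g -> 0 < TP q g.
Proof.
move=> q2 q4 ag inj sym; have [c c0 bc] := arc_bilip ag inj.
have [ik _ _] := TP_variation q2 q4 ag.1 ag.1 c0 bc.
have [Psi tg] := arc_tension ag.
have d0 : 0 < enorm (g (1 / 2) - g 0).
  rewrite enorm_gt0 subr_eq0; apply/negP => /eqP/inj e.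
  have : (1 / 2 : R) = 0 by apply: e; lra.
  lra.
have := TP_lower q2 ag tg ik d0 (D2_perp ag.1.2.1 ag.1.1 sym); apply: lt_le_trans.
have B0 := tension_ge0 tg.
by rewrite mulr_gt0 ?exprn_gt0 ?mulr_gt0 ?divr_gt0 ?mulr_gt0 ?powR_gt0 ?invr_gt0 ?mulr_gt0//; lra.
Qed.

End tangent_point_bounds.

(** * Limits along an ultrafilter *)

Section ultralimits.
Context {R : realType}.
Context {U : set_system nat} {UU : UltraFilter U}.

(** Compactness of [[-K, K]] gives a cluster point, and an ultrafilter converges to each of its
    cluster points. *)
Lemma ultra_bounded_cvg (a : nat -> R) (K : R) : (forall n, `|a n| <= K) ->
  exists l : R, a n @[n --> U] --> l.
Proof.
move=> aK.
have Fa : U (a @^-1` (`[- K, K]%classic : set R)).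
  by apply: filterE => n /=; rewrite in_itv/= -ler_norml; exact: aK.
have [l [_ cl]] := @segment_compact R (- K) K (a n @[n --> U]) _ Fa.
exists l => V Vl; have [//|nV] := in_ultra_setVsetC (a @^-1` V) UU.
by have [y [/= hy Vy]] := cl (~` V) V nV Vl; case: (hy Vy).
Qed.

Lemma ultra_le (a b : nat -> R) (l m : R) : a n @[n --> U] --> l -> b n @[n --> U] --> m ->
  (forall n, a n <= b n) -> l <= m.
Proof. by move=> al bm ab; apply: ler_cvg_to al bm _; exact: nearW. Qed.

Lemma ultra_eq (a b : nat -> R) (l m : R) : a n @[n --> U] --> l -> b n @[n --> U] --> m ->
  (forall n, a n = b n) -> l = m.
Proof.
move=> al bm ab; apply/eqP; rewrite eq_le.
by rewrite (ultra_le al bm) ?(ultra_le bm al)// => n; rewrite ab.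
Qed.

(* Arzela--Ascoli with the modulus of continuity [sqrt (K r)]. *)
Lemma ultra_uniform (f : nat -> R -> R) (F : R -> R) (K : R) : 0 <= K ->
  (forall n t, f n (t + 1) = f n t) ->
  (forall n s t, s <= t <= s + 1 -> (f n t - f n s) ^+ 2 <= K * (t - s)) ->
  (forall t, f n t @[n --> U] --> F t) ->
  forall e, 0 < e -> \forall n \near U, forall t, `|f n t - F t| <= e.
Proof.
move=> K0 per hold cv e e0.
have perF t : F (t + 1) = F t by apply: (ultra_eq (cv _) (cv _)) => n; rewrite per.
have holdF s t : s <= t <= s + 1 -> (F t - F s) ^+ 2 <= K * (t - s).
  move=> st; have h : (f n t - f n s) ^+ 2 @[n --> U] --> (F t - F s) ^+ 2.
    by rewrite expr2; under eq_fun do rewrite expr2; apply: cvgM; apply: cvgB; exact: cv.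
  by apply: (ultra_le h (cvg_cst (K * (t - s)))) => n; exact: hold.
(* The mesh [1 / (N + 1)] keeps oscillations below [e / 3]; convergence is then asked at finitely
   many nodes. *)
have [N hN] : exists N : nat, K * N.+1%:R^-1 <= (e / 3) ^+ 2.
  have e3 : 0 < (e / 3) ^+ 2 by rewrite exprn_gt0// divr_gt0.
  exists (Num.truncn (K / (e / 3) ^+ 2)).
  rewrite ler_pdivrMr// mulrC -ler_pdivrMr//; apply: ltW.
  by rewrite truncnS_gt// divr_ge0// ltW.
have small x (y : R) : 0 <= y -> x ^+ 2 <= y ^+ 2 -> `|x| <= y.
  by move=> y0 xy; rewrite -ler_sqr ?nnegrE// real_normK ?num_real.
have e3 : 0 <= e / 3 by rewrite divr_ge0// ltW.
have e3' : 0 < e / 3 by rewrite divr_gt0.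
have hk0 (k : 'I_N.+1) : \forall n \near U, `|f n (k%:R / N.+1%:R) - F (k%:R / N.+1%:R)| <= e / 3.
  have /cvgrPdist_le/(_ _ e3') := cv (k%:R / N.+1%:R).
  by apply: filterS => n; rewrite distrC.
have FU : Filter U by exact: filter_filter.
apply: (@filterS _ U FU _ _ _ (@filter_forall _ _ _ U FU hk0)) => n hk t.
have perD s : f n (s + 1) - F (s + 1) = f n s - F s by rewrite per perF.
rewrite (periodic_red t perD); have /andP[u0 u1] := frac_itv t; move: (t - _) u0 u1 => u u0 u1.
have N0 : 0 < N.+1%:R :> R by rewrite ltr0n.
pose k := Num.truncn (u * N.+1%:R).
have /andP[k1 k2] : k%:R <= u * N.+1%:R < k.+1%:R by apply: truncn_itv; rewrite mulr_ge0// ltW.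
have kN : (k < N.+1)%N.
  by rewrite -(ltr_nat R); apply: le_lt_trans k1 _; rewrite gtr_pMl.
have := hk (Ordinal kN); rewrite /=; set x := k%:R / N.+1%:R => hx.
have xu : x <= u by rewrite ler_pdivrMr.
have ux : u - x <= N.+1%:R^-1.
  by rewrite lerBlDl -[X in _ + X]mul1r -mulrDl ler_pdivlMr// natr1 ltW.
have ux1 : u <= x + 1.
  have n1 : N.+1%:R^-1 <= 1 :> R by rewrite invf_le1// ler1n.
  by have := le_trans ux n1; lra.
have hKe : K * (u - x) <= (e / 3) ^+ 2 by apply: le_trans hN; rewrite ler_wpM2l.
have xux : x <= u <= x + 1 by rewrite xu ux1.
have b1 := small _ _ e3 (le_trans (hold n x u xux) hKe).
have b2 := small _ _ e3 (le_trans (holdF x u xux) hKe).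
have -> : f n u - F u = (f n u - f n x) + (f n x - F x) - (F u - F x) by ring.
have := ler_normB (f n u - f n x + (f n x - F x)) (F u - F x).
have := ler_normD (f n u - f n x) (f n x - F x).
by lra.
Qed.

End ultralimits.

(** * Semicontinuity and stability under C^1 limits *)

Section limit_curves.
Context {R : realType}.
Local Notation mu := (@lebesgue_measure R).
Implicit Types (g h : R -> 'rV[R]_3) (Psi : 'I_3 -> R -> R).
Local Notation II := (`[0%R, 1%R] `*` `[0%R, 1%R] : set (measurableTypeR R * measurableTypeR R))%classic.

(** Differentiability in a quantitative form that passes to pointwise limits: the squared error of
    the difference quotient is at most [|z| * B]. *)
Lemma is_derive_holder (f : R -> R) (t l B : R) : 0 <= B ->
  (forall z : R, `|z| <= 1 -> (f (t + z) - f t - z * l) ^+ 2 <= `|z| ^+ 3 * B) ->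
  is_derive t 1 f l.
Proof.
move=> B0 hf.
have cv : (z^-1 *: (f (z *: 1 + t) - f t)) @[z --> (0 : R)^'] --> l.
  apply/cvgrPdist_le => e e0; near=> h.
  have hn0 : h != 0 by near: h; exact: nbhs_dnbhs_neq.
  have h1 : `|h| <= 1 by near: h; apply: dnbhs0_le.
  have h2 : `|h| <= e ^+ 2 / (1 + B).
    by near: h; apply: dnbhs0_le; rewrite divr_gt0 ?exprn_gt0//; lra.
  have hp : 0 < `|h| by rewrite normr_gt0.
  have hB : `|h| * B <= e ^+ 2.
    move: h2; rewrite ler_pdivlMr; last lra.
    by move=> ?; nra.
  rewrite -ler_sqr ?nnegrE ?(ltW e0)// real_normK ?num_real//; apply: le_trans hB.
  rewrite -sqrrN opprB.
  have -> : (h^-1 *: (f (h *: 1 + t) - f t) - l) ^+ 2 = (f (t + h) - f t - h * l) ^+ 2 / `|h| ^+ 2.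
    by rewrite real_normK ?num_real// /GRing.scale/= mulr1 [h + t]addrC; field.
  rewrite ler_pdivrMr ?exprn_gt0//; apply: le_trans (hf h h1) _.
  by rewrite le_eqVlt; apply/orP; left; apply/eqP; ring.
by split; [apply/cvg_ex; exists l; exact: cv|exact: cvg_lim cv].
Unshelve. all: by end_near. Qed.

Lemma periodic_close (s t : R) : exists s' t', `|t' - s'| <= 1 / 2 /\
  forall (T : Type) (f : R -> T), (forall x, f (x + 1) = f x) -> f s' = f s /\ f t' = f t.
Proof.
have /andP[s0 /ltW s1] := frac_itv s; have /andP[t0 /ltW t1] := frac_itv t.
have hs : 0 <= s - (Num.floor s)%:~R <= 1 by rewrite s0 s1.
have ht : 0 <= t - (Num.floor t)%:~R <= 1 by rewrite t0 t1.
have [k [_ _ hk hf]] := periodic_near hs ht.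
exists (s - (Num.floor s)%:~R), (t - (Num.floor t)%:~R + k); split => // T f fp.
by rewrite hf// -!(periodic_red _ fp).
Qed.

Lemma bilip_injective g c : periodic1 g -> 0 < c -> bilip c g -> injective_period g.
Proof.
move=> pg c0 bg s t hs ht e.
have hs' : 0 <= s <= 1 by lra.
have ht' : 0 <= t <= 1 by lra.
have [k [k3 _ hk hf]] := periodic_near hs' ht'.
have := bg.2 _ _ hk; rewrite (hf _ g pg) e subrr enorm0 pmulr_rle0// normr_le0 subr_eq0 => /eqP.
by case: k3 => [->|[->|->]]; lra.
Qed.

Lemma cvg_dot (u v : nat -> 'rV[R]_3) (a b : 'rV[R]_3) :
  (forall i, u n 0 i @[n --> \oo] --> a 0 i) -> (forall i, v n 0 i @[n --> \oo] --> b 0 i) ->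
  dot (u n) (v n) @[n --> \oo] --> dot a b.
Proof.
move=> ua vb; rewrite dotE; under eq_fun do rewrite dotE.
by apply: cvgD; [apply: cvgD|]; apply: cvgM.
Qed.

(** A nonzero limit value forces nonzero denominators and a positive base, hence continuity of the
    kernel there. *)
Lemma cvg_tpker q (u v w : nat -> 'rV[R]_3) (a b c : 'rV[R]_3) : 0 < q ->
  (forall i, u n 0 i @[n --> \oo] --> a 0 i) -> (forall i, v n 0 i @[n --> \oo] --> b 0 i) ->
  (forall i, w n 0 i @[n --> \oo] --> c 0 i) -> tpker q a b c != 0 ->
  tpker q (u n) (v n) (w n) @[n --> \oo] --> tpker q a b c.
Proof.
move=> q0 ua vb wc n0.
have sq (x : nat -> R) (y : R) : x n @[n --> \oo] --> y -> Num.sqrt (x n) @[n --> \oo] --> Num.sqrt y.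
  by move=> xy; apply: continuous_cvg => //; exact: sqrt_continuous.
have cu : enorm (u n) @[n --> \oo] --> enorm a by apply: sq; exact: cvg_dot.
have cw : enorm (w n) @[n --> \oo] --> enorm c by apply: sq; exact: cvg_dot.
have cX : cross_norm2 (u n) (v n) @[n --> \oo] --> cross_norm2 a b.
  by apply: cvgB; [apply: cvgM|rewrite expr2; under eq_fun do rewrite expr2; apply: cvgM]; exact: cvg_dot.
pose X u v : R := 2 * Num.sqrt (cross_norm2 u v) / (enorm u * dot v v).
have X0 : X a b != 0.
  apply: contra_neq n0 => e; rewrite /tpker -/(X a b) e powR0 ?mul0r// gt_eqF//.
have Xp : 0 < X a b.
  by rewrite lt_def X0 /X divr_ge0 ?mulr_ge0 ?sqrtr_ge0 ?enorm_ge0 ?dot_ge0.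
have cXX : X (u n) (v n) @[n --> \oo] --> X a b.
  apply: cvgM; first by apply: cvgM; [exact: cvg_cst|exact: sq].
  apply: cvgV; last by apply: cvgM => //; exact: cvg_dot.
  by move: X0; rewrite /X mulf_eq0 negb_or invr_eq0 => /andP[].
apply: cvgM => //; apply: cvgM => //.
have cp : {for X a b, continuous (fun x : R => powR x q)}.
  apply: differentiable_continuous; apply/derivable1_diffP.
  by have [] := @is_derive_powR_pos R id (X a b) 1 q Xp (is_derive_id _ _).
exact: (continuous_cvg _ cp cXX).
Qed.

Lemma TP_lsc q (g : nat -> R -> 'rV[R]_3) G (K : R) : 2 < q ->
  (forall n, W22 (g n)) -> W22 G ->
  (forall n, (mu \x mu)%E.-integrable II (EFin \o (fun z => TPk q (g n) z.1 z.2))) ->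
  (forall n, TP q (g n) <= K) ->
  (forall t i, g n t 0 i @[n --> \oo] --> G t 0 i) ->
  (forall t i, deriv1 (g n) t 0 i @[n --> \oo] --> deriv1 G t 0 i) -> TP q G <= K.
Proof.
move=> q2 wg wG ik hK cg cg'.
have mk h : W22 h -> measurable_fun II (fun z => (TPk q h z.1 z.2)%:E).
  by move=> wh; apply: measurable_funTS; apply/measurable_EFinP; exact: measurable_TPk.
have k0 h z : (0 <= (TPk q h z.1 z.2)%:E)%E by rewrite lee_fin TPk_ge0.
have le : (\int[mu \x mu]_(z in II) (TPk q G z.1 z.2)%:E <= K%:E)%E.
  apply: (@le_trans _ _ (\int[mu \x mu]_(z in II) limn_einf (fun n => (TPk q (g n) z.1 z.2)%:E))%E).
    apply: ge0_le_integral => //.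
    - exact: measurable_II.
    - exact: mk.
    - have -> : (fun z : measurableTypeR R * measurableTypeR R => limn_einf (fun n => (TPk q (g n) z.1 z.2)%:E)) =
          (fun z => - limn_esup (fun n => - (TPk q (g n) z.1 z.2)%:E))%E.
        by apply/funext => z; rewrite -[LHS]oppeK -limn_esupN.
      apply: (measurableT_comp (f := -%E)) => //.
      apply: measurable_fun_limn_esup => n.
      by apply: (measurableT_comp (f := -%E)) => //; exact: mk.
    (* Where the limit kernel is 0 the bound is trivial, so the discontinuity at a vanishing chord
       does no harm. *)
    - move=> [s t] _ /=; have [->|n0] := eqVneq (TPk q G s t) 0.
        rewrite limn_einf_lim; apply: lime_ge; first exact: is_cvg_einfs.
        by apply: nearW => n; apply: le_ereal_inf_tmp => _ [m _ <-]; exact: (k0 (g m) (s, t)).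
      have cT : TPk q (g n) s t @[n --> \oo] --> TPk q G s t.
        rewrite TPk_tpker; under eq_fun do rewrite TPk_tpker.
        apply: cvg_tpker; [lra|exact: cg'| |exact: cg'|by rewrite -TPk_tpker].
        by move=> i; rewrite !mxE; under eq_fun do rewrite !mxE; apply: cvgB; exact: cg.
      have cE : (TPk q (g n) s t)%:E @[n --> \oo] --> (TPk q G s t)%:E by apply/cvg_EFin; [exact: nearW|].
      by have [-> _] := cvg_limn_einf_sup cE.
  apply: le_trans (fatou _ _ _ _) _ => //.
  - exact: measurable_II.
  - by move=> n; exact: mk.
  - apply: limn_einf_le_bound => n.
    by have := hK n; rewrite TP_prod// /Rintegral -lee_fin fineK// (integrable_fin_num _ (ik n))//; exact: measurable_II.
rewrite TP_prod// /Rintegral -lee_fin fineK// ge0_fin_numE; first exact: le_lt_trans le (ltry _).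
exact: integral_ge0.
Qed.

(** In the sup norm the displacement has increments at most [c / 8] times the parameter distance and
    [g] at least [c / 3] times it; the ratio [3 / 8] is below the contraction constant [1 / 2]. *)
Lemma isotopic_close A g h c : W22 g -> W22 h -> 0 < c -> bilip c g ->
  (forall t i, `|deriv1 h t 0 i - deriv1 g t 0 i| <= c / 8) ->
  ambient_isotopic A (range g) -> ambient_isotopic A (range h).
Proof.
move=> wg wh c0 [_ bg] close iso; pose eta t := h t - g t.
have -> : h = (fun t => g t + eta t) by apply/funext => t; rewrite subrKC.
apply: (@ambient_isotopic_push _ g eta (1 / 2)) => //; [lra|].
move=> s t; have [s' [t' [d12 per]]] := periodic_close s t.
have [<- <-] := per _ eta (fun x => congr2 (fun a b => a - b) (wh.1 x) (wg.1 x)).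
have [<- <-] := per _ g wg.1.
have le1 : `|eta t' - eta s'| <= c / 8 * `|t' - s'|.
  apply: row_norm_le => [|i]; first by rewrite mulr_ge0// divr_ge0// ltW.
  have dd (x : R) : is_derive x 1 (fun x => h x 0 i - g x 0 i) (deriv1 h x 0 i - deriv1 g x 0 i).
    exact: (is_deriveB (is_derive_coord i (wh.2.1 x)) (is_derive_coord i (wg.2.1 x))).
  have [xi _ E] := MVT_signed s' t' dd.
  by rewrite /eta !mxE E normrM ler_wpM2r.
have := normr_ge0 (g t' - g s'); have := bg s' t' d12; have := enorm_le_norm (g t' - g s'); move: le1.
move: (`|t' - s'|) (`|eta _ - _|) (`|g _ - _|) (enorm _) => x y z w.
by lra.
Qed.

(** Symmetry excludes translations: the first two coordinates vanish at parameter 0 and the third at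
    [1 / 4], from where the Lipschitz estimate takes over. *)
Lemma arc_D2_bound g (t : R) i : arc g -> D2sym g -> `|g t 0 i| <= 3 * (`|t| + 1).
Proof.
move=> ag sym.
have [t0 t01 z] : exists2 t0, 0 <= t0 <= 1 & g t0 0 i = 0.
  have [i2|i2] := eqVneq (i : nat) 2%N.
    exists (1 / 4); first lra.
    have [h _] := sym (1 / 4); move: h; rewrite (_ : - (1 / 4) + 1 / 2 = 1 / 4); last by field.
    by move=> /rowP/(_ i); rewrite mxE i2/=; lra.
  exists 0; first lra.
  have [_ [_ h]] := sym 0; move: h; rewrite oppr0.
  by move=> /rowP/(_ i); rewrite mxE (negbTE i2); lra.
have := enorm_coord (g t - g t0) i; rewrite !mxE z subr0 => h; apply: (le_trans h).
apply: (le_trans (arc_lipschitz t0 t ag)); rewrite ler_pM2l//.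
apply: (le_trans (ler_normB _ _)); rewrite lerD2l ger0_norm; lra.
Qed.

(** [Psi i] is linear up to a periodic error. *)
Lemma tension_bound g Psi B i t : tension g Psi B -> `|Psi i t| <= B * (`|t| + 1).
Proof.
move=> [nd per ctl P0 hB].
have P1 j : 0 <= Psi j 1 by rewrite -(P0 j); exact: nd.
have PB : Psi i 1 <= B.
  by apply: le_trans hB; rewrite (bigD1 i)//= lerDl; apply: sumr_ge0.
have fp s : Psi i (s + 1) - (s + 1) * Psi i 1 = Psi i s - s * Psi i 1 by rewrite per; ring.
have h : `|Psi i t - t * Psi i 1| <= Psi i 1.
  rewrite (periodic_red t fp); have /andP[u0 /ltW u1] := frac_itv t.
  move: (t - _) u0 u1 => u u0 u1; have := nd i _ _ u0; have := nd i _ _ u1; rewrite P0 => a b.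
  by have := P1 i; rewrite ler_norml; nra.
have e : Psi i t = (Psi i t - t * Psi i 1) + t * Psi i 1 by ring.
rewrite e; apply: (le_trans (ler_normD _ _)); rewrite normrM (ger0_norm (P1 i)).
have := normr_ge0 t; have := P1 i; nra.
Qed.

Lemma bending_ge0 g : 0 <= bending g.
Proof.
apply: Rintegral_ge0 => t _.
by rewrite divr_ge0 ?cross_norm2_ge0// exprn_ge0// enorm_ge0.
Qed.

Lemma TP_ge0 q g : 0 <= TP q g.
Proof.
apply: fine_ge0; apply: integral_ge0 => s _; apply: integral_ge0 => t _.
by rewrite lee_fin TPk_ge0.
Qed.

Lemma arc_taylor g Psi B (t z : R) i : arc g -> tension g Psi B -> `|z| <= 1 ->
  (g (t + z) 0 i - g t 0 i - z * deriv1 g t 0 i) ^+ 2 <= `|z| ^+ 3 * B.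
Proof.
move=> ag tg z1.
have [xi hxi E] := MVT_signed t (t + z) (fun x => is_derive_coord i (ag.1.2.1 x)).
rewrite E [t + z - t]addrAC subrr add0r mulrC -mulrBr exprMn.
have xz : `|xi - t| <= `|z|.
  case/orP: hxi => /andP[a b].
    by rewrite ger0_norm ?subr_ge0// (le_trans _ (ler_norm _))// lerBlDl.
  by rewrite distrC ger0_norm ?subr_ge0// -normrN (le_trans _ (ler_norm _))//; lra.
have h := tension_holder_abs tg (le_trans xz z1).
have h2 : (deriv1 g xi 0 i - deriv1 g t 0 i) ^+ 2 <= `|z| * B.
  apply: le_trans (ler_wpM2r (tension_ge0 tg) xz); apply: le_trans h.
  have := enorm_coord (deriv1 g xi - deriv1 g t) i; rewrite !mxE => hc.
  by rewrite -(real_normK (num_real (_ - _))) ler_sqr ?nnegrE ?enorm_ge0.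
rewrite -(real_normK (num_real z)) [`|z| ^+ 3]exprSr -mulrA ler_wpM2l ?sqr_ge0//.
Qed.

End limit_curves.

(** * Limits of minimising sequences *)

Section minimising_sequences.
Context {R : realType}.
Local Notation mu := (@lebesgue_measure R).
Implicit Types (Psi : 'I_3 -> R -> R).

Lemma ultra_sqr {U : set_system nat} {UU : UltraFilter U} (a : nat -> R) (l : R) :
  a n @[n --> U] --> l -> a n ^+ 2 @[n --> U] --> l ^+ 2.
Proof. by move=> al; rewrite expr2; under eq_fun do rewrite expr2; exact: cvgM. Qed.

Lemma ultra_sum3 {U : set_system nat} {UU : UltraFilter U} (a : nat -> 'I_3 -> R) (l : 'I_3 -> R) :
  (forall i, a n i @[n --> U] --> l i) -> \sum_i a n i @[n --> U] --> \sum_i l i.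
Proof.
move=> al; rewrite sum3; under eq_fun do rewrite sum3.
by apply: cvgD => //; exact: cvgD.
Qed.

Section limit.
Context {U : set_system nat} {UU : UltraFilter U}.
Variables (g : nat -> R -> 'rV[R]_3) (Psi : nat -> 'I_3 -> R -> R) (b : nat -> R) (B c : R).
Hypotheses (ag : forall n, arc (g n)) (sg : forall n, D2sym (g n)).
Hypotheses (tg : forall n, tension (g n) (Psi n) (b n)) (bB : forall n, b n <= B).
Hypotheses (c0 : 0 < c) (bg : forall n, bilip c (g n)).

Let tB n : tension (g n) (Psi n) B. Proof. exact: tension_le (bB n) (tg n). Qed.
Let B0 : 0 <= B. Proof. exact: tension_ge0 (tB 0%N). Qed.

(** Curves, tangents and tensions converge pointwise along [U], and the properties to be inherited
    are pointwise closed conditions. The limit tension yields both the regularity of [G] and the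
    bound on its bending energy; the common modulus of continuity makes the convergence uniform. *)
Lemma ultra_limit_curve : exists G : R -> 'rV[R]_3, [/\
  arc G, D2sym G, bilip c G,
  (forall bl, b n @[n --> U] --> bl -> bending G <= bl) &
  forall e, 0 < e -> \forall n \near U, forall t i,
    `|g n t 0 i - G t 0 i| <= e /\ `|deriv1 (g n) t 0 i - deriv1 G t 0 i| <= e].
Proof.
have lG (z : R * 'I_3) : exists l : R, g n z.1 0 z.2 @[n --> U] --> l.
  by apply: ultra_bounded_cvg => n; exact: arc_D2_bound.
have lD (z : R * 'I_3) : exists l : R, deriv1 (g n) z.1 0 z.2 @[n --> U] --> l.
  by apply: ultra_bounded_cvg => n; apply: le_trans (enorm_coord _ _) _; rewrite (ag n).2.
have lP (z : 'I_3 * R) : exists l : R, Psi n z.1 z.2 @[n --> U] --> l.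
  by apply: ultra_bounded_cvg => n; exact: tension_bound (tB n).
have [Gl hG] := choice lG; have [Dl hD] := choice lD; have [P hP] := choice lP.
pose G t : 'rV[R]_3 := \row_i Gl (t, i); pose D t : 'rV[R]_3 := \row_i Dl (t, i).
have cG t i : g n t 0 i @[n --> U] --> G t 0 i by rewrite mxE; exact: (hG (t, i)).
have cD t i : deriv1 (g n) t 0 i @[n --> U] --> D t 0 i by rewrite mxE; exact: (hD (t, i)).
have cP i t : Psi n i t @[n --> U] --> P (i, t) by exact: (hP (i, t)).
have cst (x : R) : (fun=> x) n @[n --> U] --> x by exact: cvg_cst.
have dG t : derivable G t 1 /\ deriv1 G t = D t.
  apply: deriv1_coordP => i; apply: (is_derive_holder B0) => z z1.
  have l1 : (g n (t + z) 0 i - g n t 0 i - z * deriv1 (g n) t 0 i) ^+ 2 @[n --> U] -->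
      (G (t + z) 0 i - G t 0 i - z * D t 0 i) ^+ 2.
    by apply: ultra_sqr; apply: cvgB; [apply: cvgB|apply: cvgM]; exact: cG || exact: cD || exact: cst.
  by apply: (ultra_le l1 (cst _)) => n; exact: arc_taylor (ag n) (tB n) z1.
have dE t : deriv1 G t = D t by have [] := dG t.
have perG : periodic1 G.
  by move=> t; apply/rowP => i; apply: (ultra_eq (cG _ _) (cG _ _)) => n; rewrite (ag n).1.1.
have ctl i s t : s <= t -> (deriv1 G t 0 i - deriv1 G s 0 i) ^+ 2 <= (t - s) * (P (i, t) - P (i, s)).
  move=> st; rewrite !dE.
  have l1 : (deriv1 (g n) t 0 i - deriv1 (g n) s 0 i) ^+ 2 @[n --> U] --> (D t 0 i - D s 0 i) ^+ 2.
    by apply: ultra_sqr; apply: cvgB; exact: cD.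
  have l2 : (t - s) * (Psi n i t - Psi n i s) @[n --> U] --> (t - s) * (P (i, t) - P (i, s)).
    by apply: cvgM; [exact: cst|apply: cvgB; exact: cP].
  by apply: (ultra_le l1 l2) => n; have [_ _ h _ _] := tg n; exact: h.
have ndP i : {homo (fun t => P (i, t)) : x y / x <= y}.
  by move=> x y xy; apply: (ultra_le (cP i x) (cP i y)) => n; have [h _ _ _ _] := tg n; exact: h.
have wG : W22 G.
  apply: W22I => //; first by move=> t; have [] := dG t.
  by move=> i; exists (fun t => P (i, t)); split => //; exact: ctl.
have aG : arc G.
  split=> // t; rewrite dE; apply/eqP; rewrite -(@eqrXn2 _ 2) ?enorm_ge0// expr1n enorm_sqr.
  have l1 : \sum_i deriv1 (g n) t 0 i ^+ 2 @[n --> U] --> \sum_i D t 0 i ^+ 2.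
    by apply: ultra_sum3 => i; apply: ultra_sqr; exact: cD.
  apply/eqP; by apply: (ultra_eq l1 (cst 1)) => n; rewrite -enorm_sqr (ag n).2 expr1n.
exists G; split => //.
- apply/D2symP => j; apply/funext => t; apply/rowP => i; rewrite /d2act /rep [LHS]mxE.
  have l1 : d2s j i * g n (d2psi j t) 0 i @[n --> U] --> d2s j i * G (d2psi j t) 0 i.
    by apply: cvgM; [exact: cst|exact: cG].
  apply: (ultra_eq l1 (cG t i)) => n.
  by have /D2symP/(_ j) e := sg n; rewrite -[in RHS]e /d2act /rep [RHS]mxE.
- split=> [t|s t h]; first by rewrite aG.2; have [h _] := bg 0%N; have := h t; rewrite (ag 0%N).2.
  rewrite -ler_sqr ?nnegrE ?mulr_ge0 ?enorm_ge0 ?(ltW c0)// enorm_sqr.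
  have l1 : \sum_i (g n t 0 i - g n s 0 i) ^+ 2 @[n --> U] --> \sum_i (G t 0 i - G s 0 i) ^+ 2.
    by apply: ultra_sum3 => i; apply: ultra_sqr; apply: cvgB; exact: cG.
  have -> : \sum_i (G t - G s) 0 i ^+ 2 = \sum_i (G t 0 i - G s 0 i) ^+ 2.
    by apply: eq_bigr => i _; rewrite !mxE.
  apply: (ultra_le (cst ((c * `|t - s|) ^+ 2)) l1) => n.
  have -> : \sum_i (g n t 0 i - g n s 0 i) ^+ 2 = \sum_i (g n t - g n s) 0 i ^+ 2.
    by apply: eq_bigr => i _; rewrite !mxE.
  by rewrite -enorm_sqr ler_sqr ?nnegrE ?mulr_ge0 ?enorm_ge0 ?(ltW c0)//; exact: (bg n).2.
- move=> bl cb; apply: (@tension_bending _ G (fun i t => P (i, t))) => //; split => //.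
  + move=> i x; have l1 : Psi n i x + Psi n i 1 @[n --> U] --> P (i, x) + P (i, 1).
      by apply: cvgD; exact: cP.
    apply: (ultra_eq (cP i (x + 1)) l1) => n; by have [_ h _ _ _] := tg n; rewrite h.
  + move=> i; apply: (ultra_eq (cP i 0) (cst 0)) => n.
    by have [_ _ _ h _] := tg n; rewrite h.
  + have l1 : \sum_i Psi n i 1 @[n --> U] --> \sum_i P (i, 1).
      by apply: ultra_sum3 => i; exact: cP.
    by apply: (ultra_le l1 cb) => n; have [_ _ _ _ h] := tg n.
- move=> e e0; have FU : Filter U by exact: filter_filter.
  have u1 i : \forall n \near U, forall t, `|g n t 0 i - G t 0 i| <= e.
    apply: (@ultra_uniform R U UU (fun n t => g n t 0 i) (fun t => G t 0 i) 9); [by []| | |by move=> t; exact: cG|exact: e0].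
    + by move=> n t; rewrite (ag n).1.1.
    + move=> n s t /andP[st ts]; have := enorm_coord (g n t - g n s) i.
      have := arc_lipschitz s t (ag n); rewrite !mxE ger0_norm ?subr_ge0// => h1 h2.
      rewrite -(real_normK (num_real (_ - _))).
      have h3 := le_trans h2 h1; have h4 := normr_ge0 (g n t 0 i - g n s 0 i).
      by move: (`|_|) h3 h4 => y h3 h4; nra.
  have u2 i : \forall n \near U, forall t, `|deriv1 (g n) t 0 i - deriv1 G t 0 i| <= e.
    apply: (@ultra_uniform R U UU (fun n t => deriv1 (g n) t 0 i) (fun t => deriv1 G t 0 i) B); [exact: B0| | | |exact: e0].
    + by move=> n t; rewrite (deriv1_periodic (ag n).1.1).
    + move=> n s t st; rewrite mulrC; apply: le_trans (tension_holder (tB n) st).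
      have := enorm_coord (deriv1 (g n) t - deriv1 (g n) s) i; rewrite !mxE => hc.
      by rewrite -(real_normK (num_real (_ - _))) ler_sqr ?nnegrE ?enorm_ge0.
    + by move=> t; rewrite dE; exact: cD.
  have a1 := @filter_forall _ _ _ U FU u1; have a2 := @filter_forall _ _ _ U FU u2.
  by apply: (@filterS _ U FU _ _ _ (@filterI _ U FU _ _ a1 a2)) => n [h1 h2] t i.
Qed.

End limit.

Lemma minimising_limit (q theta : R) (k : R -> 'rV[R]_3) (g : nat -> R -> 'rV[R]_3) (m : R) :
  2 < q -> q <= 4 -> 0 < theta ->
  (forall n, arc (g n)) -> (forall n, D2sym (g n)) -> (forall n, injective_period (g n)) ->
  (forall n, knot_type_of k (g n)) ->
  (forall n, Etheta q theta (g n) <= m + n.+1%:R^-1) ->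
  exists G, [/\ arc G, D2sym G, injective_period G, knot_type_of k G & Etheta q theta G <= m].
Proof.
move=> q2 q4 th0 ag sg inj kg hE; pose p := 1 / (q - 2).
have q20 : 0 < q - 2 by rewrite subr_gt0.
have p0 : 0 < p by rewrite divr_gt0.
pose Q n := powR (TP q (g n)) p.
have Q0 n : 0 <= Q n by exact: powR_ge0.
have b0 n : 0 <= bending (g n) by exact: bending_ge0.
have EE n : bending (g n) + theta * Q n <= m + n.+1%:R^-1 by exact: hE.
have E1 n : bending (g n) + theta * Q n <= m + 1.
  apply: le_trans (EE n) _; rewrite lerD2l invf_le1// ler1n//.
have bB n : bending (g n) <= m + 1.
  by apply: le_trans (E1 n); rewrite lerDl mulr_ge0// ltW.
have QB n : Q n <= (m + 1) / theta.
  rewrite ler_pdivlMr// mulrC; apply: le_trans (E1 n); by rewrite lerDr.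
have B0 : 0 <= m + 1 by exact: le_trans (b0 0%N) (bB 0%N).
have TB n : TP q (g n) <= powR ((m + 1) / theta) (1 / p) by exact: powR_root_le p0 (TP_ge0 _ _) (QB n).
have [c c0 hc] := arc_bilip_uniform (powR ((m + 1) / theta) (1 / p)) q2 q4 B0.
have [Psi tg] := choice (fun n => arc_tension (ag n)).
have bil n : bilip c (g n).
  exact: hc (ag n) (inj n) (tension_le (bB n) (tg n)) (TB n).
have [U [UU sub]] := ultraFilterLemma (@eventually_filter).
have [G [aG sG bG lsc unif]] := ultra_limit_curve ag sg tg bB c0 bil.
have [bl cb] : exists l : R, bending (g n) @[n --> U] --> l.
  by apply: (@ultra_bounded_cvg _ U UU _ (m + 1)) => n; rewrite ger0_norm.
have [Ql cQ] : exists l : R, Q n @[n --> U] --> l.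
  by apply: (@ultra_bounded_cvg _ U UU _ ((m + 1) / theta)) => n; rewrite ger0_norm.
have FU : Filter U by exact: filter_filter.
have Em : bl + theta * Ql <= m.
  apply/ler_addgt0Pr => e e0.
  have l1 : bending (g n) + theta * Q n @[n --> U] --> bl + theta * Ql.
    by apply: cvgD => //; apply: cvgM => //; exact: cvg_cst.
  apply: (cvgr_to_le l1).
  have : \forall n \near \oo, n.+1%:R^-1 <= e.
    have /cvgrPdist_le/(_ _ e0) := @cvg_harmonic R; apply: filterS => n.
    by rewrite sub0r normrN ger0_norm// invr_ge0.
  by move=> /sub; apply: filterS => n hn; apply: le_trans (EE n) _; rewrite lerD2l.
have kG : knot_type_of k G.
  have c8 : 0 < c / 8 by rewrite divr_gt0.
  have [n hn] := filter_ex (unif _ c8).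
  apply: (isotopic_close (ag n).1 aG.1 c0 (bil n) _ (kg n)) => t i.
  by rewrite distrC; have [] := hn t i.
exists G; split => //; first exact: bilip_injective aG.1.1 c0 bG.
apply: le_trans Em; rewrite /Etheta -/p; apply: lerD; first exact: lsc.
rewrite ler_wpM2l ?(ltW th0)//; apply/ler_addgt0Pr => e e0.
have Ql0 : 0 <= Ql by apply: (ultra_le (cvg_cst 0) cQ).
have hQ : \forall n \near U, Q n <= Ql + e.
  have /cvgrPdist_le/(_ _ e0) := cQ; apply: filterS => n; rewrite ler_norml; lra.
(* Fatou's lemma works along sequences: [nj] will pick indices from sets large for [U], with [C^1]
   error [1 / (j + 1)] and [Q] at most its limit plus [e]. *)
have sel j : exists n, Q n <= Ql + e /\ forall t i,
    `|g n t 0 i - G t 0 i| <= j.+1%:R^-1 /\ `|deriv1 (g n) t 0 i - deriv1 G t 0 i| <= j.+1%:R^-1.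
  have j0 : 0 < j.+1%:R^-1 :> R by rewrite invr_gt0 ltr0n.
  exact: (filter_ex (filterI hQ (unif _ j0))).
have [nj hnj] := choice sel.
have TPG : TP q G <= powR (Ql + e) (1 / p).
  apply: (@TP_lsc _ q (fun j => g (nj j))) => //.
  - by move=> j; exact: (ag _).1.
  - exact: aG.1.
  - by move=> j; have [] := TP_variation q2 q4 (ag (nj j)).1 (ag (nj j)).1 c0 (bil _).
  - by move=> j; have [h _] := hnj j; exact: powR_root_le p0 (TP_ge0 _ _) h.
  - move=> t i; apply/cvgrPdist_le => d d0.
    have /cvgrPdist_le/(_ _ d0) := @cvg_harmonic R; apply: filterS => j.
    rewrite sub0r normrN ger0_norm ?invr_ge0// => hj; rewrite distrC.
    by apply: le_trans hj; have [_ /(_ t i)[]] := hnj j.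
  - move=> t i; apply/cvgrPdist_le => d d0.
    have /cvgrPdist_le/(_ _ d0) := @cvg_harmonic R; apply: filterS => j.
    rewrite sub0r normrN ger0_norm ?invr_ge0// => hj; rewrite distrC.
    by apply: le_trans hj; have [_ /(_ t i)[]] := hnj j.
have Qe0 : 0 <= Ql + e by rewrite addr_ge0// ltW.
have -> : Ql + e = powR (powR (Ql + e) (1 / p)) p.
  by rewrite -powRrM mul1r mulVf ?gt_eqF// powRr1.
by apply: ge0_ler_powR; rewrite ?nnegrE ?powR_ge0 ?TP_ge0// ltW.
Qed.

End minimising_sequences.

(** * Symmetric minimisers and symmetric criticality *)

Section symmetric_criticality.
Context {R : realType}.
Local Notation mu := (@lebesgue_measure R).
Implicit Types (g h : R -> 'rV[R]_3).

Lemma injective_period_near g x y : periodic1 g -> injective_period g ->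
  `|x - y| < 1 -> g x = g y -> x = y.
Proof.
move=> pg inj xy e.
have e1 := periodic_red x pg; have e2 := periodic_red y pg.
have := inj _ _ (frac_itv x) (frac_itv y); rewrite -e1 -e2 => /(_ e) e3.
have : x - y = (Num.floor x - Num.floor y)%:~R by rewrite intrB; lra.
move: (_ - Num.floor y) => z rz; move: xy; rewrite rz -intr_norm (ltr_int R _ 1).
rewrite -[1%R]/(0%:Z + 1)%R ltzD1 normr_le0 => /eqP z0.
by apply/eqP; rewrite -subr_eq0 rz z0.
Qed.

Lemma arc_length_1 g : arc g -> curve_length g = 1.
Proof.
move=> ag; rewrite /curve_length; under eq_Rintegral do rewrite ag.2.
by rewrite Rintegral_itv_cst// subr0 mulr1.
Qed.

Lemma Etheta_rep q theta sg tau dtau s g : reparam sg tau dtau -> (forall i, s i ^+ 2 = 1) ->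
  W22 g -> W22 (rep s tau g) -> Etheta q theta (rep s tau g) = Etheta q theta g.
Proof.
by move=> rt s1 wg wr; rewrite /Etheta (bending_rep rt s1 wg wr) (TP_rep rt s1 wg).
Qed.

(** Energy, symmetry and image survive the passage to arclength, so the infimum is approached by
    unit-speed curves. *)
Lemma CK_arc_normal_form k g : CK k g -> D2sym g -> exists g',
  [/\ arc g', D2sym g', injective_period g', knot_type_of k g' &
      forall q theta, Etheta q theta g' = Etheta q theta g].
Proof.
move=> [wg [l1 [v0 [inj kg]]]] sym.
have [tau [dtau [rt mono wr u1 sr]]] := arclength_reparam wg l1 v0.
exists (fun t => g (tau t)).
have [_ _ _ surj tp] := rt.
split.
- by split.
- exact: sr.
- move=> s t /andP[s0 s1] /andP[t0 t1] e.
  have t01 : tau 1 = tau 0 + 1 by rewrite -[in LHS](add0r 1) tp.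
  have lt1 x : x < 1 -> tau x < tau 0 + 1 by move=> x1; rewrite -t01 (leW_mono mono).
  have ge0 x : 0 <= x -> tau 0 <= tau x by move=> x0; rewrite mono.
  have d : `|tau s - tau t| < 1.
    have := lt1 _ s1; have := lt1 _ t1; have := ge0 _ s0; have := ge0 _ t0.
    by rewrite ltr_norml; lra.
  have := injective_period_near wg.1 inj d e.
  exact: (inc_inj mono).
- rewrite /knot_type_of (_ : range (fun t => g (tau t)) = range g)//.
  apply/seteqP; split => [_ [t _ <-]|_ [t _ <-]]; first by exists (tau t).
  by have [x <-] := surj t; exists x.
- move=> q theta; have E : (fun t => g (tau t)) = rep (fun=> 1) tau g.
    by apply/funext => t; apply/rowP => i; rewrite /rep !mxE mul1r.
  rewrite E; apply: (Etheta_rep _ _ rt); [by move=> i; rewrite expr1n|exact: wg|by rewrite -E].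
Qed.

Lemma symmetric_minimiser q theta k : 2 < q -> q <= 4 -> 0 < theta ->
  (exists g, CK k g /\ D2sym g) ->
  exists G, [/\ arc G, D2sym G, injective_period G, knot_type_of k G &
    forall g, CK k g -> D2sym g -> Etheta q theta G <= Etheta q theta g].
Proof.
move=> q2 q4 th0 [g0 [ck0 sym0]].
pose S := [set x : R | exists g, [/\ CK k g, D2sym g & x = Etheta q theta g]].
have E0 g : 0 <= Etheta q theta g.
  by rewrite /Etheta addr_ge0 ?bending_ge0// mulr_ge0 ?powR_ge0// ltW.
have hS : has_inf S.
  split; first by exists (Etheta q theta g0), g0.
  by exists 0 => _ [g [_ _ ->]].
have sel n : exists g, [/\ arc g, D2sym g, injective_period g, knot_type_of k g &
    Etheta q theta g <= inf S + n.+1%:R^-1].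
  have n0 : 0 < n.+1%:R^-1 :> R by rewrite invr_gt0 ltr0n.
  have [_ [g [ck sym ->]] /ltW hg] := inf_adherent n0 hS.
  have [g' [ag sg ig kg eg]] := CK_arc_normal_form ck sym.
  by exists g'; split; [exact: ag|exact: sg|exact: ig|exact: kg|rewrite eg].
have [g hg] := choice sel.
have [|n|n|n|n|G [aG sG iG kG hG]] := @minimising_limit R q theta k g (inf S) q2 q4 th0.
- by move=> n; have [] := hg n.
- by have [] := hg n.
- by have [] := hg n.
- by have [] := hg n.
- by have [] := hg n.
exists G; split; [exact: aG|exact: sG|exact: iG|exact: kG|] => h ck sym; apply: le_trans hG _.
by apply: ge_inf; [exact: hS.2|exists h].
Qed.

(** Difference quotients with steps [1 / (n + 1)] are eventually nonnegative; the reflected function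
    gives the opposite sign. *)
Lemma fermat_min (f : R -> R) (l d : R) : is_derive (0 : R) 1 f l -> 0 < d ->
  (forall e, `|e| < d -> f 0 <= f e) -> l = 0.
Proof.
have half (f' : R -> R) (l' : R) : is_derive (0 : R) 1 f' l' -> 0 < d -> (forall e, `|e| < d -> f' 0 <= f' e) -> 0 <= l'.
  move=> df d0 hm; have cv := derivable_quotient_cvg df.
  apply: (cvgr_to_ge cv).
  have /cvgrPdist_lt/(_ _ d0) := @cvg_harmonic R; apply: filterS => n.
  rewrite sub0r normrN => hn; rewrite add0r mulr_ge0// subr_ge0 hm//.
move=> df d0 hm; apply/eqP; rewrite eq_le (half f)// andbT -oppr_ge0.
apply: (half (fun x => f (- x))) => //; last by move=> e he; rewrite oppr0 hm// normrN.
have h1 : is_derive (-1 * 0 + 0 : R) (1 : R) f l by rewrite mulr0 addr0.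
have := @is_derive_affine R f (fun=> l) (-1) 0 0 h1; rewrite mulN1r.
by under eq_fun do rewrite mulN1r addr0.
Qed.

Lemma d2act_W22 j h : W22 h -> W22 (d2act j h).
Proof.
move=> wh; have [dp _ _ _ tp] := @d2psi_reparam R j.
have dr t := @rep_deriv R (d2s j) (d2psi j) (fun=> (-1) ^+ (j != 1)) h t (wh.2.1 _) (dp t).
apply: W22I.
- move=> t; rewrite /d2act /rep tp; congr sgmul.
  by case: (j != 1) => /=; rewrite ?expr0 ?expr1 ?wh.1// -[in RHS](subrK 1 (d2psi j t)) wh.1.
- by move=> t; have [] := dr t.
- move=> i; have -> : (fun t => deriv1 (d2act j h) t 0 i) =
      (fun t => ((-1) ^+ (j != 1) * d2s j i) * deriv1 h (d2psi j t) 0 i).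
    by apply/funext => t; have [_ ->] := dr t; rewrite !mxE mulrA.
  apply: H1_scale; rewrite /d2psi; have hh := H1_shift (d2off j) (W22_H1 i wh).
  case: (j != 1) => /=; last by under eq_fun do rewrite expr0 mul1r.
  by under eq_fun do rewrite expr1 mulN1r; exact: (H1_opp hh).
Qed.

Lemma d2act_add j g h : d2act j (fun t => g t + h t) = (fun t => d2act j g t + d2act j h t).
Proof. by apply/funext => t; rewrite /d2act /rep sgmulD. Qed.

Lemma d2act_scale j (c : R) g : d2act j (fun t => c *: g t) = (fun t => c *: d2act j g t).
Proof. by apply/funext => t; rewrite /d2act /rep sgmulZ. Qed.

Lemma d2act_vary j g h (e : R) : d2act j g = g ->
  d2act j (vary g h e) = vary g (d2act j h) e.
Proof. by move=> gj; rewrite /vary d2act_add gj d2act_scale. Qed.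

Definition d2sum h : R -> 'rV[R]_3 :=
  fun t => ((h t + d2act 0 h t) + d2act 1 h t) + d2act 2%:R h t.

Lemma d2sum_W22 h : W22 h -> W22 (d2sum h).
Proof. by move=> wh; do 3 (apply: W22D; last exact: d2act_W22). Qed.

(** Each half-turn permutes the four summands, since composing two of the parameter maps gives the
    third up to a period. *)
Lemma d2sum_sym h : periodic1 h -> D2sym (d2sum h).
Proof.
move=> ph.
have p0 t : d2psi 0 t = - t + 1 / 2 :> R by rewrite /d2psi /d2off/= expr1 mulN1r.
have p1 t : d2psi 1 t = t - 1 / 2 :> R by rewrite /d2psi /d2off/= expr0 mul1r.
have p2 t : d2psi 2%:R t = - t :> R by rewrite /d2psi /d2off/= expr1 mulN1r addr0.
have HE t : d2sum h t = ((h t + sgmul (d2s 0) (h (- t + 1 / 2))) + sgmul (d2s 1) (h (t - 1 / 2))) +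
    sgmul (d2s 2%:R) (h (- t)) by rewrite /d2sum /d2act /rep p0 p1 p2.
have phm t : h (t - 1) = h t by rewrite -[in RHS](subrK 1 t) ph.
have cases (i : 'I_3) : [\/ i = 0, i = 1 | i = 2%:R].
  case: i => [[|[|[|//]]]] p; [constructor 1|constructor 2|constructor 3]; exact: val_inj.
move=> t; rewrite !HE; split; [|split]; apply/rowP => i.
- have -> : - (- t + 1 / 2) + 1 / 2 = t by field.
  have -> : - t + 1 / 2 - 1 / 2 = - t by field.
  have -> : - (- t + 1 / 2) = t - 1 / 2 by field.
  by case: (cases i) => ->; rewrite !mxE /d2s /=; ring.
- have -> : h (- (t - 1 / 2) + 1 / 2) = h (- t) by rewrite -(ph (- t)); congr h; field.
  have -> : h (t - 1 / 2 - 1 / 2) = h t by rewrite -(phm t); congr h; field.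
  have -> : - (t - 1 / 2) = - t + 1 / 2 by field.
  by case: (cases i) => ->; rewrite !mxE /d2s /=; ring.
- have -> : h (- - t + 1 / 2) = h (t - 1 / 2) by rewrite -(ph (t - 1 / 2)); congr h; field.
  have -> : h (- t - 1 / 2) = h (- t + 1 / 2) by rewrite -(phm (- t + 1 / 2)); congr h; field.
  rewrite opprK.
  by case: (cases i) => ->; rewrite !mxE /d2s /=; ring.
Qed.

(* Symmetric criticality: an invariant functional has the same derivative in the direction
   [h] and in each direction of its orbit. *)
Lemma dirD_d2sum (F : (R -> 'rV[R]_3) -> R) g h : W22 g -> W22 h -> D2sym g -> gateaux F g ->
  (forall j w, W22 w -> F (d2act j w) = F w) -> dirD F g (d2sum h) = 4 * dirD F g h.
Proof.
move=> wg wh /D2symP sym gF inv.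
have orb j : dirD F g (d2act j h) = dirD F g h.
  have E : (fun e : R => F (vary g (d2act j h) e)) = (fun e : R => F (vary g h e)).
    apply/funext => e.
    by rewrite -(d2act_vary h e (sym j)) (inv j _ (vary_W22 e wg wh)).
  by rewrite /dirD E.
have w1 := W22D wh (d2act_W22 0 wh); have w2 := W22D w1 (d2act_W22 1 wh).
rewrite /d2sum (gF.2 _ _ w2 (d2act_W22 2%:R wh)) (gF.2 _ _ w1 (d2act_W22 1 wh)).
rewrite (gF.2 _ _ wh (d2act_W22 0 wh)).
by rewrite !orb; ring.
Qed.

Lemma length_d2act j g : W22 g -> curve_length (d2act j g) = curve_length g.
Proof. by move=> wg; exact: (length_rep (d2psi_reparam j) (d2s_sqr j) wg). Qed.

Lemma Etheta_d2act q theta j g : W22 g -> Etheta q theta (d2act j g) = Etheta q theta g.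
Proof.
move=> wg.
exact: (Etheta_rep q theta (d2psi_reparam j) (d2s_sqr j) wg (d2act_W22 j wg)).
Qed.

(* Small variations stay in the knot class; rescaling restores the length constraint, and
   [length * energy] is scale invariant. *)
Lemma vary_competitor k g h : arc g -> D2sym g -> injective_period g -> knot_type_of k g ->
  W22 h -> D2sym h -> exists2 d : R, 0 < d & forall e, `|e| < d ->
  0 < curve_length (vary g h e) /\
  CK k (fun t => (curve_length (vary g h e))^-1 *: vary g h e t) /\
  D2sym (fun t => (curve_length (vary g h e))^-1 *: vary g h e t).
Proof.
move=> ag /D2symP sg ig kg wh /D2symP sh; have wg := ag.1.
have [c c0 bc] := arc_bilip ag ig.
have [L [dl [dl0 dl1 hu hD hh]]] := vary_bounds wg wh c0 bc.
have L0 : 0 <= L by have [hL _] := hh 0 0; exact: le_trans (enorm_ge0 _) hL.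
have c2 : 0 < c / 2 by rewrite divr_gt0.
(* [c / 8] is the closeness that [isotopic_close] tolerates, and [1 + L] exceeds the speed of
   [h]. *)
exists (Num.min dl (c / 8 / (1 + L))).
  by rewrite lt_min dl0 !divr_gt0//; lra.
move=> e; rewrite lt_min => /andP[e1 e2].
have wv : W22 (vary g h e) by exact: vary_W22.
have bv : bilip (c / 2) (vary g h e).
  split=> [t|s t st]; first by rewrite vary_deriv//; have /andP[] := hu e t e1.
  have /andP[+ _] := hD e s t e1 st; congr (_ <= enorm _).
  by apply/rowP => i; rewrite !mxE; ring.
have l0 : 0 < curve_length (vary g h e).
  apply: lt_le_trans c2 _; rewrite -[c / 2]mulr1 -[X in _ * X](subr0 1) -Rintegral_itv_cst//.
  apply: le_Rintegral => //.
  - exact: continuous_itv_integrable (fun x => cvg_cst _).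
  - exact: continuous_itv_integrable (W22_speed_continuous wv).
  - by move=> t _; exact: bv.1.
set l := curve_length _ in l0 *; split; [exact: l0|]; have li : 0 < l^-1 by rewrite invr_gt0.
split; last first.
  by apply/D2symP => j; rewrite d2act_scale d2act_vary// sh.
split; first exact: W22Z.
split; first by rewrite length_scale// mulVf// gt_eqF.
split.
  move=> t; have [_ ->] := deriv1Z l^-1 (wv.2.1 t).
  by rewrite enormZ gtr0_norm// mulr_gt0//; apply: lt_le_trans c2 (bv.1 t).
split.
  move=> s t hs ht /(scalerI (lt0r_neq0 li)).
  exact: (bilip_injective wv.1 c2 bv).
apply: ambient_isotopic_scale => //.
apply: (isotopic_close wg wv c0 bc _ kg) => t i.
rewrite vary_deriv// !mxE addrAC subrr add0r normrM.
have h1 : `|deriv1 h t 0 i| <= L by apply: le_trans (enorm_coord _ _) _; have [] := hh t t.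
have h2 : `|e| * (1 + L) <= c / 8 by rewrite -ler_pdivlMr ?ltW//; lra.
apply: le_trans h2; rewrite ler_wpM2l//; lra.
Qed.

Lemma minimiser_first_variation q theta k g h c : 2 < q -> arc g -> D2sym g ->
  injective_period g -> knot_type_of k g ->
  (forall g', CK k g' -> D2sym g' -> Etheta q theta g <= Etheta q theta g') ->
  0 < c -> bilip c g -> gateaux (Etheta q theta) g -> W22 h -> D2sym h ->
  dirD (Etheta q theta) g h + Etheta q theta g * dirD (@curve_length R) g h = 0.
Proof.
move=> q2 ag sg ig kg hmin c0 bc gE wh sh.
have gL := length_gateaux ag.1 c0 bc.
have [d d0 hd] := vary_competitor ag sg ig kg wh sh.
have dL := gateaux_dirD gL wh; have dE := gateaux_dirD gE wh.
(* The length of [g] is 1, so the derivative of this product at 0 carries the energy itself as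
   multiplier. *)
pose phi e := curve_length (vary g h e) * Etheta q theta (vary g h e).
have dphi : is_derive (0 : R) 1 phi (Etheta q theta g * dirD (@curve_length R) g h +
    dirD (Etheta q theta) g h).
  have := is_deriveM dL dE; rewrite /GRing.scale/= vary0 (arc_length_1 ag) mul1r addrC.
  exact.
rewrite addrC; apply: (fermat_min dphi d0) => e he.
have -> : phi 0 = Etheta q theta g by rewrite /phi vary0 (arc_length_1 ag) mul1r.
have [l0 [ck sym]] := hd e he; apply: le_trans (hmin _ ck sym) _.
by rewrite Etheta_scale ?invr_gt0 ?invrK//; exact: vary_W22 ag.1 wh.
Qed.

End symmetric_criticality.

Theorem theorem1p1 (R : realType) (q : R) (k : R -> 'rV[R]_3) :
  2 < q -> q <= 4 ->
  C1_knot k ->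
  (exists g, CK k g /\ D2sym g) ->
  forall theta : R, 0 < theta ->
  exists Gamma : R -> 'rV[R]_3,
    CK k Gamma /\ (forall t, enorm (deriv1 Gamma t) = 1) /\ D2sym Gamma /\
    forall h : R -> 'rV[R]_3, W22 h ->
      exists dE dL : R,
        has_dir_deriv (Etheta q theta) Gamma h dE /\
        has_dir_deriv (@curve_length R) Gamma h dL /\
        dE + Etheta q theta Gamma * dL = 0.
Proof.
move=> q2 q4 _ exg theta th0.
have [G [aG sG iG kG hmin]] := symmetric_minimiser q2 q4 th0 exg.
have [c c0 bc] := arc_bilip aG iG.
have gL := length_gateaux aG.1 c0 bc.
have gE := Etheta_gateaux theta q2 q4 aG.1 c0 bc (D2_TP_gt0 q2 q4 aG iG sG).
exists G; split.
  split; first exact: aG.1.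
  split; first exact: arc_length_1.
  split; first by move=> t; rewrite aG.2.
  by split.
split; first exact: aG.2.
split; first exact: sG.
move=> h wh; exists (dirD (Etheta q theta) G h), (dirD (@curve_length R) G h).
split; first exact/has_dir_derivP/(gateaux_dirD gE wh).
split; first exact/has_dir_derivP/(gateaux_dirD gL wh).
have := minimiser_first_variation q2 aG sG iG kG hmin c0 bc gE (d2sum_W22 wh) (d2sum_sym wh.1).
rewrite (dirD_d2sum aG.1 wh sG gE (Etheta_d2act q theta)).
rewrite (dirD_d2sum aG.1 wh sG gL length_d2act); lra.
Qed.
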